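(* Assume $P(I=0)<1$, the Markov chain $(Y_n)_{n\ge0}$ is irreducible, and Assumption A holds: $E[J^2]<\infty$, $E[I^2]<\infty$, $E[X]=1$, $E[X^3]<\infty$. Let $\theta=\frac{2}{\sigma^2}(\mu+\nu-\rho)$. Then $(Y_n)$ is: - transient, if $\theta>1$; - null-recurrent, if $0<\theta\le 1$, and also if $\theta=0$ and Assumption B holds: $E[J^3]<\infty$, $E[I^3]<\infty$, $E[X]=1$, $E[X^4]<\infty$; - positive recurrent, if $\theta<0$.
   Context: Let $I,J,K,X$ be $\mathbb N_0$-valued random variables, $\mathbb N_0=\{0,1,2,\dots\}$, with $P(J>0)=1$ and $K\sim\mathrm{Geo}(1-p)$ for some $0<p<1$, i.e. $P(K=k)=(1-p)p^k$ for $k\ge 0$. Let $(I_n)$, $(J_n)$, $(K_n)$, $(X_{m,n})$ ($n\ge0$, $m\ge1$) be i.i.d. copies of $I,J,K,X$ respectively, all jointly independent. The branching process $(Y_n)_{n\ge 0}$ is the Markov chain on $\mathbb N_0$ with given $Y_0$ and $$Y_{n+1}=\Bigl(J_n+\sum_{m=1}^{Y_n+I_n-K_n}X_{m,n}\Bigr)\mathbf 1_{\{K_n<Y_n+I_n\}},\qquad n\ge 0.$$ Notation: $\mu=E[I]$, $\nu=E[J]$, $\rho=E[K]=p/(1-p)$, $\sigma^2=\mathrm{Var}(X)$, and it is assumed throughout that $\sigma^2>0$. *)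

(* Defs.v *)
From HB Require Import structures.
From mathcomp Require Import all_boot all_order all_algebra.
From mathcomp Require Import all_classical all_reals all_analysis.

Set Implicit Arguments.
Unset Strict Implicit.
Unset Printing Implicit Defensive.

Import Order.TTheory GRing.Theory Num.Theory.
Import numFieldNormedType.Exports.

Local Open Scope classical_set_scope.
Local Open Scope ring_scope.
Local Open Scope ereal_scope.

Section random_variables.
Context {d : measure_display} {Omega : measurableType d} {R : realType}.
Variable P : probability Omega R.

Definition same_law (U V : {RV P >-> nat}) : Prop :=
  forall A : set nat, distribution P U A = distribution P V A.

(* Product rule over every finite subfamily, a subfamily being listed by a
   duplicate-free sequence of indices. *)
Definition mutually_independent (T : eqType) (U : T -> {RV P >-> nat}) : Prop :=
  forall (s : seq T) (B : T -> set nat), uniq s ->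
    P (\bigcap_(i in [set` s]) (U i @^-1` B i)) =
    \prod_(i <- s) P (U i @^-1` B i).

Definition real_of (U : Omega -> nat) : Omega -> R := fun w => (U w)%:R%R.

Definition mean (U : Omega -> nat) : R := fine 'E_P[real_of U].

Definition finite_moment (k : nat) (U : Omega -> nat) : Prop :=
  'E_P[(fun w => real_of U w ^+ k)%R] < +oo.

Definition geometric_law (p : R) (U : Omega -> nat) : Prop :=
  forall k : nat, P [set w | U w = k] = ((1 - p) * p ^+ k)%R%:E.

End random_variables.

Section markov_chains.
Context {d : measure_display} {Omega : measurableType d} {R : realType}.
Variable P : probability Omega R.

(* A Markov chain on nat is given through all its deterministic starting
   points: Y y n is the state at time n of the chain started from Y_0 = y,
   so that the law of Y y under P is the usual P_y. *)
Variable Y : nat -> nat -> Omega -> nat.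

Definition irreducible_chain : Prop :=
  forall x y : nat, exists n : nat, 0 < P [set w | Y x n w = y].

(* First return time to y of the chain started from y; +oo if none. *)
Definition return_time (y : nat) (w : Omega) : \bar R :=
  ereal_inf [set n%:R%:E | n in [set n : nat | (0 < n)%N /\ Y y n w = y]].

Definition return_probability (y : nat) : \bar R :=
  P [set w | return_time y w < +oo].

Definition mean_return_time (y : nat) : \bar R := \int[P]_w return_time y w.

Definition transient_chain : Prop := forall y, return_probability y < 1.

Definition null_recurrent_chain : Prop :=
  forall y, return_probability y = 1 /\ mean_return_time y = +oo.

Definition positive_recurrent_chain : Prop :=
  forall y, return_probability y = 1 /\ mean_return_time y < +oo.

End markov_chains.

Section branching_process.
Context {d : measure_display} {Omega : measurableType d} {R : realType}.
Context {P : probability Omega R}.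
Variables (I_ J_ K_ : nat -> {RV P >-> nat}) (X_ : nat -> nat -> {RV P >-> nat}).

(* X_ m n is only used for m >= 1, hence the shift of its first index. *)
Definition innovations (i : (nat + nat) + (nat + nat * nat)) : {RV P >-> nat} :=
  match i with
  | inl (inl n) => I_ n
  | inl (inr n) => J_ n
  | inr (inl n) => K_ n
  | inr (inr (m, n)) => X_ m.+1 n
  end.

Fixpoint branching (y n : nat) (w : Omega) : nat :=
  if n is n'.+1 then
    let N := (branching y n' w + I_ n' w)%N in
    if (K_ n' w < N)%N then
      (J_ n' w + \sum_(1 <= m < (N - K_ n' w).+1) X_ m n' w)%N
    else 0%N
  else y.

End branching_process.

Definition theta {d : measure_display} {Omega : measurableType d}
    {R : realType} (P : probability Omega R) (I J K X : Omega -> nat) : R :=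
  (2 / fine 'V_P[real_of X] * (mean P I + mean P J - mean P K))%R.

Definition assumptionA {d : measure_display} {Omega : measurableType d}
    {R : realType} (P : probability Omega R) (I J X : Omega -> nat) : Prop :=
  [/\ finite_moment P 2 J, finite_moment P 2 I,
      'E_P[real_of X] = 1 & finite_moment P 3 X].

Definition assumptionB {d : measure_display} {Omega : measurableType d}
    {R : realType} (P : probability Omega R) (I J X : Omega -> nat) : Prop :=
  [/\ finite_moment P 3 J, finite_moment P 3 I,
      'E_P[real_of X] = 1 & finite_moment P 4 X].

(* Main.v *)
Require Import Defs.
From HB Require Import structures.
From mathcomp Require Import all_boot all_order all_algebra.
From mathcomp Require Import all_classical all_reals all_analysis.
From mathcomp Require Import measurable_realfun ring lra zify.

Set Implicit Arguments.
Unset Strict Implicit.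
Unset Printing Implicit Defensive.

Import Order.TTheory GRing.Theory Num.Theory.
Import numFieldNormedType.Exports.

Local Open Scope classical_set_scope.
Local Open Scope ring_scope.
Local Open Scope ereal_scope.

(** One step of the chain acts exactly on exponentials, and this is what the
    proof exploits.  Let [phi], [h], [iota] be the generating functions of [X],
    [J], [I].  As [K] is geometric, summing over its values is a geometric sum,
    so that for a population [x]
      [E s ^ Y_1 = g s * phi s ^ x + e s * p ^ x],
    with [g = al * iota (phi s)], [e = (1 - al) * iota p] and
    [al = h * phi * (1 - p) / (phi - p)] ([Ex_one_step_exp]).  The second term
    accounts for the catastrophes and is negligible for large [x].  With
    [s = 1 - t], [c = mu + nu - rho] and [b = sigma ^ 2 / 2], so that
    [theta = c / b], the moment assumptions give
      [1 - phi (1 - t) = t - b t ^ 2 + O(t ^ 3)], [g = 1 - c t + O(t ^ 2)],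
      [e = O(t)]                                       ([one_step_expansion]).
    Hence one step moves [s_k ^ x] to [s_(k+1) ^ x], where [s_(k+1) = phi s_k],
    [t_k = 1 - s_k] behaves like [1 / (b k)], and the cost is a factor
    [1 - c t_k].  All test functions are mixtures of these exponentials.

    If [theta > 1], take [F x = \sum_k w_k s_k ^ x] with [w_(k+1) = w_k g_k].
    One step shifts the sum by one index and loses the first term, so [F] is
    superharmonic far from 0; it is positive and tends to 0 because [w_k], which
    decays like [k ^ (- theta)], is summable.  This forces transience
    ([pgf_transient]).

    If [theta <= 1], take [F x = \sum_k w_k (1 - s_k ^ x)] with
    [w_k = t_k + M t_k ^ 2].  For large [M] these weights decrease fast enough
    for [F] to be superharmonic far from 0, [\sum_k w_k] diverges, so that [F]
    is unbounded, and [\sum_k w_k t_k] converges, so that [F] is finite.  The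
    maximum principle then gives recurrence ([pgf_recurrent]).

    The slopes [(1 - s ^ x) / (1 - s)] tend to [x] as [s] tends to 1, so the same
    identity yields the drift of the population size: it is [c] up to a multiple
    of [p ^ x].  If [theta < 0] it is negative far from 0, and the return times
    have finite mean ([pgf_positive_recurrent]).

    If [0 <= theta], the drift is non-negative far from 0 (when [c = 0] the
    multiple of [p ^ x] has coefficient [iota p * mu]).  Suppose that the mean
    time [m x] to reach a state [y] from [x] were finite.  The slopes are bounded
    functions whose drift is bounded below uniformly in [s], whence
    [x <= C (1 + m x)].  So the positive part of [x - y0], which is subharmonic
    for the chain killed at [y], is dominated by a multiple of [m]; but
    the expectation of [m] over the chain not yet killed at time [n] is a tail of
    the convergent series [m x], and tends to 0.  This is absurd, and the return
    times have infinite mean ([pgf_not_positive]). *)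

(** * Expectations of functions of a discrete variable *)

Section discrete_expectation.
Context {d : measure_display} {Omega : measurableType d} {R : realType}.
Variable P : probability Omega R.

Definition Ex (U : Omega -> nat) (h : nat -> \bar R) : \bar R :=
  \int[P]_w h (U w).

Lemma measurable_level (U : Omega -> nat) : measurable_fun setT U ->
  forall A : set nat, measurable (U @^-1` A).
Proof. by move=> mU A; rewrite -[_ @^-1` _]setTI; exact: mU. Qed.

Lemma measurable_of_levels (U : Omega -> nat) :
  (forall v, measurable (U @^-1` [set v])) -> measurable_fun setT U.
Proof.
move=> mU _ B _; rewrite setTI.
have -> : U @^-1` B = \bigcup_(v in B) (U @^-1` [set v]).
  apply/seteqP; split=> [w Bw|w [v Bv /= Uw]]; first by exists (U w).
  by rewrite /preimage /= Uw.
by apply: bigcup_measurable => v _; exact: mU.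
Qed.

Lemma measurable_nat_comp (U : Omega -> nat) (h : nat -> \bar R) :
  measurable_fun setT U -> measurable_fun [set: Omega] (h \o U).
Proof. by move=> mU _ B _; rewrite setTI; exact: (measurable_level mU (h @^-1` B)). Qed.

Variables (U : Omega -> nat) (mU : measurable_fun setT U).
Implicit Types h : nat -> \bar R.

Lemma Ex_ge0 h : (forall v, 0 <= h v) -> 0 <= Ex U h.
Proof. by move=> h0; apply: integral_ge0. Qed.

Lemma Ex_le h1 h2 : (forall v, 0 <= h1 v) -> (forall v, h1 v <= h2 v) ->
  Ex U h1 <= Ex U h2.
Proof. by move=> h0 h12; apply: ge0_le_integral => //; exact: measurable_nat_comp. Qed.

Lemma ExD h1 h2 : (forall v, 0 <= h1 v) -> (forall v, 0 <= h2 v) ->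
  Ex U (fun v => h1 v + h2 v) = Ex U h1 + Ex U h2.
Proof. by move=> h10 h20; apply: ge0_integralD => //; exact: measurable_nat_comp. Qed.

Lemma ExZ k h : 0 <= k -> (forall v, 0 <= h v) ->
  Ex U (fun v => k * h v) = k * Ex U h.
Proof. by move=> k0 h0; apply: ge0_integralZl => //; exact: measurable_nat_comp. Qed.

Lemma Ex_cst k : Ex U (fun=> k) = k.
Proof.
by rewrite /Ex integral_cst// [X in _ * X](_ : _ = 1) ?mule1//; exact: probability_setT.
Qed.

Lemma Ex_sum (I : Type) (s : seq I) (h : I -> nat -> \bar R) :
  (forall i v, 0 <= h i v) ->
  Ex U (fun v => \sum_(i <- s) h i v) = \sum_(i <- s) Ex U (h i).
Proof.
by move=> h0; apply: ge0_integral_sum => // i; exact: measurable_nat_comp.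
Qed.

Lemma Ex_nneseries (h : nat -> nat -> \bar R) : (forall n v, 0 <= h n v) ->
  Ex U (fun v => \sum_(n <oo) h n v) = \sum_(n <oo) Ex U (h n).
Proof.
by move=> h0; apply: integral_nneseries => // n; exact: measurable_nat_comp.
Qed.

(** Splitting along the values of the discrete variable is what turns the
    product rule for events into a rule for integrals. *)
Lemma integral_levels (B : set Omega) (f : Omega -> \bar R) : measurable B ->
  measurable_fun setT f -> (forall w, 0 <= f w) ->
  \int[P]_(w in B) f w = \sum_(v <oo) \int[P]_(w in B `&` U @^-1` [set v]) f w.
Proof.
move=> mB mf f0.
have EB : B = \bigcup_v (B `&` U @^-1` [set v]).
  by apply/seteqP; split=> [w Bw|w [v _ []]] //; exists (U w).
rewrite {1}EB ge0_integral_bigcup//.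
- by move=> k; apply: measurableI => //; exact: measurable_level.
- exact: measurable_funS mf.
- apply/trivIsetP => i j _ _ /eqP ij; rewrite -subset0 => w [[_ Ui] [_ Uj]].
  by case: ij; rewrite -Ui -Uj.
Qed.

Lemma Ex_series h : (forall v, 0 <= h v) ->
  Ex U h = \sum_(v <oo) P (U @^-1` [set v]) * h v.
Proof.
move=> h0; rewrite /Ex (integral_levels measurableT)//; last exact: measurable_nat_comp.
apply: eq_eseriesr => v _; rewrite setTI.
rewrite (eq_integral (fun=> h v)); last by move=> w; rewrite inE /= => ->.
by rewrite integral_cst 1?[RHS]muleC//; exact: measurable_level.
Qed.

Lemma Ex_ge_level h z : (forall v, 0 <= h v) ->
  P (U @^-1` [set z]) * h z <= Ex U h.
Proof.
move=> h0; rewrite Ex_series// (@nneseriesD1 _ _ z xpredT)//; last first.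
  by move=> k _; apply: mule_ge0.
by rewrite leeDl// nneseries_ge0// => n _ _; apply: mule_ge0.
Qed.

Lemma Ex_gt0 h : (forall v, 0 <= h v) -> 0 < Ex U h ->
  exists2 z, 0 < P (U @^-1` [set z]) & 0 < h z.
Proof.
move=> h0; rewrite Ex_series// => lt0.
apply: contrapT => H.
move: lt0; rewrite eseries0 ?ltxx// => v _ _.
have [->|hv] := eqVneq (h v) 0; first by rewrite mule0.
have [->|pv] := eqVneq (P (U @^-1` [set v])) 0; first by rewrite mul0e.
by exfalso; apply: H; exists v; rewrite lt0e ?hv ?pv ?h0 ?measure_ge0.
Qed.

(** [Ex_le0] and [Ex_max] are the local form of the maximum principle: a function
    that is on average as large as its maximum equals it at every successor. *)
Lemma Ex_le0 h z : (forall v, 0 <= h v) -> Ex U h <= 0 ->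
  0 < P (U @^-1` [set z]) -> h z = 0.
Proof.
move=> h0 Eh pz; apply/eqP; rewrite eq_le h0 andbT leNgt; apply/negP => hz.
have := le_trans (Ex_ge_level z h0) Eh.
by rewrite leNgt mule_gt0.
Qed.

Lemma Ex_max (c : R) h z : (forall v, 0 <= h v) -> (forall v, h v <= c%:E) ->
  c%:E <= Ex U h -> 0 < P (U @^-1` [set z]) -> h z = c%:E.
Proof.
move=> h0 hc Eh pz.
have hfin v : h v \is a fin_num.
  by rewrite ge0_fin_numE// (le_lt_trans (hc v))// ltry.
have g0 v : 0 <= c%:E - h v by rewrite sube_ge0 ?hc ?hfin ?orbT.
have : Ex U (fun v => c%:E - h v) <= 0.
  rewrite -(@leeD2rE _ c%:E)// add0e.
  apply: le_trans (leeD2l _ Eh) _.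
  rewrite -ExD//.
  rewrite (_ : (fun v => _) = (fun=> c%:E)) ?Ex_cst//.
  by apply/funext => v; rewrite subeK.
move=> /(Ex_le0 g0) /(_ pz) /eqP.
by rewrite sube_eq ?fin_num_adde_defl// add0e => /eqP.
Qed.

(** The complement is treated by adding rather than subtracting, since the
    additivity of integrals of non-negative functions needs no integrability. *)
Lemma Ex_onem (h : nat -> R) (a : R) : (forall v, 0 <= h v <= 1)%R ->
  Ex U (EFin \o h) = a%:E -> Ex U (fun v => (1 - h v)%:E) = (1 - a)%:E.
Proof.
move=> h01 Ea.
have : Ex U (fun v => (1 - h v)%:E + (EFin \o h) v) = 1.
  rewrite -[RHS](Ex_cst 1); congr Ex; apply/funext => v /=.
  by rewrite -EFinD subrK.
rewrite ExD; last 2 first.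
- by move=> v; rewrite lee_fin subr_ge0; case/andP: (h01 v).
- by move=> v; rewrite lee_fin; case/andP: (h01 v).
rewrite Ea => H; apply/eqP; rewrite EFinB eq_sym sube_eq ?fin_num_adde_defl//.
by rewrite H.
Qed.

Lemma Ex_indic (A : set nat) : Ex U (fun v => (\1_A v : R)%:E) = P (U @^-1` A).
Proof.
rewrite /Ex (eq_integral (fun w => (\1_(U @^-1` A) w)%:E)).
  by rewrite integral_indic ?setIT//; exact: measurable_level.
by move=> w _; rewrite !indicE; congr (_%:R%:E); apply/idP/idP; rewrite !inE.
Qed.

End discrete_expectation.

(** * Countable chains through their killed transition operator *)

Lemma exists_max {R : realDomainType} (D : nat -> R) (N : nat) : (0 < N)%N ->
  exists2 i, (i < N)%N & forall j, (j < N)%N -> (D j <= D i)%R.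
Proof.
elim: N => // -[_ _|N /(_ isT) [i iN Di] _].
  by exists 0%N => // j; rewrite ltnS leqn0 => /eqP ->.
have [le|lt] := leP (D N.+1) (D i).
  exists i; first exact: ltnW.
  by move=> j; rewrite ltnS leq_eqVlt => /predU1P[->//|/Di].
exists N.+1 => // j; rewrite ltnS leq_eqVlt => /predU1P[->//|/Di le].
exact: le_trans le (ltW lt).
Qed.

Section taboo.
Context {R : realType}.
Implicit Types (D : pred nat) (h : nat -> \bar R).

Definition keep D h z : \bar R := if D z then h z else 0.

Lemma keep_ge0 D h : (forall z, 0 <= h z) -> forall z, 0 <= keep D h z.
Proof. by move=> h0 z; rewrite /keep; case: ifP. Qed.

Lemma keep_le D h1 h2 : (forall z, h1 z <= h2 z) ->
  forall z, keep D h1 z <= keep D h2 z.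
Proof. by move=> h12 z; rewrite /keep; case: ifP. Qed.

Lemma keep_le_self D h : (forall z, 0 <= h z) -> forall z, keep D h z <= h z.
Proof. by move=> h0 z; rewrite /keep; case: ifP. Qed.

End taboo.

Section countable_chain.
Context {d : measure_display} {Omega : measurableType d} {R : realType}.
Variable P : probability Omega R.
Variables (S : nat -> Omega -> nat) (mS : forall x, measurable_fun setT (S x)).
Implicit Types (D : pred nat) (h : nat -> \bar R).

Local Notation A h x := (Ex P (S x) h).

(** The transition operator of the chain killed when it leaves [D]; with
    [D = predC1 y] its iterates compute taboo probabilities, with [D = predT]
    ordinary ones. *)
Definition killed D h x : \bar R := A (keep D h) x.

Lemma killed_ge0 D h : (forall z, 0 <= h z) -> forall x, 0 <= killed D h x.
Proof. by move=> h0 x; apply: Ex_ge0; exact: keep_ge0. Qed.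

Lemma killed_le D h1 h2 : (forall z, 0 <= h1 z) -> (forall z, h1 z <= h2 z) ->
  forall x, killed D h1 x <= killed D h2 x.
Proof. by move=> h0 h12 x; apply: Ex_le => //; [exact: keep_ge0|exact: keep_le]. Qed.

Lemma killedD D h1 h2 : (forall z, 0 <= h1 z) -> (forall z, 0 <= h2 z) ->
  forall x, killed D (fun z => h1 z + h2 z) x = killed D h1 x + killed D h2 x.
Proof.
move=> h10 h20 x; rewrite /killed -ExD//; [|exact: keep_ge0|exact: keep_ge0].
by congr Ex; apply/funext => z; rewrite /keep; case: ifP; rewrite ?adde0.
Qed.

Lemma killedZ D k h : 0 <= k -> (forall z, 0 <= h z) ->
  forall x, killed D (fun z => k * h z) x = k * killed D h x.
Proof.
move=> k0 h0 x; rewrite /killed -ExZ//; last exact: keep_ge0.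
by congr Ex; apply/funext => z; rewrite /keep; case: ifP; rewrite ?mule0.
Qed.

Lemma killed_le_full D h : (forall z, 0 <= h z) ->
  forall x, killed D h x <= A h x.
Proof. by move=> h0 x; apply: Ex_le => //; [exact: keep_ge0|exact: keep_le_self]. Qed.

Lemma killed_nneseries D (h : nat -> nat -> \bar R) : (forall n z, 0 <= h n z) ->
  forall x, killed D (fun z => \sum_(n <oo) h n z) x = \sum_(n <oo) killed D (h n) x.
Proof.
move=> h0 x; rewrite /killed -Ex_nneseries//; last by move=> n; exact: keep_ge0.
congr Ex; apply/funext => z; rewrite /keep; case: ifP => // _.
by rewrite eseries0.
Qed.

Lemma iter_ge0 D n h : (forall z, 0 <= h z) -> forall x, 0 <= iter n (killed D) h x.
Proof. by move=> h0; elim: n => //= n IH x; exact: killed_ge0. Qed.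

Lemma iter_le D n h1 h2 : (forall z, 0 <= h1 z) -> (forall z, h1 z <= h2 z) ->
  forall x, iter n (killed D) h1 x <= iter n (killed D) h2 x.
Proof.
move=> h0 h12; elim: n => //= n IH x; apply: killed_le => // z.
exact: iter_ge0.
Qed.

Lemma iter_killedD D n h1 h2 : (forall z, 0 <= h1 z) -> (forall z, 0 <= h2 z) ->
  iter n (killed D) (fun z => h1 z + h2 z) =
  (fun x => iter n (killed D) h1 x + iter n (killed D) h2 x).
Proof.
move=> h10 h20; elim: n => //= n ->; apply/funext => x.
by rewrite killedD// => z; exact: iter_ge0.
Qed.

Lemma iter_killedZ D n k h : 0 <= k -> (forall z, 0 <= h z) ->
  iter n (killed D) (fun z => k * h z) = (fun x => k * iter n (killed D) h x).
Proof.
move=> k0 h0; elim: n => //= n ->; apply/funext => x.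
by rewrite killedZ// => z; exact: iter_ge0.
Qed.

Lemma iter_killed_nneseries D n (h : nat -> nat -> \bar R) :
  (forall j z, 0 <= h j z) ->
  iter n (killed D) (fun z => \sum_(j <oo) h j z) =
  (fun x => \sum_(j <oo) iter n (killed D) (h j) x).
Proof.
move=> h0; elim: n => //= n ->; apply/funext => x.
by rewrite killed_nneseries// => j z; exact: iter_ge0.
Qed.

(** [survival y n x] is the probability of avoiding [y] at times 1, ..., n when
    starting from [x]; only the times after the start count, so that
    [survival y n y] is the tail of the return time. *)
Definition survival y n x : \bar R := iter n (killed (predC1 y)) (fun=> 1) x.

Lemma survival_ge0 y n x : 0 <= survival y n x.
Proof. exact: iter_ge0. Qed.

Lemma survivalS_le y n x : survival y n.+1 x <= survival y n x.
Proof.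
rewrite /survival iterSr; apply: iter_le => z; first exact: killed_ge0.
by apply: le_trans (killed_le_full _ _ _) _ => //; rewrite Ex_cst.
Qed.

Lemma survival_noninc y x : {homo survival y ^~ x : n m / (n <= m)%N >-> m <= n}.
Proof.
move=> n m /subnK <-; elim: (m - n)%N => // k IH.
by rewrite addSn; exact: le_trans (survivalS_le _ _ _) IH.
Qed.

Lemma survival_le1 y n x : survival y n x <= 1.
Proof. exact: (@survival_noninc y x 0%N n). Qed.

Lemma survival_fin y n x : survival y n x \is a fin_num.
Proof.
by rewrite ge0_fin_numE ?survival_ge0// (le_lt_trans (survival_le1 _ _ _))// ltry.
Qed.

Lemma survivalS_ge y n x z : z != y ->
  P (S x @^-1` [set z]) * survival y n z <= survival y n.+1 x.
Proof.
move=> zy; apply: le_trans (Ex_ge_level P (mS x) z _) => /=; last first.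
  by apply: keep_ge0 => ?; exact: survival_ge0.
by rewrite /keep /= zy.
Qed.

Definition expected_upto y n x : \bar R := \sum_(0 <= j < n) survival y j x.

Lemma expected_upto_ge0 y n x : 0 <= expected_upto y n x.
Proof. by apply: sume_ge0 => j _; exact: survival_ge0. Qed.

Lemma expected_uptoS y n x :
  expected_upto y n.+1 x = 1 + killed (predC1 y) (expected_upto y n) x.
Proof.
rewrite /expected_upto big_nat_recl//; congr (_ + _).
rewrite /killed -Ex_sum//; last by move=> j; apply: keep_ge0 => z; exact: survival_ge0.
congr Ex; apply/funext => z; rewrite /keep /expected_upto; case: ifP => // _.
by rewrite big1.
Qed.

(** Restarting at time [k]: what is left of the truncated return time is paid only
    by the paths that have not met [y]. *)
Lemma expected_uptoD y n k x :
  expected_upto y (n + k) x =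
  expected_upto y k x + iter k (killed (predC1 y)) (expected_upto y n) x.
Proof.
elim: k x => [|k IH] x; first by rewrite addn0 [in X in _ = X + _]/expected_upto big_geq// add0e.
rewrite addnS !expected_uptoS -addeA; congr (_ + _).
rewrite /= -killedD//; [|by move=> z; exact: expected_upto_ge0|].
  by congr killed; apply/funext => z; exact: IH.
by apply: iter_ge0 => z; exact: expected_upto_ge0.
Qed.

Lemma expected_upto_le_n y n x : expected_upto y n x <= n%:R%:E.
Proof.
elim: n => [|n IH]; first by rewrite /expected_upto big_geq.
rewrite /expected_upto big_nat_recr//= -addn1 natrD EFinD leeD//.
exact: survival_le1.
Qed.

Lemma expected_upto_fin y n x : expected_upto y n x \is a fin_num.
Proof.
rewrite ge0_fin_numE ?expected_upto_ge0//.
by apply: le_lt_trans (expected_upto_le_n _ _ _) _; exact: ltry.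
Qed.

Hypothesis irr : forall x y, exists n,
  0 < iter n (killed predT) (keep (pred1 y) (fun=> 1)) x.

(** In an irreducible chain a non-empty set stable under possible transitions is
    everything.  Each use of irreducibility below goes through this principle. *)
Lemma irreducible_closed (Q : nat -> Prop) : (exists x, Q x) ->
  (forall x z, Q x -> 0 < P (S x @^-1` [set z]) -> Q z) -> forall z, Q z.
Proof.
move=> [x0 Qx0] Qcl z; have [n] := irr x0 z.
elim: n x0 Qx0 => [x Qx|n IH x Qx] /=.
  by rewrite /keep /=; case: eqP => [<-|]; rewrite ?ltxx.
move=> /(Ex_gt0 (mS x)) [|u pu hu].
  by apply: keep_ge0 => ?; apply: iter_ge0; exact: keep_ge0.
exact: IH (Qcl _ _ Qx pu) hu.
Qed.

Lemma not_always_avoided y :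
  (forall x z, 0 < P (S x @^-1` [set z]) -> z != y) -> False.
Proof.
move=> H; suff: y != y by rewrite eqxx.
apply: (@irreducible_closed (fun z => z != y)) => [|x z _ /H //].
by exists y.+1; rewrite gtn_eqF.
Qed.

(** Otherwise the set of states from which [y] is surely avoided would be stable,
    hence everything, and no state would lead to [y]. *)
Lemma survival_lt1 y x : exists n, survival y n x < 1.
Proof.
apply: contrapT => Hx.
have Hx1 n : survival y n x = 1.
  apply/eqP; rewrite eq_le survival_le1 leNgt; apply/negP => lt; apply: Hx.
  by exists n.
suff cl : forall z w, (forall n, survival y n z = 1) ->
    0 < P (S z @^-1` [set w]) -> w != y /\ forall n, survival y n w = 1.
  have Hall : forall z, forall n, survival y n z = 1.
    apply: irreducible_closed; first by exists x.
    by move=> z w Hz /(cl _ _ Hz) [].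
  by apply: (@not_always_avoided y) => z w /(cl _ _ (Hall z)) [].
move=> z w Hz pw.
suff Hn n : keep (predC1 y) (survival y n) w = 1.
  have wy : w != y.
    by move: (Hn 0%N); rewrite /keep /=; case: eqP => // _ /eqP; rewrite eq_sym onee_eq0.
  by split=> // n; move: (Hn n); rewrite /keep /= wy.
have k1 v : keep (predC1 y) (survival y n) v <= 1.
  by rewrite /keep; case: ifP => _; rewrite ?survival_le1.
have k0 v : 0 <= keep (predC1 y) (survival y n) v.
  by apply: keep_ge0 => ?; exact: survival_ge0.
apply: (Ex_max (mS z) k0 k1 _ pw).
by rewrite -(Hz n.+1).
Qed.
Lemma survival_pred_small y x z (e : R) : (0 < e)%R ->
  (forall e : R, (0 < e)%R -> exists n, survival y n x <= e%:E) ->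
  z != y -> 0 < P (S x @^-1` [set z]) -> exists n, survival y n z <= e%:E.
Proof.
move=> e0 Hx zy pz.
have pfin : P (S x @^-1` [set z]) \is a fin_num.
  by apply: fin_num_measure; exact: measurable_level.
have p0 : (0 < fine (P (S x @^-1` [set z])))%R.
  by apply: fine_gt0; rewrite pz ltey_eq pfin.
have [n Hn] := Hx _ (mulr_gt0 p0 e0).
exists n; rewrite -(lee_pmul2l pfin pz).
rewrite -[X in _ <= X * _](fineK pfin) -EFinM.
apply: (le_trans (survivalS_ge n x zy)).
exact: le_trans (survivalS_le _ _ _) Hn.
Qed.

(** A function [k] with values in [0, 1], equal to 1 at [y] and superharmonic up to
    an error [e], bounds the probability of ever meeting [y].  As it is at most 1/2
    at [x1], some state does not surely lead to [y]; but if [y] were recurrent, all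
    states would, by stability.  The error lets [k] be a truncation of an infinite
    mixture. *)
Lemma transience_criterion y x1 :
  (forall e : R, (0 < e)%R -> exists k : nat -> R,
    [/\ forall z, (0 <= k z <= 1)%R, k y = 1%R, (k x1 <= 2^-1)%R &
        forall x, A (EFin \o k) x <= (k x + e)%:E]) ->
  exists2 e : R, (0 < e)%R & forall n, e%:E <= survival y n y.
Proof.
move=> Hk; apply: contrapT => Hneg.
have Hy (e : R) : (0 < e)%R -> exists n, survival y n y <= e%:E.
  move=> e0; apply: contrapT => Hn; apply: Hneg; exists e => // n.
  by rewrite leNgt; apply/negP => lt; apply: Hn; exists n; exact: ltW.
have Hall : forall z, forall e : R, (0 < e)%R -> exists n, survival y n z <= e%:E.
  apply: irreducible_closed; first by exists y.
  move=> x z Hx pz e e0.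
  have [->|zy] := eqVneq z y; first exact: Hy.
  exact: survival_pred_small pz.
have [n Hn] := Hall x1 (4^-1)%R ltac:(by rewrite invr_gt0).
have n0 : (0 < n.+1%:R :> R)%R by rewrite ltr0n.
have e0 : (0 < (8 * n.+1%:R)^-1 :> R)%R by rewrite invr_gt0 mulr_gt0.
have [k [k01 ky kx1 Ak]] := Hk _ e0.
set e := (8 * n.+1%:R)^-1%R in e0 Ak.
have claim m x : 1 <= survival y m x + (k x + m%:R * e)%:E.
  elim: m x => [|m IH] x.
    by rewrite /survival /= leeDl// lee_fin mul0r addr0; case/andP: (k01 x).
  have km0 z : (0 <= (k z + m%:R * e)%:E).
    by rewrite lee_fin addr_ge0 ?mulr_ge0 ?(ltW e0)//; case/andP: (k01 z).
  have sv0 z : 0 <= keep (predC1 y) (survival y m) z.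
    by apply: keep_ge0 => ?; exact: survival_ge0.
  have : 1 <= A (fun z => keep (predC1 y) (survival y m) z + (k z + m%:R * e)%:E) x.
    rewrite -[X in X <= _](Ex_cst P (S x)); apply: Ex_le => // z.
    rewrite /keep /=; case: (eqVneq z y) => [->|zy] /=; last exact: IH.
    by rewrite add0e lee_fin ky lerDl mulr_ge0// ltW.
  rewrite ExD// => /le_trans; apply; apply: leeD => //.
  rewrite (_ : (fun z => _) = (fun z => (EFin \o k) z + (m%:R * e)%:E)); last first.
    by apply/funext => z /=; rewrite EFinD.
  rewrite ExD//; last 2 first.
  - by move=> z /=; rewrite lee_fin; case/andP: (k01 z).
  - by move=> z; rewrite lee_fin mulr_ge0// ltW.
  rewrite Ex_cst -[m.+1]addn1 natrD mulrDl mul1r addrA addrAC EFinD. exact: leeD.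
have := le_trans (claim n x1) (leeD Hn (lexx _)).
rewrite -EFinD lee_fin => c1.
have : (n%:R * e <= 8^-1)%R.
  rewrite /e invfM mulrCA ler_piMr ?invr_ge0// ler_pdivrMr// mul1r.
  by rewrite ler_nat.
by move: c1 kx1; lra.
Qed.

(** The probability [b x] of never meeting [y] from [x] is harmonic for the killed
    chain.  Subtracting a small superharmonic function that is at least 1 near
    infinity makes the maximum be attained, and it can be attained only in
    [[0, y0)]; so [b] is maximal somewhere.  Where it is maximal and positive, all
    successors share the maximum and avoid [y], which irreducibility forbids. *)
Lemma recurrence_criterion y y0 : (0 < y0)%N ->
  (forall x0 (e : R), (0 < e)%R -> exists f : nat -> R,
    [/\ forall z, (0 <= f z)%R, (f x0 <= e)%R,
        exists x1, forall x, (x1 <= x)%N -> (1 <= f x)%R &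
        forall x, (y0 <= x)%N -> A (EFin \o f) x <= (f x)%:E]) ->
  forall (e : R) x, (0 < e)%R -> exists n, survival y n x <= e%:E.
Proof.
move=> y00 Hf.
pose b x := fine (ereal_inf (range (survival y ^~ x))).
have inf0 x : 0 <= ereal_inf (range (survival y ^~ x)).
  by apply: le_ereal_inf_tmp => _ [n _ <-]; exact: survival_ge0.
have inf_le x n : ereal_inf (range (survival y ^~ x)) <= survival y n x.
  by apply: ereal_inf_lbound; exists n.
have bE x : (b x)%:E = ereal_inf (range (survival y ^~ x)).
  rewrite fineK// ge0_fin_numE// (le_lt_trans (inf_le x 0%N))//.
  by rewrite (le_lt_trans (survival_le1 _ _ _))// ltry.
have b0 x : (0 <= b x)%R by rewrite -lee_fin bE.
have b1 x : (b x <= 1)%R.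
  by rewrite -lee_fin bE (le_trans (inf_le x 0%N))// survival_le1.
have cvb x : survival y n x @[n --> \oo] --> (b x)%:E.
  by rewrite bE; apply: ereal_nonincreasing_cvgn; exact: survival_noninc.
(* [b] is a decreasing limit, so harmonicity passes to the limit by domination. *)
have bT x : (b x)%:E <= A (keep (predC1 y) (EFin \o b)) x.
  have cvk w : (setT : set Omega) w ->
      keep (predC1 y) (survival y n) (S x w) @[n --> \oo] -->
      keep (predC1 y) (EFin \o b) (S x w).
    by move=> _; rewrite /keep; case: ifP => _; [exact: cvb|exact: cvg_cst].
  have domk w n : (setT : set Omega) w ->
      `|keep (predC1 y) (survival y n) (S x w)| <= cst 1 w.
    move=> _; rewrite /keep; case: ifP => _; last by rewrite abse0.
    by rewrite gee0_abs ?survival_ge0 ?survival_le1.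
  have [_ _ cv] := @dominated_convergence _ _ _ P setT measurableT
    (fun n w => keep (predC1 y) (survival y n) (S x w))
    (fun w => keep (predC1 y) (EFin \o b) (S x w)) (cst 1)
    (fun n => measurable_nat_comp _ (mS x)) (measurable_nat_comp _ (mS x))
    (aeW _ cvk) (finite_measure_integrable_cst P 1%R measurableT) (aeW _ domk).
  rewrite -[X in _ <= X](cvg_lim _ cv)//; apply: lime_ge; first by apply/cvg_ex; eexists; exact: cv.
  apply: nearW => n; rewrite bE; exact: (inf_le x n.+1).
have bA x : (b x)%:E <= A (EFin \o b) x.
  by apply: le_trans (bT x) (killed_le_full _ _ _) => z; rewrite lee_fin.
have [z0 z0y0 bz0] := exists_max b y00.
(* The maximum over the finite set below [y0] is a global one. *)
have step1 x0 : (b x0 <= b z0)%R.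
  rewrite leNgt; apply/negP => lt.
  have e0 : (0 < (b x0 - b z0) / 2)%R by rewrite divr_gt0// subr_gt0.
  have [f [f0 fx0 [x1 fx1] Af]] := Hf x0 _ e0.
  pose D x := (b x - f x)%R.
  have [xm xmN Dm] := @exists_max _ D (maxn x1 x0).+1 isT.
  have Dx0 : (b z0 < D x0)%R by rewrite /D; lra.
  have Dxm : (b z0 < D xm)%R.
    by apply: lt_le_trans Dx0 (Dm _ _); rewrite ltnS leq_maxr.
  have Dle x : (D x <= D xm)%R.
    have [xl|xg] := leqP x (maxn x1 x0); first exact: Dm.
    have fx : (1 <= f x)%R by apply: fx1; apply: leq_trans (ltnW xg); exact: leq_maxl.
    have := b1 x; have := b0 z0; rewrite {1}/D; lra.
  suff Hall : forall z, D z = D xm.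
    move: Dxm; rewrite -(Hall 0%N) /D.
    by have := bz0 _ y00; have := f0 0%N; lra.
  apply: irreducible_closed; first by exists xm.
  move=> x z Dx pz.
    have xy0 : (y0 <= x)%N.
      rewrite leqNgt; apply/negP => /bz0 bx; move: Dxm; rewrite -Dx /D.
      by have := f0 x; lra.
    pose e v := (D xm + f v - b v)%R.
    have e_ge0 v : (0 <= e v)%R by have := Dle v; rewrite /e /D; lra.
    have : (EFin \o e) z = 0.
      apply: (Ex_le0 (mS x) (h := EFin \o e) _ _ pz); first by move=> v; rewrite lee_fin.
      rewrite -(@leeD2rE _ (b x)%:E)// add0e.
      apply: le_trans (leeD2l _ (bA x)) _.
      rewrite -ExD//; [|by move=> v; rewrite lee_fin..].
      rewrite (_ : (fun v => _) = (fun v => (D xm)%:E + (EFin \o f) v)); last first.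
        by apply/funext => v /=; rewrite -!EFinD; congr EFin; rewrite /e; ring.
      rewrite ExD; [|exact: (mS x)|by move=> _; rewrite lee_fin (le_trans (b0 z0)) ?ltW|by []].
      rewrite Ex_cst; apply: le_trans (leeD2l _ (Af _ xy0)) _.
      by rewrite -EFinD lee_fin -Dx /D; lra.
    by move=> /= [] ez; move: ez; rewrite /e /D; lra.
have bz00 : b z0 = 0%R.
  apply/eqP; rewrite eq_le b0 andbT leNgt; apply/negP => bpos.
  have key x z : b x = b z0 -> 0 < P (S x @^-1` [set z]) -> z != y /\ b z = b z0.
    move=> bx pz.
    have : keep (predC1 y) (EFin \o b) z = (b z0)%:E.
      apply: (Ex_max (mS x) _ _ _ pz).
      - by apply: keep_ge0 => v; rewrite lee_fin.
      - by move=> v; rewrite /keep; case: ifP; rewrite lee_fin.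
      - by rewrite -bx; exact: bT.
    rewrite /keep /=; case: eqP => _ /=; last by move=> [].
    by move=> [] bz; move: bpos; rewrite -bz ltxx.
  have Hall : forall z, b z = b z0.
    apply: irreducible_closed; first by exists z0.
    by move=> x z bx /(key _ _ bx) [].
  by apply: (@not_always_avoided y) => x z /(key _ _ (Hall x)) [].
move=> e x e0.
have bx : b x = 0%R by apply/eqP; rewrite eq_le b0 andbT -bz00.
apply: contrapT => Hn.
have : e%:E <= (b x)%:E.
  rewrite bE; apply: le_ereal_inf_tmp => _ [n _ <-].
  by rewrite leNgt; apply/negP => lt; apply: Hn; exists n; exact: ltW.
by rewrite bx lee_fin leNgt e0.
Qed.
(** From the finitely many states below [y0], the target is met within a common
    time [N] with a probability bounded below. *)
Lemma survival_uniform y y0 : exists N (del : R),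
  (0 < del)%R /\ forall z, (z < y0)%N -> survival y N z <= (1 - del)%:E.
Proof.
elim: y0 => [|y0 [N [del [del0 HN]]]]; first by exists 0%N, 1%R.
have [n Hn] := survival_lt1 y y0.
have nfin := survival_fin y n y0.
have del'0 : (0 < 1 - fine (survival y n y0))%R.
  by rewrite subr_gt0 -lte_fin fineK.
exists (maxn N n), (Num.min del (1 - fine (survival y n y0)))%R; split.
  by rewrite lt_min del0.
move=> z; rewrite ltnS leq_eqVlt => /predU1P[->|zy0].
  apply: le_trans (survival_noninc y y0 (leq_maxr N n)) _.
  by rewrite -(fineK nfin) lee_fin lerBrDl -lerBrDr ge_min lexx orbT.
apply: le_trans (survival_noninc y z (leq_maxl N n)) _.
apply: le_trans (HN z zy0) _.
by rewrite lee_fin lerB// ge_min lexx.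
Qed.

(** The drift condition bounds the mean time to enter [[0, y0)] by [V], so the mean
    return time truncated at [n] is at most [V + B], where [B] is its maximum over
    [[0, y0)].  Running the chain for [N] more steps from the maximising state
    replaces [B] by at most [(1 - del) * B] plus a constant: [B] is bounded
    uniformly in [n]. *)
Lemma positive_criterion y y0 (V : nat -> R) (C : R) : (0 < y0)%N -> (0 <= C)%R ->
  (forall z, (0 <= V z)%R) ->
  (forall x, (y0 <= x)%N -> A (EFin \o V) x + 1 <= (V x)%:E) ->
  (forall x, A (EFin \o V) x <= (V x + C)%:E) ->
  exists M : R, forall n, expected_upto y n y <= M%:E.
Proof.
move=> y00 C0 V0 Vdrift VC.
have upto_bound n (B : R) : (0 <= B)%R ->
    (forall z, (z < y0)%N -> expected_upto y n z <= B%:E) ->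
    forall x, expected_upto y n x <= (V x + B)%:E.
  move=> B0; elim: n => [|n IH] HB x.
    by rewrite /expected_upto big_geq// lee_fin addr_ge0.
  have [xy0|y0x] := ltnP x y0.
    by apply: le_trans (HB _ xy0) _; rewrite lee_fin lerDr.
  have HBn z : (z < y0)%N -> expected_upto y n z <= B%:E.
    move=> /HB; apply: le_trans; rewrite /expected_upto big_nat_recr//=.
    by rewrite leeDl ?survival_ge0.
  rewrite expected_uptoS.
  apply: (@le_trans _ _ (1 + A (fun z => (EFin \o V) z + B%:E) x)).
    apply: leeD2l; apply: le_trans (killed_le_full _ _ _) _.
      by move=> z; exact: expected_upto_ge0.
    by apply: Ex_le => // z; [exact: expected_upto_ge0|exact: IH].
  rewrite ExD//.
  by rewrite Ex_cst addeA EFinD leeD2r// addeC; exact: Vdrift.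
have iterV k x : iter k (killed (predC1 y)) (EFin \o V) x <= (V x + k%:R * C)%:E.
  elim: k x => [|k IH] x; first by rewrite mul0r addr0.
  apply: (@le_trans _ _ (A (fun z => (EFin \o V) z + (k%:R * C)%:E) x)).
    apply: (le_trans (killed_le_full _ _ _)) => [z|]; first exact: iter_ge0.
    by apply: Ex_le => // z; exact: iter_ge0.
  rewrite ExD//; last by move=> z; rewrite lee_fin mulr_ge0.
  rewrite Ex_cst; apply: le_trans (leeD2r _ (VC x)) _.
  by rewrite -EFinD lee_fin -[k.+1]addn1 natrD mulrDl mul1r; lra.
have [N [del [del0 HN]]] := survival_uniform y y0.
have [zV _ HzV] := exists_max V y00.
pose B := ((N%:R + V zV + N%:R * C) / del)%R.
have B0 : (0 <= B)%R by apply: divr_ge0 (ltW del0); rewrite !addr_ge0// mulr_ge0.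
exists (V y + B)%R => n; apply: (upto_bound n B) => //.
have fE z : (fine (expected_upto y n z))%:E = expected_upto y n z.
  by rewrite fineK// expected_upto_fin.
have [zn zny0 Hzn] := exists_max (fun z => fine (expected_upto y n z)) y00.
set b := fine (expected_upto y n zn) in Hzn.
have b0 : (0 <= b)%R by rewrite -lee_fin /b fE expected_upto_ge0.
suff bB : (b <= B)%R.
  by move=> z zy0; rewrite -fE lee_fin (le_trans (Hzn _ zy0)).
have /(upto_bound n b b0) Hub z : (z < y0)%N -> expected_upto y n z <= b%:E.
  by rewrite -fE lee_fin; exact: Hzn.
have : b%:E <= (N%:R + (V zV + N%:R * C) + b * (1 - del))%:E.
  rewrite /b fE.
  apply: (@le_trans _ _ (expected_upto y (n + N) zn)).
    rewrite /expected_upto (big_cat_nat (leq0n n) (leq_addr N n))/=.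
    by rewrite leeDl// sume_ge0// => i _; exact: survival_ge0.
  rewrite expected_uptoD -/b -addrA EFinD leeD ?expected_upto_le_n//.
  apply: (@le_trans _ _ (iter N (killed (predC1 y)) (fun z => (EFin \o V) z + b%:E * 1) zn)).
    by apply: iter_le => z; [exact: expected_upto_ge0|rewrite mule1 -EFinD; exact: Hub].
  rewrite iter_killedD//; last by move=> z; rewrite mule1 lee_fin.
  rewrite iter_killedZ// EFinD leeD//.
    apply: le_trans (iterV _ _) _.
    by rewrite lee_fin lerD2r HzV.
  by rewrite EFinM lee_wpmul2l// HN.
rewrite lee_fin => Hb.
by rewrite /B ler_pdivlMr//; lra.
Qed.

(** A finite mean hitting time of [y] is inherited by successors; at [y] itself it
    is the assumption. *)
Lemma expected_finite y : \sum_(n <oo) survival y n y < +oo ->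
  forall x, \sum_(n <oo) survival y n x < +oo.
Proof.
move=> Hy; apply: irreducible_closed; first by exists y.
move=> x z Hx pz.
have [->//|zy] := eqVneq z y.
have pfin : P (S x @^-1` [set z]) \is a fin_num.
  by apply: fin_num_measure; exact: measurable_level.
have p0 : (0 < fine (P (S x @^-1` [set z])))%R.
  by apply: fine_gt0; rewrite pz ltey_eq pfin.
have le : P (S x @^-1` [set z]) * \sum_(n <oo) survival y n z
          <= \sum_(n <oo) survival y n x.
  rewrite -(fineK pfin) -nneseriesZl; last by move=> i _; exact: survival_ge0.
  apply: lee_nneseries => [i _ _|n _].
    by apply: mule_ge0; rewrite ?lee_fin ?(ltW p0) ?survival_ge0.
  rewrite fineK//; apply: (le_trans (survivalS_ge n x zy)); exact: survivalS_le.
rewrite ltey; apply/eqP => E; move: le; rewrite E gt0_muley//.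
by rewrite leye_eq => /eqP Hx1; move: Hx; rewrite Hx1 ltxx.
Qed.

(** If the mean hitting time [m] were finite, the functions [G] would give
    [x <= C (1 + m x)], so that the subharmonic function [D x = x - y0] (truncated
    at 0) would satisfy [D <= K m].  Iterating the killed operator [T] keeps
    [D <= T ^ n D <= K T ^ n m], and the right-hand side is a tail of the series
    [m].  This is optional stopping for a submartingale whose increments are too
    large for the usual integrability conditions. *)
Lemma null_criterion y y0 (C : R) : (0 <= C)%R -> (y < y0)%N ->
  (forall x, (y0 <= x)%N -> (x%:R)%:E <= A (fun z => (z%:R : R)%:E) x) ->
  (forall x0, (0 < x0)%N -> exists G : nat -> R,
    [/\ forall z, (0 <= G z <= z%:R)%R, (x0%:R / 2 <= G x0)%R,
        exists M : R, forall z, (G z <= M)%R &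
        forall x, (G x)%:E <= A (EFin \o G) x + C%:E]) ->
  \sum_(n <oo) survival y n y = +oo.
Proof.
move=> C0 yy0 id_drift HG.
apply/eqP; rewrite -leye_eq leNgt; apply/negP => /expected_finite Hfin.
pose T := killed (predC1 y).
pose m x := \sum_(n <oo) survival y n x.
have m0 x : 0 <= m x by apply: nneseries_ge0 => n _ _; exact: survival_ge0.
have mfin x : m x \is a fin_num by rewrite ge0_fin_numE//; exact: Hfin.
have m1 x : 1 <= m x.
  apply: le_trans (nneseries_lim_ge 1 _); last by move=> n _ _; exact: survival_ge0.
  by rewrite big_nat1.
have tail x : (\sum_(k <= j <oo) survival y j x) @[k --> \oo] --> 0.
  by apply: nneseries_tail_cvg => [|k _]; [exact: Hfin|exact: survival_ge0].
have Tm n x : iter n T m x = \sum_(n <= j <oo) survival y j x.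
  rewrite /T /m iter_killed_nneseries; last by move=> j z; exact: survival_ge0.
  rewrite -(@nneseries_addn _ (fun j => survival y j x)); last by move=> i; exact: survival_ge0.
  by apply: eq_eseriesr => j _; rewrite /survival -iterD addnC.
have surv_tail n x : survival y n x <= \sum_(n <= j <oo) survival y j x.
  apply: le_trans (nneseries_lim_ge n.+1 _); last by move=> j _ _; exact: survival_ge0.
  by rewrite big_nat1.
have tail_small x (e : R) : (0 < e)%R ->
    exists n, \sum_(n <= j <oo) survival y j x <= e%:E.
  move=> e0; have /fine_cvgP[_] := tail x; move/cvgr_le => /(_ _ e0) [n _ Hn].
  have tfin : \sum_(n <= j <oo) survival y j x \is a fin_num.
    rewrite ge0_fin_numE; last by apply: nneseries_ge0 => j _ _; exact: survival_ge0.
    apply: le_lt_trans (Hfin x).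
    rewrite [X in _ <= X](nneseries_split _ n)//; last by move=> k _; exact: survival_ge0.
    by rewrite leeDr// sume_ge0// => i _; exact: survival_ge0.
  by exists n; rewrite -(fineK tfin) lee_fin; exact: (Hn n (leqnn n)).
(* [G - y0], cut off at 0, gains at most [C] per step of the killed chain. *)
have linear_bound x : (x%:R)%:E <= (2 * y0%:R)%:E + (2 * C)%:E * m x.
  have [->|x0] := posnP x.
    by rewrite adde_ge0 ?lee_fin ?mulr_ge0// mule_ge0// lee_fin mulr_ge0.
  have [G [G01 Gx [M GM] GC]] := HG _ x0.
  pose Gp z := Num.max (G z - y0%:R)%R 0%R.
  have Gp0 z : 0 <= (Gp z)%:E by rewrite lee_fin /Gp le_max lexx orbT.
  have M0 : (0 <= M)%R by apply: le_trans (GM 0%N); case/andP: (G01 0%N).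
  have GpT z : (Gp z)%:E <= C%:E + T (EFin \o Gp) z.
    have T0 : 0 <= T (EFin \o Gp) z by apply: killed_ge0 => v; exact: Gp0.
    have : (G z)%:E <= y0%:R%:E + T (EFin \o Gp) z + C%:E.
      apply: le_trans (GC z) _; apply: leeD2r.
      rewrite -[X in X + _](Ex_cst P (S z)) -ExD//; last exact: keep_ge0.
      apply: Ex_le => // [v|v]; first by rewrite lee_fin; case/andP: (G01 v).
      rewrite /keep /=; case: (eqVneq v y) => [->|_] /=.
        rewrite adde0 lee_fin (le_trans (proj2 (andP (G01 y))))// ler_nat.
        exact: ltnW.
      by rewrite -EFinD lee_fin -lerBlDl /Gp le_max lexx.
    have [tE|] := eqVneq (T (EFin \o Gp) z) +oo.
      by move=> _; rewrite tE addey// leey.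
    rewrite -ltey -ge0_fin_numE// => tfin; rewrite -(fineK tfin) -!EFinD !lee_fin => H.
    rewrite /Gp ge_max; apply/andP; split; first by lra.
    by rewrite addr_ge0// fine_ge0.
  have GpIter n z : (Gp z)%:E <= C%:E * expected_upto y n z + M%:E * survival y n z.
    elim: n z => [|n IH] z.
      rewrite /expected_upto big_geq// mule0 add0e /survival /= mule1 lee_fin.
      rewrite /Gp ge_max M0 andbT lerBlDr (le_trans (GM z))// lerDl//.
    apply: le_trans (GpT z) _; rewrite expected_uptoS.
    rewrite ge0_muleDr//; last by apply: killed_ge0 => v; exact: expected_upto_ge0.
    rewrite mule1 -addeA leeD2l// /survival /= -/(survival y n).
    rewrite -(@killedZ _ C%:E (expected_upto y n))//; last first.
      by move=> v; exact: expected_upto_ge0.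
    rewrite -(@killedZ _ M%:E (survival y n))//; last by move=> v; exact: survival_ge0.
    rewrite -killedD; last 2 first.
      by move=> v; rewrite mule_ge0// expected_upto_ge0.
      by move=> v; rewrite mule_ge0// survival_ge0.
    by apply: killed_le => // v; exact: Gp0.
  have GpM : (Gp x)%:E <= C%:E * m x.
    apply/lee_addgt0Pr => e e0.
    have e'0 : (0 < e / (M + 1))%R by rewrite divr_gt0// ltr_wpDl.
    have [n Hn] := tail_small x _ e'0.
    apply: le_trans (GpIter n x) _; apply: leeD.
      rewrite lee_wpmul2l//.
      by apply: nneseries_lim_ge => i _ _; exact: survival_ge0.
    apply: (@le_trans _ _ (M%:E * (e / (M + 1))%:E)).
      by rewrite lee_wpmul2l//; exact: le_trans (surv_tail n x) Hn.
    rewrite -EFinM lee_fin mulrA ler_pdivrMr ?ltr_wpDl//.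
    by rewrite mulrDr mulr1 mulrC lerDl ltW.
  move: GpM; rewrite -(fineK (mfin x)) -!EFinM -EFinD !lee_fin => GpM.
  have : (G x - y0%:R <= Gp x)%R by rewrite /Gp le_max lexx.
  by lra.
pose D x := ((x - y0)%N%:R : R).
have D0 z : 0 <= (D z)%:E by rewrite lee_fin.
have DT x : (D x)%:E <= T (EFin \o D) x.
  have [xy0|y0x] := ltnP x y0.
    rewrite /D (eqP (ltnW xy0 : (x - y0 == 0)%N)).
    by apply: killed_ge0 => v; exact: D0.
  have : (x%:R)%:E <= T (EFin \o D) x + y0%:R%:E.
    apply: le_trans (id_drift x y0x) _.
    rewrite -[X in _ + X](Ex_cst P (S x)) -ExD//; last exact: keep_ge0.
    apply: Ex_le => // v.
    rewrite /keep /=; case: (eqVneq v y) => [->|_] /=.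
      by rewrite add0e lee_fin ler_nat ltnW.
    by rewrite -EFinD lee_fin /D -natrD ler_nat; lia.
  by rewrite /D natrB// EFinB leeBlDr.
have DTn n x : (D x)%:E <= iter n T (EFin \o D) x.
  elim: n x => //= n IH x; apply: le_trans (DT x) _.
  by apply: killed_le => // z; exact: D0.
pose K := (2 * y0%:R + 2 * C)%R.
have K0 : (0 <= K)%R by rewrite addr_ge0// mulr_ge0.
have DK z : (D z)%:E <= K%:E * m z.
  apply: (@le_trans _ _ (z%:R)%:E); first by rewrite lee_fin ler_nat leq_subr.
  apply: le_trans (linear_bound z) _.
  have mz1 : (1 <= fine (m z))%R by rewrite -lee_fin fineK.
  rewrite -(fineK (mfin z)) -!EFinM -EFinD lee_fin /K.
  have : (0 <= y0%:R * (fine (m z) - 1))%R by rewrite mulr_ge0// subr_ge0.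
  by lra.
have : (D y0.+1)%:E <= 2^-1%:E.
  have e0 : (0 < 2^-1 / (K + 1) :> R)%R by rewrite divr_gt0 ?ltr_wpDl.
  have [n Hn] := tail_small y0.+1 _ e0.
  apply: le_trans (DTn n _) _.
  apply: le_trans (iter_le _ _ _ DK _) _; first exact: D0.
  rewrite iter_killedZ// -/T Tm.
  apply: le_trans (lee_wpmul2l _ Hn) _; first by rewrite lee_fin.
  rewrite -EFinM lee_fin mulrA ler_pdivrMr ?ltr_wpDl//.
  by rewrite mulrDr mulr1 mulrC lerDl.
rewrite lee_fin /D subSn// subnn; lra.
Qed.
End countable_chain.

(** * Elementary inequalities *)

Section bernoulli_inequalities.
Context {R : realFieldType}.
Implicit Types (t : R) (n : nat).
Local Open Scope ring_scope.

Lemma bernoulli_lower t n : 0 <= t <= 1 -> 1 - n%:R * t <= (1 - t) ^+ n.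
Proof.
move=> /andP[t0 t1]; elim: n => [|n IH]; first by rewrite expr0 mul0r subr0.
rewrite [(1 - t) ^+ n.+1]exprS -[n.+1]addn1 natrD.
have n0 : 0 <= n%:R :> R by [].
have s0 : 0 <= 1 - t by rewrite subr_ge0.
have := ler_wpM2l s0 IH.
have : 0 <= n%:R * t * t by rewrite !mulr_ge0.
by lra.
Qed.

Lemma bernoulli_upper t n : 0 <= t <= 1 ->
  (1 - t) ^+ n <= 1 - n%:R * t + n%:R * (n%:R - 1) / 2 * t ^+ 2.
Proof.
move=> /andP[t0 t1]; elim: n => [|n IH]; first by rewrite expr0 !mul0r; lra.
rewrite [(1 - t) ^+ n.+1]exprS -[n.+1]addn1 natrD.
have s0 : 0 <= 1 - t by rewrite subr_ge0.
have := ler_wpM2l s0 IH.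
have : 0 <= n%:R * (n%:R - 1) / 2 * t ^+ 3 :> R.
  rewrite mulr_ge0 ?exprn_ge0// mulr_ge0//.
  case: n {IH} => [|n]; first by rewrite mul0r.
  by rewrite mulr_ge0// subr_ge0 ler1n.
by lra.
Qed.

Lemma bernoulli_upper_sq t n : 0 <= t <= 1 ->
  (1 - t) ^+ n <= 1 - n%:R * t + n%:R ^+ 2 * t ^+ 2.
Proof.
move=> t01; apply: le_trans (bernoulli_upper n t01) _.
rewrite lerD2l; apply: ler_wpM2r; first by rewrite exprn_ge0//; case/andP: t01.
have : 0 <= n%:R :> R by [].
have : 0 <= n%:R ^+ 2 :> R by rewrite exprn_ge0.
by lra.
Qed.

Lemma bernoulli_lower3 t n : 0 <= t <= 1 ->
  1 - n%:R * t + n%:R * (n%:R - 1) / 2 * t ^+ 2 - n%:R ^+ 3 * t ^+ 3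
    <= (1 - t) ^+ n.
Proof.
move=> /andP[t0 t1]; elim: n => [|n IH].
  by rewrite expr0 !mul0r expr0n /= mul0r; lra.
rewrite [(1 - t) ^+ n.+1]exprS -[n.+1]addn1 natrD.
have s0 : 0 <= 1 - t by rewrite subr_ge0.
have := ler_wpM2l s0 IH.
have n0 : 0 <= n%:R :> R by [].
have : 0 <= n%:R ^+ 3 * t ^+ 4 by rewrite mulr_ge0// exprn_ge0.
have : 0 <= n%:R * t ^+ 3 by rewrite mulr_ge0// exprn_ge0.
have : 0 <= n%:R ^+ 2 * t ^+ 3 by rewrite mulr_ge0// exprn_ge0.
have : 0 <= t ^+ 3 by rewrite exprn_ge0.
by lra.
Qed.

End bernoulli_inequalities.

Section geometric_domination.
Context {R : realType}.
Local Open Scope ring_scope.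

Lemma eventually_lt (a : R) (e : R) : 0 <= a < 1 -> 0 < e ->
  exists N, forall n, (N <= n)%N -> a ^+ n <= e.
Proof.
move=> /andP[a0 a1] e0.
have : GRing.exp a @ \oo --> (0 : R) by apply: cvg_expr; rewrite ger0_norm.
by move=> /cvgr_le /(_ _ e0) [N _ HN]; exists N => n Nn; exact: HN.
Qed.

Lemma geometric_domination (a b C : R) : 0 <= a < b ->
  exists N, forall n, (N <= n)%N -> C * a ^+ n <= b ^+ n.
Proof.
move=> /andP[a0 ab]; have b0 : 0 < b by apply: le_lt_trans ab.
have ab1 : 0 <= a / b < 1 by rewrite divr_ge0 ?(ltW b0)//= ltr_pdivrMr ?mul1r.
have C1 : 0 < (`|C| + 1)^-1 by rewrite invr_gt0 ltr_wpDl.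
have [N HN] := eventually_lt ab1 C1.
exists N => n /HN; rewrite expr_div_n ler_pdivrMr ?exprn_gt0// => H.
apply: (@le_trans _ _ ((`|C| + 1) * a ^+ n)).
  by rewrite ler_wpM2r ?exprn_ge0// (le_trans (ler_norm _))// lerDl.
apply: le_trans (ler_wpM2l _ H) _; first by rewrite addr_ge0.
by rewrite mulVKf// gt_eqF// ltr_wpDl.
Qed.

Lemma bounded_series_tail (w : nat -> R) (W : R) : (forall k, 0 <= w k) ->
  (forall N, \sum_(k < N) w k <= W) -> forall e, 0 < e ->
  exists K, forall N, \sum_(k < N) w k <= \sum_(k < K) w k + e.
Proof.
move=> w0 HW e e0.
pose E := range (fun N => \sum_(k < N) w k).
have hE : has_sup E by split; [exists (\sum_(k < 0) w k); exists 0%N|exists W => _ [N _ <-]].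
have [_ [K _ <-] HK] := sup_adherent e0 hE.
exists K => N; apply: le_trans (_ : sup E <= _).
  by apply: sup_upper_bound => //; exists N.
by rewrite -lerBlDr ltW.
Qed.

End geometric_domination.

(** * Iterating a generating function near its parabolic fixed point *)

(** Iterates of a map tangent to the identity at 0 from below: the behaviour of
    [1 - phi_k(s)] for the iterates [phi_k] of a critical generating function. *)
Section parabolic_iterates.
Context {R : realType}.
Local Open Scope ring_scope.
Variables (f : R -> R) (b T : R).
Hypothesis (b0 : 0 < b) (T0 : 0 < T) (bT : b * T <= 2^-1).
Hypothesis f_bounds : forall t, 0 < t <= T ->
  t - b * t ^+ 2 <= f t <= t - b / 2 * t ^+ 2.

Let tk k := iter k f T.

Lemma iterate_range k : 0 < tk k <= T.
Proof.
elim: k => [|k /= tkr]; first by rewrite /tk /= T0 lexx.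
have /andP[t0 tT] := tkr; have /andP[fl fu] := f_bounds tkr.
rewrite /tk /= -/(tk k); apply/andP; split.
  have btT : b * tk k <= 2^-1 by apply: le_trans bT; rewrite ler_pM2l.
  have : 0 < tk k * (1 - b * tk k) by rewrite mulr_gt0//; lra.
  by move=> pos; apply: lt_le_trans fl; lra.
apply: le_trans fu _; apply: le_trans tT.
by rewrite gerBl mulr_ge0 ?exprn_ge0 ?divr_ge0// ltW.
Qed.

Lemma iterate_noninc m n : (m <= n)%N -> tk n <= tk m.
Proof.
move=> /subnK <-; elim: (n - m)%N => // k IH; rewrite addSn.
apply: le_trans IH; have /andP[_ fu] := f_bounds (iterate_range (k + m)).
apply: le_trans fu _.
by rewrite gerBl mulr_ge0 ?sqr_ge0// divr_ge0// ltW.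
Qed.

(** Each step decreases [t_k] by at least [b / 2 * t_k ^ 2], so the sum telescopes. *)
Lemma iterate_sum_sq N : \sum_(k < N) tk k ^+ 2 <= 2 * T / b.
Proof.
suff H : b / 2 * (\sum_(k < N) tk k ^+ 2) + tk N <= T.
  have /andP[tN0 _] := iterate_range N.
  rewrite ler_pdivlMr// mulrC.
  by move: H tN0; lra.
elim: N => [|N IH]; first by rewrite big_ord0 mulr0 add0r.
rewrite big_ord_recr /=; have /andP[_ fu] := f_bounds (iterate_range N).
by move: fu IH; rewrite /tk /= -/(tk N); lra.
Qed.

(** If the sum were finite, the product of the factors [1 - b t_k] would be
    bounded below, and so would the iterates themselves. *)
Lemma iterate_sum_infinite L : exists N, L <= \sum_(k < N) tk k.
Proof.
apply: contrapT => Hn.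
have HL N : \sum_(k < N) tk k <= L.
  by rewrite leNgt; apply/negP => lt; apply: Hn; exists N; exact: ltW.
have lower k : T * expR (- (2 * b) * (\sum_(i < k) tk i)) <= tk k.
  elim: k => [|k IH]; first by rewrite big_ord0 mulr0 expR0 mulr1.
  have tkr := iterate_range k; have /andP[t0 tT] := tkr.
  have /andP[fl _] := f_bounds tkr.
  have btT : b * tk k <= 2^-1 by apply: le_trans bT; rewrite ler_pM2l.
  apply: le_trans (_ : _ <= tk k * (1 - b * tk k)) _; last first.
    by rewrite /tk /= -/(tk k); move: fl; lra.
  rewrite big_ord_recr /= mulrDr expRD mulrA ler_pM ?expR_ge0//.
    by rewrite mulr_ge0 ?expR_ge0// ltW.
  set x := b * tk k; have x0 : 0 < x by rewrite mulr_gt0.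
  have x1 : 0 < 1 - x by move: btT; rewrite -/x; lra.
  have -> : - (2 * b) * tk k = - (2 * x) by rewrite /x; ring.
  rewrite expRN invf_ple ?posrE ?expR_gt0//.
  apply: le_trans (expR_ge1Dx _); rewrite -div1r ler_pdivrMr//.
  have : x * (2^-1 - x) >= 0 by rewrite mulr_ge0 ?(ltW x0)// subr_ge0.
  by lra.
set del := T * expR (- (2 * b) * L).
have del0 : 0 < del by rewrite mulr_gt0 ?expR_gt0.
have tdel k : del <= tk k.
  apply: le_trans (lower k); rewrite /del ler_pM2l// ler_expR.
  by rewrite ler_nM2l// oppr_lt0 mulr_gt0.
have [N HN] : exists N : nat, L / del < N%:R.
  by exists (Num.truncn (L / del)).+1; exact: truncnS_gt.
have := HL N; apply/negP; rewrite -ltNge.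
move: HN; rewrite ltr_pdivrMr// => /lt_le_trans; apply.
have -> : N%:R * del = \sum_(k < N) del by rewrite sumr_const card_ord mulr_natl.
exact: ler_sum.
Qed.

(** Raabe's test, with [1 / t_k], which grows like [b k], in the place of [k]: the
    sequence [w_k / t_k] decreases by at least [kap * w_k] at each step. *)
Lemma iterate_weights_summable (g : R -> R) (kap : R) (w : nat -> R) : 0 < kap ->
  (forall t, 0 < t <= T -> 0 < g t /\ g t / f t + kap <= t^-1) ->
  w 0%N = 1 -> (forall k, w k.+1 = w k * g (tk k)) ->
  (forall k, 0 < w k) /\ forall N, \sum_(k < N) w k <= (kap * T)^-1.
Proof.
move=> kap0 gH w00 wS.
have wpos k : 0 < w k.
  elim: k => [|k IH]; first by rewrite w00.
  by rewrite wS mulr_gt0//; case: (gH _ (iterate_range k)).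
split=> // N.
suff H : kap * (\sum_(k < N) w k) + w N / tk N <= T^-1.
  rewrite invfM ler_pdivlMl//; apply: le_trans H.
  have /andP[tN _] := iterate_range N.
  by rewrite lerDl divr_ge0 ?(ltW (wpos N)) ?(ltW tN).
elim: N => [|N IH]; first by rewrite big_ord0 mulr0 add0r w00 div1r.
apply: le_trans IH; rewrite big_ord_recr /= mulrDr -addrA lerD2l.
rewrite wS /tk /= -/(tk N) -mulrA [kap * _]mulrC -mulrDr addrC.
by rewrite ler_pM2l//; case: (gH _ (iterate_range N)).
Qed.

End parabolic_iterates.

(** * Recurrence and transience from the one-step transform *)

(** Collects finitely many requirements of the form: [T] is small enough. *)
Lemma small_enough {R : realFieldType} (t0 : R) (l : seq (R * R)) : (0 < t0)%R ->
  all (fun q => (0 <= q.1) && (0 < q.2))%R l ->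
  exists2 T, (0 < T <= t0)%R & all (fun q => q.1 * T <= q.2)%R l.
Proof.
move=> t00; elim: l => [_|[M e] l IH /= /andP[/andP[M0 e0] Hl]].
  by exists t0; rewrite ?t00 ?lexx.
have [T /andP[T0 Tt0] HT] := IH Hl.
have M1 : (0 < M + 1)%R by rewrite ltr_wpDl.
exists (Num.min T (e / (M + 1)))%R.
  by rewrite lt_min T0 divr_gt0//= ge_min Tt0.
apply/andP; split.
  apply: (@le_trans _ _ (M * (e / (M + 1)))%R); first by rewrite ler_wpM2l// ge_min lexx orbT.
  by rewrite mulrA ler_pdivrMr// mulrDr mulr1 mulrC lerDl ltW.
apply/allP => q ql; move/allP: HT => /(_ q ql); apply: le_trans.
by rewrite ler_wpM2l ?ge_min ?lexx//; case/andP: (allP Hl q ql).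
Qed.

Section generating_function_criteria.
Context {d : measure_display} {Omega : measurableType d} {R : realType}.
Variable P : probability Omega R.
Variables (S : nat -> Omega -> nat) (mS : forall x, measurable_fun setT (S x)).
Hypothesis irr : forall x y, exists n,
  0 < iter n (killed P S predT) (keep (pred1 y) (fun=> 1)) x.

Local Notation A h x := (Ex P (S x) h).

(** The hypotheses describe the transform near [s = 1 - t]: [1 - f t] is the
    offspring generating function, [c] the drift, [b] half the offspring variance,
    [g] and [e] the coefficients of the regular and catastrophic parts. *)
Variables (p c b gam cst t0 : R) (f g e : R -> R).
Hypothesis (p01 : (0 < p < 1)%R) (b0 : (0 < b)%R) (gam0 : (0 <= gam)%R).
Hypothesis (cst0 : (0 <= cst)%R) (t00 : (0 < t0)%R) (t0p : (p + t0 < 1)%R).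
Hypothesis hf : forall t, (0 < t <= t0)%R ->
  (t - b * t ^+ 2 <= f t <= t - b * t ^+ 2 + gam * t ^+ 3)%R.
Hypothesis hg : forall t, (0 < t <= t0)%R ->
  (1 - c * t - cst * t ^+ 2 <= g t <= 1 - c * t + cst * t ^+ 2)%R.
Hypothesis he : forall t, (0 < t <= t0)%R -> (- (cst * t) <= e t <= cst * t)%R.
Hypothesis hA : forall t x, (0 < t <= t0)%R ->
  A (fun z => ((1 - t) ^+ z)%:E) x = (g t * (1 - f t) ^+ x + e t * p ^+ x)%:E.

Lemma t0_lt1 : (t0 < 1)%R.
Proof. by case/andP: p01 => ? ?; move: t0p; lra. Qed.

Lemma onem_range t : (0 < t <= t0)%R -> (0 <= 1 - t <= 1)%R.
Proof. by move=> /andP[t_0 tt0]; have := t0_lt1; lra. Qed.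

Lemma onem_exp_range t z : (0 < t <= t0)%R -> (0 <= (1 - t) ^+ z <= 1)%R.
Proof.
by move=> /onem_range /andP[s0 s1]; rewrite exprn_ge0//= exprn_ile1.
Qed.

Lemma p_exp_range z : (0 <= p ^+ z <= 1)%R.
Proof.
by case/andP: p01 => pp0 pp1; rewrite exprn_ge0 ?exprn_ile1// ltW.
Qed.

Lemma pgf_combination (N : nat) (w t : nat -> R) x :
  (forall k, 0 <= w k)%R -> (forall k, 0 < t k <= t0)%R ->
  A (fun z => (\sum_(k < N) w k * (1 - t k) ^+ z)%R%:E) x =
  (\sum_(k < N) w k * (g (t k) * (1 - f (t k)) ^+ x + e (t k) * p ^+ x))%R%:E.
Proof.
move=> w0 tr.
rewrite (_ : (fun z => _) = (fun z => \sum_(k <- index_enum 'I_N)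
    ((w k)%:E * ((1 - t k) ^+ z)%:E))); last first.
  by apply/funext => z; rewrite -sumEFin; apply: eq_bigr => k _; rewrite EFinM.
have t_ge0 k z : 0 <= ((1 - t k) ^+ z)%:E.
  by rewrite lee_fin; case/andP: (onem_exp_range z (tr k)).
rewrite Ex_sum//; last by move=> k z; apply: mule_ge0 => //; rewrite lee_fin.
rewrite -sumEFin; apply: eq_bigr => k _.
by rewrite ExZ ?lee_fin// hA// EFinM.
Qed.

Lemma pgf_combination_onem (N : nat) (w t : nat -> R) x :
  (forall k, 0 <= w k)%R -> (forall k, 0 < t k <= t0)%R ->
  A (fun z => (\sum_(k < N) w k * (1 - (1 - t k) ^+ z))%R%:E) x =
  (\sum_(k < N) w k * (1 - (g (t k) * (1 - f (t k)) ^+ x + e (t k) * p ^+ x)))%R%:E.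
Proof.
move=> w0 tr.
rewrite (_ : (fun z => _) = (fun z => \sum_(k <- index_enum 'I_N)
    ((w k)%:E * (1 - (1 - t k) ^+ z)%:E))); last first.
  by apply/funext => z; rewrite -sumEFin; apply: eq_bigr => k _; rewrite EFinM.
have t_ge0 k z : 0 <= (1 - (1 - t k) ^+ z)%:E.
  by rewrite lee_fin subr_ge0; case/andP: (onem_exp_range z (tr k)).
rewrite Ex_sum//; last by move=> k z; apply: mule_ge0 => //; rewrite lee_fin.
rewrite -sumEFin; apply: eq_bigr => k _.
rewrite ExZ ?lee_fin// EFinM; congr (_ * _).
by apply: (Ex_onem (mS x)) (hA x (tr k)) => z; exact: onem_exp_range.
Qed.

Lemma f_half t : (0 < t <= t0)%R -> (gam * t <= b / 2)%R ->
  (t - b * t ^+ 2 <= f t <= t - b / 2 * t ^+ 2)%R.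
Proof.
move=> tr gt; have /andP[-> fu] /= := hf tr; have /andP[t_0 _] := tr.
apply: le_trans fu _.
have : (0 <= t ^+ 2 * (b / 2 - gam * t))%R by rewrite mulr_ge0 ?sqr_ge0 ?subr_ge0.
by lra.
Qed.

(** Applied to [F N x = \sum_(k < N) w k * s k ^ x] the step shifts the index; the
    lost term [s 0 ^ x] outweighs the catastrophic part, as [p < s 0], and the
    entering term is at most [w N], which is arbitrarily small. *)
Lemma pgf_transient y : (b < c)%R ->
  exists2 eps : R, (0 < eps)%R & forall n, eps%:E <= survival P S y n y.
Proof.
move=> bc.
have c0 : (0 < c)%R by apply: lt_trans bc.
have [|T /andP[T0 Tt0] /= /and5P[bT gamT cstT cT /andP[cstT4 _]]] :=
  @small_enough _ t0 [:: (b, 2^-1); (gam, b / 2); (cst, (c - b) / 2); (c, 4^-1);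
                         (cst, 4^-1)]%R t00.
  by rewrite /= (ltW b0) gam0 cst0 (ltW c0) !invr_gt0 !divr_gt0 ?subr_gt0//= !ltr0n.
have Tr t : (0 < t <= T)%R -> (0 < t <= t0)%R.
  by move=> /andP[-> /le_trans]; apply.
have fb t : (0 < t <= T)%R -> (t - b * t ^+ 2 <= f t <= t - b / 2 * t ^+ 2)%R.
  move=> tT; apply: f_half; first exact: Tr.
  by apply: le_trans gamT; rewrite ler_wpM2l//; case/andP: tT.
pose tk k := iter k f T.
have tkT k : (0 < tk k <= T)%R by exact: (iterate_range b0 T0 bT fb).
have tkr k : (0 < tk k <= t0)%R by apply: Tr.
pose w := fix w k : R := if k is k'.+1 then (w k' * g (tk k'))%R else 1%R.
(* Half of the margin between [c] and [b] absorbs the second-order terms. *)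
pose kap := ((c - b) / 2)%R.
have kap0 : (0 < kap)%R by rewrite divr_gt0 ?subr_gt0.
have gH t : (0 < t <= T)%R -> (0 < g t /\ g t / f t + kap <= t^-1)%R.
  move=> tT; have /andP[t_0 t_T] := tT.
  have t1 : (t < 1)%R by apply: le_lt_trans t0_lt1; apply: le_trans t_T Tt0.
  have [ct cstt bt] : [/\ c * t <= 4^-1, cst * t <= 4^-1 & b * t <= 2^-1]%R.
    by split; [apply: le_trans cT|apply: le_trans cstT4|apply: le_trans bT];
      rewrite ler_wpM2l ?(ltW c0) ?(ltW b0).
  have cstt2 : (cst * t <= (c - b) / 2)%R by apply: le_trans cstT; rewrite ler_wpM2l.
  have /andP[gl gu] := hg (Tr _ tT); have /andP[fl _] := fb _ tT.
  have cstt' : (cst * t ^+ 2 <= cst * t)%R.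
    by rewrite ler_wpM2l// expr2 ler_piMl// ltW.
  split; first by lra.
  have f_pos : (0 < f t)%R.
    have : (0 < t * (1 - b * t))%R by rewrite mulr_gt0//; lra.
    by move=> pos; apply: lt_le_trans fl; lra.
  rewrite -lerBrDr ler_pdivrMr//.
  have kt : (0 <= t^-1 - kap)%R.
    rewrite subr_ge0 -[X in (_ <= X)%R]div1r ler_pdivlMr// /kap.
    have : (0 <= b * t)%R by rewrite mulr_ge0 ?ltW.
    by lra.
  apply: le_trans (ler_wpM2l kt fl).
  have -> : ((t^-1 - kap) * (t - b * t ^+ 2) = (1 - kap * t) * (1 - b * t))%R.
    by field; rewrite gt_eqF.
  apply: (le_trans gu).
  have : (0 <= t * ((c - b) / 2 - cst * t))%R by rewrite mulr_ge0 ?(ltW t_0)// subr_ge0.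
  have := mulr_ge0 (mulr_ge0 (ltW kap0) (ltW t_0)) (mulr_ge0 (ltW b0) (ltW t_0)).
  by rewrite /kap; lra.
have [wpos wsum] := iterate_weights_summable b0 T0 bT fb kap0 gH (erefl : w 0%N = 1%R)
  (fun k => erefl).
have w0 k : (0 <= w k)%R by apply: ltW.
set W := (kap * T)^-1%R in wsum.
have W0 : (0 <= W)%R by rewrite invr_ge0 mulr_ge0 ?ltW.
pose s k := (1 - tk k)%R.
have s01 k z : (0 <= s k ^+ z <= 1)%R by exact: onem_exp_range.
pose F N x := (\sum_(k < N) w k * s k ^+ x)%R.
have F0 N x : (0 <= F N x)%R.
  by apply: sumr_ge0 => k _; rewrite mulr_ge0//; case/andP: (s01 k x).
have AF N x : A (EFin \o F N) x <=
    (F N x + w N + (W * cst * p ^+ x - s 0%N ^+ x))%R%:E.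
  rewrite (pgf_combination N x w0 tkr) lee_fin.
  have -> : (\sum_(k < N) w k * (g (tk k) * (1 - f (tk k)) ^+ x + e (tk k) * p ^+ x) =
      \sum_(k < N) w k.+1 * s k.+1 ^+ x + p ^+ x * \sum_(k < N) w k * e (tk k))%R.
    rewrite mulr_sumr -big_split /=; apply: eq_bigr => k _.
    by rewrite /s /tk /= -/(tk k); ring.
  have tele : (\sum_(k < N) w k.+1 * s k.+1 ^+ x =
               F N x + w N * s N ^+ x - s 0%N ^+ x)%R.
    rewrite /F; elim: (N) => [|n IH]; first by rewrite !big_ord0 /= mul1r add0r subrr.
    by rewrite !big_ord_recr /= IH; ring.
  have bnd : (\sum_(k < N) w k * e (tk k) <= W * cst)%R.
    apply: (@le_trans _ _ (\sum_(k < N) w k * cst)%R).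
      apply: ler_sum => k _; rewrite ler_wpM2l//.
      have /andP[_ eu] := he (tkr k); apply: le_trans eu _.
      rewrite ler_piMr// (le_trans _ (ltW t0_lt1))//.
      by case/andP: (tkr k).
    by rewrite -mulr_suml ler_wpM2r.
  have := ler_wpM2l (proj1 (andP (p_exp_range x))) bnd.
  have : (w N * s N ^+ x <= w N)%R by rewrite ler_piMr//; case/andP: (s01 N x).
  by rewrite tele; lra.
have s0p : (0 <= p < s 0%N)%R.
  case/andP: p01 => pp0 _; rewrite (ltW pp0) /= (_ : s 0%N = 1 - T)%R //.
  by move: t0p Tt0; lra.
have [x2 Hx2] := geometric_domination (W * cst) s0p.
pose y0 := maxn x2 y.
pose m := (s 0%N ^+ y0)%R.
have s0pos : (0 < s 0%N)%R by case/andP: s0p => /le_lt_trans; apply.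
have m0 : (0 < m)%R by rewrite exprn_gt0.
have Fm N x : (0 < N)%N -> (x <= y0)%N -> (m <= F N x)%R.
  case: N => // N _ xy0; rewrite /F big_ord_recl /= mul1r.
  apply: (@le_trans _ _ (s 0%N ^+ x)%R).
    rewrite /m -(subnK xy0) exprD ler_piMl ?exprn_ge0 ?(ltW s0pos)//.
    by case/andP: (s01 0%N (y0 - x)%N).
  rewrite lerDl; apply: sumr_ge0 => k _; apply: (mulr_ge0 (w0 (lift ord0 k))).
  by case/andP: (s01 (lift ord0 k) x).
have m4 : (0 < m / 4)%R by rewrite divr_gt0.
have [K HK] := bounded_series_tail w0 wsum m4.
have [x1 Hx1] : exists x1, forall N, (F N x1 <= m / 2)%R.
  have sK : (0 <= s K < 1)%R.
    have /andP[tK0 _] := tkr K; have /andP[sK0 _] := onem_range (tkr K).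
    by rewrite /s sK0 ltrBlDr ltrDl.
  have WK : (0 < m / 4 / (W + 1))%R by rewrite divr_gt0// ltr_wpDl.
  have [x1 Hx1] := eventually_lt sK WK.
  exists x1 => N.
  have FK : (F K x1 <= m / 4)%R.
    apply: (@le_trans _ _ (\sum_(k < K) w k * s K ^+ x1)%R).
      apply: ler_sum => k _; rewrite ler_wpM2l// lerXn2r//.
      - by rewrite nnegrE; case/andP: (onem_range (tkr k)).
      - by rewrite nnegrE; case/andP: (onem_range (tkr K)).
      - by rewrite lerD2l lerN2; apply: (iterate_noninc b0 T0 bT fb); exact: ltnW.
    rewrite -mulr_suml; apply: le_trans (ler_wpM2r _ (wsum K)) _.
      by case/andP: (s01 K x1).
    apply: le_trans (ler_wpM2l W0 (Hx1 _ (leqnn _))) _.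
    rewrite mulrA ler_pdivrMr ?ltr_wpDl// mulrC ler_pM2l//.
    by rewrite lerDl.
  have FS N' : (F N' x1 <= F K x1 + m / 4)%R.
    have [NK|KN] := leqP N' K.
      rewrite -(subnKC NK) /F big_split_ord /= -addrA lerDl addr_ge0 ?(ltW m4)//.
      by apply: sumr_ge0 => k _; rewrite mulr_ge0//; case/andP: (s01 (N' + k)%N x1).
    have := HK N'; rewrite -(subnKC (ltnW KN)) /F !big_split_ord /= !lerD2l.
    apply: le_trans; apply: ler_sum => k _; rewrite ler_piMr//.
    by case/andP: (s01 (K + k)%N x1).
  by have := FS N; lra.
apply: (@transience_criterion _ _ _ _ _ mS irr y x1) => eps eps0.
have wsmall : exists2 N, (0 < N)%N & (w N / m <= eps)%R.
  have [K' HK'] := bounded_series_tail w0 wsum (mulr_gt0 eps0 m0).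
  exists K'.+1 => //; rewrite ler_pdivrMr//.
  have := HK' K'.+2; rewrite !big_ord_recr /= -addrA lerD2l.
  by apply: le_trans; rewrite lerDr.
have [N N0 wN] := wsmall.
exists (fun z => Num.min (F N z / m) 1)%R; split.
- by move=> z; rewrite le_min ler01 divr_ge0 ?(ltW m0)//= ge_min lexx orbT.
- apply/eqP; rewrite eq_le ge_min lexx orbT le_min lexx andbT ler_pdivlMr// mul1r.
  by apply: Fm => //; exact: leq_maxr.
- by rewrite ge_min ler_pdivrMr// mulrC; apply/orP; left; exact: Hx1.
move=> x.
have k1 : A (EFin \o (fun z => Num.min (F N z / m) 1)%R) x <= 1.
  rewrite -[X in _ <= X](Ex_cst P (S x)); apply: Ex_le => // z /=.
    by rewrite lee_fin le_min ler01 divr_ge0 ?(ltW m0).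
  by rewrite lee_fin ge_min lexx orbT.
have [lt|ge] := leP (F N x / m)%R 1%R; last first.
  by apply: le_trans k1 _; rewrite lee_fin lerDl ltW.
have [xy0|y0x] := leqP x y0.
  have -> : (F N x / m)%R = 1%R.
    by apply/eqP; rewrite eq_le lt /= ler_pdivlMr// mul1r; exact: Fm.
  by apply: le_trans k1 _; rewrite lee_fin lerDl ltW.
apply: (@le_trans _ _ (A (fun z => (m^-1)%:E * (EFin \o F N) z) x)).
  apply: Ex_le => // z /=.
    by rewrite lee_fin le_min ler01 divr_ge0 ?(ltW m0).
  by rewrite -EFinM lee_fin ge_min mulrC lexx.
rewrite ExZ; [|exact: (mS x)|by rewrite lee_fin invr_ge0 ltW|by move=> v; exact: F0].
apply: le_trans (lee_wpmul2l _ (AF N x)) _; first by rewrite lee_fin invr_ge0 ltW.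
rewrite -EFinM lee_fin mulrC mulrDl mulrDl -addrA lerD2l.
apply: le_trans wN; rewrite gerDl mulr_le0_ge0 ?invr_ge0 ?(ltW m0)// subr_le0.
by apply: Hx2; apply: leq_trans (ltnW y0x); exact: leq_maxl.
Qed.
(** For [c < b] the weights [t_k] alone would do.  The correction [M * t_k ^ 2] makes
    the case [c = b] work: it lowers the ratio of consecutive weights by
    [M * b * t_k ^ 2], which beats the unknown second-order terms.  The telescoped sum
    leaves [w 0 * s 0 ^ x], of the wrong sign; doubling the first weight produces a
    gain of order [s 1 ^ x], which dominates it and [p ^ x] for large [x]. *)
Lemma pgf_recurrent : (c <= b)%R ->
  forall y (eps : R) x, (0 < eps)%R -> exists n, survival P S y n x <= eps%:E.
Proof.
move=> cb y.
pose M := (8 * (gam + cst) / b)%R.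
have M0 : (0 <= M)%R by rewrite divr_ge0 ?(ltW b0)// mulr_ge0// addr_ge0.
have Mb : (M * b = 8 * (gam + cst))%R by rewrite /M divfK// gt_eqF.
have [|T /andP[T0 Tt0] /= /and5P[bT gamT MT cT /andP[cstT _]]] :=
  @small_enough _ t0 [:: (b, 2^-1); (gam, b / 2); (M, 1); (`|c|, 4^-1);
                         (cst, 4^-1)]%R t00.
  by rewrite /= (ltW b0) gam0 cst0 M0 normr_ge0 !invr_gt0 !divr_gt0//= !ltr0n ltr01.
have Tr t : (0 < t <= T)%R -> (0 < t <= t0)%R.
  by move=> /andP[-> /le_trans]; apply.
have fb t : (0 < t <= T)%R -> (t - b * t ^+ 2 <= f t <= t - b / 2 * t ^+ 2)%R.
  move=> tT; apply: f_half; first exact: Tr.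
  by apply: le_trans gamT; rewrite ler_wpM2l//; case/andP: tT.
pose tk k := iter k f T.
have tkT k : (0 < tk k <= T)%R by exact: (iterate_range b0 T0 bT fb).
have tkr k : (0 < tk k <= t0)%R by apply: Tr.
have tk0 k : (0 < tk k)%R by case/andP: (tkT k).
pose wt t : R := (t + M * t ^+ 2)%R.
have wt0 t : (0 <= t)%R -> (0 <= wt t)%R.
  by move=> t_0; rewrite addr_ge0// mulr_ge0// exprn_ge0.
have gpos t : (0 < t <= T)%R -> (0 < g t)%R.
  move=> tT; have /andP[t_0 t_T] := tT.
  have ct : (c * t <= 4^-1)%R.
    apply: le_trans cT; apply: (@le_trans _ _ (`|c| * t)%R).
      by rewrite ler_wpM2r ?(ltW t_0)// ler_norm.
    by rewrite ler_wpM2l.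
  have cstt : (cst * t ^+ 2 <= 4^-1)%R.
    apply: le_trans cstT; rewrite ler_wpM2l// expr2 (le_trans _ t_T)//.
    by rewrite ler_piMl ?(ltW t_0)// (le_trans t_T)// (le_trans Tt0)// ltW// t0_lt1.
  by have /andP[gl _] := hg (Tr _ tT); lra.
(* The constant 8 in [M] leaves a factor 4 over the second-order errors, of which
   the bounds [1 + M t <= 2] and [r >= 1/2] use up all. *)
have wt_dec t : (0 < t <= T)%R -> (wt (f t) <= g t * wt t)%R.
  move=> tT; have /andP[t_0 t_T] := tT.
  have /andP[gl _] := hg (Tr _ tT); have /andP[fl fu] := fb _ tT.
  have /andP[_ fu3] := hf (Tr _ tT).
  have bt : (b * t <= 2^-1)%R by apply: le_trans bT; rewrite ler_wpM2l// ltW.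
  have Mt : (M * t <= 1)%R by apply: le_trans MT; rewrite ler_wpM2l.
  have f_pos : (0 <= f t)%R.
    have : (0 <= t * (1 - b * t))%R by rewrite mulr_ge0 ?(ltW t_0)//; lra.
    by move=> pos; apply: le_trans fl; lra.
  pose r := (1 - b * t + gam * t ^+ 2)%R.
  have r2 : (2^-1 <= r)%R.
    have : (0 <= gam * t ^+ 2)%R by rewrite mulr_ge0// exprn_ge0// ltW.
    by rewrite /r; lra.
  pose q := (1 + M * t - M * b / 2 * t ^+ 2)%R.
  have step : (wt (f t) <= (t * r) * q)%R.
    rewrite /wt (_ : f t + M * f t ^+ 2 = f t * (1 + M * f t))%R; last by ring.
    apply: ler_pM => //; first by rewrite addr_ge0// mulr_ge0.
      by rewrite /r; lra.
    have := ler_wpM2l M0 fu; rewrite /q; lra.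
  apply: le_trans step _.
  apply: (@le_trans _ _ ((1 - b * t - cst * t ^+ 2) * wt t)%R); last first.
    rewrite ler_wpM2r ?wt0 ?(ltW t_0)//; apply: le_trans gl.
    by rewrite lerD2r lerD2l lerN2 ler_wpM2r// ltW.
  have key : (0 <= r * (M * b) / 2 - (1 + M * t) * (gam + cst))%R.
    rewrite Mb.
    have gc0 : (0 <= gam + cst)%R by rewrite addr_ge0.
    have := mulr_ge0 gc0 (_ : 0 <= r - 2^-1)%R; rewrite subr_ge0 => /(_ r2).
    have := mulr_ge0 gc0 (_ : 0 <= 1 - M * t)%R; rewrite subr_ge0 => /(_ Mt).
    by lra.
  have := mulr_ge0 (exprn_ge0 3 (ltW t_0)) key.
  by rewrite /wt /q /r; lra.
have g0 : (0 < g T)%R by apply: gpos; rewrite T0 lexx.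
pose w k := if k is k'.+1 then wt (tk k) else (2 * wt T)%R.
have wT : (0 < wt T)%R by rewrite ltr_wpDr// mulr_ge0// exprn_ge0// ltW.
have w0 k : (0 <= w k)%R.
  by case: k => [|k]; rewrite /w ?mulr_ge0 ?(ltW wT)// wt0// ltW.
have w_le k : (w k * tk k <= 4 * tk k ^+ 2)%R.
  have Mtk : (M * tk k <= 1)%R.
    by apply: le_trans MT; rewrite ler_wpM2l//; case/andP: (tkT k).
  apply: (@le_trans _ _ (2 * wt (tk k) * tk k)%R).
    rewrite ler_wpM2r ?(ltW (tk0 k))//; case: (k) => [//|k'].
    by rewrite /w ler_peMl ?ler1n// wt0// ltW.
  have := mulr_ge0 (exprn_ge0 2 (ltW (tk0 k))) (_ : 0 <= 1 - M * tk k)%R.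
  by rewrite subr_ge0 => /(_ Mtk); rewrite /wt; lra.
pose W := (8 * T / b)%R.
have W0 : (0 <= W)%R by rewrite divr_ge0 ?(ltW b0)// mulr_ge0// ltW.
have wsum N : (\sum_(k < N) w k * tk k <= W)%R.
  apply: (@le_trans _ _ (\sum_(k < N) 4 * tk k ^+ 2)%R); first exact: ler_sum.
  rewrite -mulr_sumr; have := iterate_sum_sq b0 T0 bT fb N; rewrite -/tk /W.
  set Q := (\sum_(k < N) _)%R; have -> : (8 * T / b = 4 * (2 * T / b))%R by ring.
  by move=> H; rewrite ler_pM2l.
pose s k := (1 - tk k)%R.
have s01 k z : (0 <= s k ^+ z <= 1)%R by exact: onem_exp_range.
pose F N x := (\sum_(k < N) w k * (1 - s k ^+ x))%R.
have F0 N x : (0 <= F N x)%R.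
  by apply: sumr_ge0 => k _; rewrite mulr_ge0// subr_ge0; case/andP: (s01 k x).
have FW N x : (F N x <= x%:R * W)%R.
  apply: le_trans (ler_wpM2l _ (wsum N)) => //.
  rewrite mulr_sumr; apply: ler_sum => k _; rewrite mulrCA ler_wpM2l//.
  have := bernoulli_lower x (_ : 0 <= tk k <= 1)%R; rewrite -/(s k).
  have /andP[tkk0 tkk1] := tkr k.
  rewrite (ltW tkk0) (le_trans tkk1 (ltW t0_lt1)) => /(_ isT).
  by lra.
have AF N x : (0 < N)%N -> A (EFin \o F N) x <=
    (F N x + (w 0%N * s 0%N ^+ x - wt T * g T * s 1%N ^+ x + cst * W * p ^+ x))%R%:E.
  move=> N0; rewrite (pgf_combination_onem N x w0 tkr) lee_fin.
  have -> : (\sum_(k < N) w k * (1 - (g (tk k) * (1 - f (tk k)) ^+ x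
                                      + e (tk k) * p ^+ x)) =
      F N x + \sum_(k < N) (w k * s k ^+ x - w k * g (tk k) * s k.+1 ^+ x)
      + p ^+ x * \sum_(k < N) w k * - e (tk k))%R.
    rewrite mulr_sumr -!big_split /=; apply: eq_bigr => k _.
    by rewrite /s /tk /= -/(tk k); ring.
  rewrite -addrA lerD2l; apply: lerD.
    case: N N0 => // N _.
    suff H : (\sum_(k < N.+1) (w k * s k ^+ x - w k * g (tk k) * s k.+1 ^+ x)
             + w N.+1 * s N.+1 ^+ x <= w 0%N * s 0%N ^+ x - wt T * g T * s 1%N ^+ x)%R.
      apply: le_trans H; rewrite lerDl mulr_ge0//.
      by case/andP: (s01 N.+1 x).
    have wdec k : (wt (tk k.+1) * s k.+1 ^+ x <= wt (tk k) * g (tk k) * s k.+1 ^+ x)%R.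
      rewrite ler_wpM2r//; first by case/andP: (s01 k.+1 x).
      by rewrite [leRHS]mulrC; exact: wt_dec.
    elim: N => [|N IH].
      have := wdec 0%N; rewrite big_ord1 /w /=.
      by lra.
    rewrite big_ord_recr /=; have := wdec N.+1; move: IH; rewrite /=.
    by lra.
  rewrite mulrC; apply: ler_wpM2r; first by case/andP: (p_exp_range x).
  apply: (@le_trans _ _ (\sum_(k < N) cst * (w k * tk k))%R).
    apply: ler_sum => k _; rewrite mulrCA ler_wpM2l//.
    by have /andP[el _] := he (tkr k); lra.
  by rewrite -mulr_sumr ler_wpM2l.
have s0E : s 0%N = (1 - T)%R by [].
have s0_ge0 : (0 <= s 0%N)%R by rewrite s0E; have := t0_lt1; move: Tt0; lra.
have s01lt : (s 0%N < s 1%N)%R.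
  rewrite ltrD2l ltrN2; have /andP[_ fu] := fb _ (tkT 0%N).
  apply: le_lt_trans fu _; rewrite gtrDl oppr_lt0 mulr_gt0 ?divr_gt0//.
  exact: exprn_gt0.
have ps1 : (0 <= p < s 1%N)%R.
  case/andP: p01 => pp0 _; rewrite (ltW pp0) /=; apply: lt_trans s01lt.
  by rewrite s0E; move: t0p Tt0; lra.
have [y1 Hy1] := geometric_domination (4 / g T) (introT andP (conj s0_ge0 s01lt)).
have [y2 Hy2] := geometric_domination (2 * (cst * W) / (wt T * g T)) ps1.
have drift N x : (0 < N)%N -> ((maxn y1 y2).+1 <= x)%N ->
    A (EFin \o F N) x <= (F N x)%:E.
  move=> N0 xy; apply: le_trans (AF N x N0) _; rewrite lee_fin gerDl.
  have wg : (0 < wt T * g T)%R by rewrite mulr_gt0.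
  have H1 : (w 0%N * s 0%N ^+ x <= 2^-1 * (wt T * g T * s 1%N ^+ x))%R.
    have /Hy1 : (y1 <= x)%N by apply: leq_trans (ltnW xy); exact: leq_maxl.
    move=> /(ler_wpM2l (ltW wg)).
    rewrite (_ : wt T * g T * (4 / g T * s 0%N ^+ x) = 2 * (w 0%N * s 0%N ^+ x))%R.
      by move=> H; lra.
    by rewrite /w; field; rewrite gt_eqF.
  have H2 : (cst * W * p ^+ x <= 2^-1 * (wt T * g T * s 1%N ^+ x))%R.
    have /Hy2 : (y2 <= x)%N by apply: leq_trans (ltnW xy); exact: leq_maxr.
    move=> /(ler_wpM2l (ltW wg)).
    rewrite (_ : wt T * g T * (2 * (cst * W) / (wt T * g T) * p ^+ x) =
                 2 * (cst * W * p ^+ x))%R.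
      by move=> H; lra.
    by field; rewrite !gt_eqF.
  by lra.
apply: (@recurrence_criterion _ _ _ _ _ mS irr y (maxn y1 y2).+1) => // x0 ep ep0.
pose L := (2 * (x0%:R * W + 1) / ep)%R.
have xW0 : (0 < x0%:R * W + 1)%R by rewrite ltr_wpDl// mulr_ge0.
have L0 : (0 < L)%R by rewrite divr_gt0// mulr_gt0.
have [N HN] := iterate_sum_infinite b0 T0 bT fb L.
have N0 : (0 < N)%N.
  by rewrite lt0n; apply/eqP => NE; move: HN; rewrite NE big_ord0 leNgt L0.
exists (fun z => 2 / L * F N z)%R.
have L2 : (0 < 2 / L)%R by rewrite divr_gt0.
split.
- by move=> z; rewrite mulr_ge0// ltW.
- rewrite mulrAC ler_pdivrMr//.
  have -> : (ep * L = 2 * (x0%:R * W + 1))%R by rewrite /L mulrC divfK// gt_eqF.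
  by rewrite ler_pM2l// (le_trans (FW N x0))// lerDl.
- have sN : (0 <= s N < 1)%R.
    have /andP[sN0 _] := onem_range (tkr N).
    by rewrite /s sN0 ltrBlDr ltrDl tk0.
  have half0 : (0 < 2^-1 :> R)%R by rewrite invr_gt0.
  have [x1 Hx1] := eventually_lt sN half0.
  exists x1 => x /Hx1 sx.
  rewrite mulrAC ler_pdivlMr// mul1r -ler_pdivrMl// mulrC.
  apply: (@le_trans _ _ (\sum_(k < N) tk k * 2^-1)%R).
    by rewrite -mulr_suml ler_wpM2r.
  apply: ler_sum => k _; apply: ler_pM => //; first exact: ltW.
    have tw : (tk k <= wt (tk k))%R.
      by rewrite lerDl mulr_ge0// exprn_ge0// ltW.
    case: (k) tw => -[|k'] ? /= tw //.
    apply: le_trans tw _.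
    by rewrite ler_peMl ?ler1n// ltW.
  have : (s k ^+ x <= s N ^+ x)%R.
    rewrite lerXn2r ?nnegrE//.
    - by case/andP: (onem_range (tkr k)).
    - by case/andP: sN.
    - by rewrite lerD2l lerN2; apply: (iterate_noninc b0 T0 bT fb); exact: ltnW.
  by lra.
- move=> x xy.
  rewrite (_ : EFin \o _ = (fun z => (2 / L)%:E * (EFin \o F N) z)); last first.
    by apply/funext => z /=; rewrite EFinM.
  rewrite ExZ; [|exact: (mS x)|by rewrite lee_fin ltW|by move=> v; exact: F0].
  by rewrite [leRHS]EFinM lee_wpmul2l ?lee_fin ?(ltW L2)//; exact: drift.
Qed.
Definition slope (t : R) (z : nat) : R := ((1 - (1 - t) ^+ z) / t)%R.

Lemma slope_range t z : (0 < t <= t0)%R -> (0 <= slope t z <= z%:R)%R.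
Proof.
move=> tr; have /andP[t_0 tt0] := tr; have /andP[s0 s1] := onem_exp_range z tr.
rewrite /slope divr_ge0 ?subr_ge0 ?(ltW t_0)//= ler_pdivrMr//.
have := bernoulli_lower z (_ : 0 <= t <= 1)%R.
by rewrite (ltW t_0) (le_trans tt0 (ltW t0_lt1)) => /(_ isT); lra.
Qed.

Lemma slope_lower t z : (0 < t <= t0)%R -> (z%:R - z%:R ^+ 2 * t <= slope t z)%R.
Proof.
move=> tr; have /andP[t_0 tt0] := tr.
rewrite /slope ler_pdivlMr//.
have := bernoulli_upper_sq z (_ : 0 <= t <= 1)%R.
by rewrite (ltW t_0) (le_trans tt0 (ltW t0_lt1)) => /(_ isT); lra.
Qed.

Lemma Ex_slope t x : (0 < t <= t0)%R -> A (EFin \o slope t) x =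
  ((1 - (g t * (1 - f t) ^+ x + e t * p ^+ x)) / t)%R%:E.
Proof.
move=> tr; have /andP[t_0 _] := tr.
rewrite (_ : EFin \o _ = (fun z => (t^-1)%:E * (1 - (1 - t) ^+ z)%:E)); last first.
  by apply/funext => z; rewrite -EFinM mulrC.
rewrite ExZ; last 3 first.
- exact: (mS x).
- by rewrite lee_fin invr_ge0 ltW.
- by move=> z; rewrite lee_fin subr_ge0; case/andP: (onem_exp_range z tr).
rewrite (Ex_onem (mS x) _ (hA x tr)) => [|z]; last exact: onem_exp_range.
by rewrite -EFinM mulrC.
Qed.

(** The slopes tend to the identity as [t] tends to 0, uniformly on bounded sets,
    so a bound on their expectations passes to the identity by truncation. *)
Lemma Ex_id_le x (B tau : R) : (0 < tau <= t0)%R ->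
  (forall t, (0 < t <= tau)%R -> A (EFin \o slope t) x <= B%:E) ->
  A (fun z => (z%:R : R)%:E) x <= B%:E.
Proof.
move=> /andP[tau0 taut0] HB; rewrite (Ex_series P (mS x))//.
apply: lime_le; first by apply: is_cvg_nneseries => v _ _; apply: mule_ge0.
apply: nearW => N /=; apply/lee_addgt0Pr => eps eps0.
have N1 : (0 < N%:R ^+ 2 + 1 :> R)%R by rewrite ltr_wpDl// exprn_ge0.
pose t := Num.min tau (eps / (N%:R ^+ 2 + 1))%R.
have t_0 : (0 < t)%R by rewrite lt_min tau0 divr_gt0.
have ttau : (t <= tau)%R by rewrite ge_min lexx.
have tr : (0 < t <= t0)%R by rewrite t_0 (le_trans ttau).
have tN : (N%:R ^+ 2 * t <= eps)%R.
  apply: (@le_trans _ _ ((N%:R ^+ 2 + 1) * t)%R); first by rewrite ler_wpM2r ?(ltW t_0)// lerDl.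
  by rewrite mulrC -ler_pdivlMr// ge_min lexx orbT.
have sl0 z : 0 <= (slope t z)%:E by rewrite lee_fin; case/andP: (slope_range z tr).
pose h v : \bar R := if (v < N)%N then (v%:R)%:E else 0.
have h0 v : 0 <= h v by rewrite /h; case: ifP => _; rewrite ?lee_fin.
apply: (@le_trans _ _ (A h x)).
  rewrite (Ex_series P (mS x))//; apply: le_trans (nneseries_lim_ge N _).
    rewrite !big_mkord; apply: lee_sum => i _.
    by rewrite /h ltn_ord.
  by move=> v _ _; apply: mule_ge0.
apply: (@le_trans _ _ (A (fun z => (EFin \o slope t) z + eps%:E) x)).
  apply: Ex_le => // v; rewrite /h; case: ifP => vN.
    rewrite -EFinD lee_fin -lerBlDr; apply: le_trans (slope_lower v tr).
    rewrite lerD2l lerN2; apply: le_trans tN; rewrite ler_wpM2r ?(ltW t_0)//.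
    by rewrite lerXn2r ?nnegrE// ler_nat ltnW.
  by apply: adde_ge0; [exact: sl0|rewrite lee_fin ltW].
rewrite ExD; [|exact: (mS x)|exact: sl0|by move=> v; rewrite lee_fin ltW].
by rewrite Ex_cst leeD2r// HB// t_0.
Qed.

(** The derivative at 1 of the one-step transform, as an upper bound; [t] is sent
    to 0 for fixed [x]. *)
Lemma Ex_id_upper x : (c < 0)%R ->
  A (fun z => (z%:R : R)%:E) x <= (x%:R + c + cst * p ^+ x)%R%:E.
Proof.
move=> c0; apply/lee_addgt0Pr => eps eps0.
pose D := (cst + x%:R * - c)%R.
have D0 : (0 <= D)%R by rewrite addr_ge0// mulr_ge0// oppr_ge0 ltW.
have [|tau /andP[tau0 taut0] /= /and4P[gamT cstT DT _]] :=
  @small_enough _ t0 [:: (gam, b / 2); (cst, 1); (D, eps)]%R t00.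
  by rewrite /= gam0 cst0 D0 eps0 divr_gt0//= ltr01.
rewrite -EFinD; apply: (@Ex_id_le _ _ tau); first by rewrite tau0.
move=> t /andP[t_0 ttau].
have tr : (0 < t <= t0)%R by rewrite t_0 (le_trans ttau).
rewrite Ex_slope// lee_fin ler_pdivrMr//.
have t1 : (t <= 1)%R by apply: le_trans (ltW t0_lt1); case/andP: tr.
have gamt : (gam * t <= b / 2)%R by apply: le_trans gamT; rewrite ler_wpM2l.
have /andP[_ fu] := f_half tr gamt.
have /andP[gl _] := hg tr; have /andP[el _] := he tr.
have ft : (f t <= t)%R.
  by apply: le_trans fu _; rewrite gerBl mulr_ge0 ?exprn_ge0 ?divr_ge0 ?(ltW b0) ?(ltW t_0).
have /andP[s0 _] := onem_range tr.
have u1 : (1 - x%:R * t <= (1 - f t) ^+ x)%R.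
  apply: le_trans (bernoulli_lower x (_ : 0 <= t <= 1)%R) _; first by rewrite (ltW t_0).
  by rewrite lerXn2r ?nnegrE ?lerD2l ?lerN2// (le_trans s0)// lerD2l lerN2.
have u0 : (0 <= (1 - f t) ^+ x)%R.
  by rewrite exprn_ge0// (le_trans s0)// lerD2l lerN2.
have cstt : (cst * t ^+ 2 <= 1)%R.
  apply: le_trans cstT; rewrite ler_wpM2l// expr2 (le_trans _ ttau)//.
  by rewrite ler_piMl// ltW.
have ct : (0 <= - c * t)%R by rewrite mulr_ge0 ?(ltW t_0)// oppr_ge0 ltW.
have gl0 : (0 <= 1 - c * t - cst * t ^+ 2)%R by lra.
have H1 := le_trans (ler_wpM2l gl0 u1) (ler_wpM2r u0 gl).
have pp : (0 <= p ^+ x)%R by case/andP: (p_exp_range x).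
have H2 := ler_wpM2r pp el.
have Dt : (D * t <= eps)%R by apply: le_trans DT; rewrite ler_wpM2l.
have H3 := ler_wpM2r (ltW t_0) Dt.
have H4 : (0 <= x%:R * cst * t ^+ 3)%R.
  by rewrite mulr_ge0 ?exprn_ge0 ?(ltW t_0)// mulr_ge0.
by move: H3; rewrite /D; lra.
Qed.

Lemma pgf_positive_recurrent y : (c < 0)%R ->
  exists M : R, forall n, expected_upto P S y n y <= M%:E.
Proof.
move=> c0; pose q := (2 / - c)%R.
have nc0 : (0 < - c)%R by rewrite oppr_gt0.
have q0 : (0 < q)%R by rewrite divr_gt0.
have qc : (q * c = - 2)%R by rewrite /q; field; rewrite lt_eqF.
have p1 : (0 <= p < 1)%R by case/andP: p01 => /ltW -> ->.
have [y1 Hy1] := geometric_domination (q * cst) p1.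
have AV x : A (EFin \o (fun z => q * z%:R)%R) x <=
    (q * (x%:R + c + cst * p ^+ x))%R%:E.
  rewrite (_ : EFin \o _ = (fun z => q%:E * (z%:R)%:E)); last first.
    by apply/funext => z; rewrite -EFinM.
  rewrite ExZ; [|exact: (mS x)|by rewrite lee_fin ltW|by []].
  by rewrite [leRHS]EFinM lee_wpmul2l ?lee_fin ?(ltW q0)// Ex_id_upper.
apply: (@positive_criterion _ _ _ _ _ mS irr y y1.+1 (fun z => q * z%:R)%R
  (q * cst)%R) => //.
- by rewrite mulr_ge0 ?(ltW q0).
- by move=> z; rewrite mulr_ge0 ?(ltW q0).
- move=> x xy; apply: le_trans (leeD2r _ (AV x)) _.
  rewrite -EFinD lee_fin; have := Hy1 x (ltnW xy); rewrite expr1n.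
  by lra.
- move=> x; apply: le_trans (AV x) _; rewrite lee_fin.
  have /andP[_ px1] := p_exp_range x.
  have := ler_wpM2l (mulr_ge0 (ltW q0) cst0) px1.
  by lra.
Qed.

Lemma exp_diff_le (r s : R) n : (0 <= s <= r)%R -> (r <= 1)%R ->
  (r ^+ n - s ^+ n <= (r - s) * (n%:R * r ^+ n.-1))%R.
Proof.
move=> /andP[s0 sr] r1; have r0 : (0 <= r)%R by apply: le_trans sr.
elim: n => [|n IH]; first by rewrite !expr0 subrr mul0r mulr0.
have -> : (r ^+ n.+1 - s ^+ n.+1 = r * (r ^+ n - s ^+ n) + (r - s) * s ^+ n)%R.
  by rewrite !exprS; ring.
have H1 := ler_wpM2l r0 IH.
have H2 : ((r - s) * s ^+ n <= (r - s) * r ^+ n)%R.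
  by rewrite ler_wpM2l ?subr_ge0// lerXn2r ?nnegrE.
apply: le_trans (lerD H1 H2) _.
rewrite -natr1 /=.
case: n {IH H1 H2} => [|n] /=; first by rewrite expr0; lra.
by rewrite [(r ^+ n.+1)%R]exprS; lra.
Qed.

(** The left-hand side is the probability of exactly one success in [n] trials. *)
Lemma one_success_prob_le1 (a : R) n : (0 <= a <= 1)%R ->
  (n%:R * a * (1 - a) ^+ n.-1 <= 1)%R.
Proof.
move=> /andP[a0 a1]; have s0 : (0 <= 1 - a)%R by rewrite subr_ge0.
suff H : (n%:R * a * (1 - a) ^+ n.-1 + (1 - a) ^+ n <= 1)%R.
  by apply: le_trans H; rewrite lerDl exprn_ge0.
elim: n => [|n IH]; first by rewrite !mul0r expr0 add0r.
have H1 := ler_wpM2l s0 IH.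
have H2 : (a * (1 - a) ^+ n <= a)%R.
  by rewrite ler_piMr// exprn_ile1// gerBl.
rewrite -natr1 /= exprS.
case: n IH H1 H2 => [|n] /= IH H1 H2; first by move: H1 H2; rewrite expr0; lra.
by move: H1 H2; rewrite !exprS; lra.
Qed.

Lemma Ex_id_lower x (q : R) : (0 <= c)%R ->
  (forall t, (0 < t <= t0)%R -> (e t <= - (q * t) + cst * t ^+ 2)%R) ->
  (x%:R + c + q * p ^+ x)%R%:E <= A (fun z => (z%:R : R)%:E) x.
Proof.
move=> c0 heq; apply/lee_addgt0Pr => eps eps0.
pose B := (x%:R * b + x%:R ^+ 2)%R.
have B0 : (0 <= B)%R by rewrite addr_ge0 ?exprn_ge0// mulr_ge0// ltW.
pose D := (cst + B + c * x%:R + cst * B + cst)%R.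
have D0 : (0 <= D)%R.
  apply: addr_ge0 => //; apply: addr_ge0; last exact: mulr_ge0.
  by apply: addr_ge0; [exact: addr_ge0|exact: mulr_ge0].
have [|t /andP[t_0 tt0] /= /and5P[bt ct Dt gamt _]] :=
  @small_enough _ t0 [:: (b, 1); (c, 1); (D, eps); (gam, b / 2)]%R t00.
  by rewrite /= (ltW b0) c0 D0 gam0 eps0 ltr01 divr_gt0//.
have tr : (0 < t <= t0)%R by rewrite t_0.
apply: (@le_trans _ _ (A (EFin \o slope t) x + eps%:E)); last first.
  apply: leeD2r; apply: Ex_le => // z; rewrite lee_fin; by case/andP: (slope_range z tr).
rewrite Ex_slope// -EFinD lee_fin -lerBlDr ler_pdivlMr//.
have t1 : (t <= 1)%R by apply: le_trans tt0 (ltW t0_lt1).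
have /andP[fl _] := hf tr.
have /andP[_ gu] := hg tr; have eu := heq _ tr.
pose v := (t - b * t ^+ 2)%R.
have v0 : (0 <= v)%R.
  have : (0 <= t * (1 - b * t))%R by rewrite mulr_ge0 ?(ltW t_0)// subr_ge0.
  by rewrite /v; lra.
have vt : (v <= t)%R by rewrite /v gerBl mulr_ge0 ?exprn_ge0// ltW.
have /andP[_ fu] := f_half tr gamt.
have ft : (f t <= t)%R.
  by apply: le_trans fu _; rewrite gerBl mulr_ge0 ?exprn_ge0 ?divr_ge0 ?(ltW b0) ?(ltW t_0).
have /andP[s0 _] := onem_range tr.
set u := ((1 - f t) ^+ x)%R.
have u0 : (0 <= u)%R.
  by rewrite exprn_ge0// (le_trans s0)// lerD2l lerN2.
have uB : (u <= 1 - x%:R * t + B * t ^+ 2)%R.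
  apply: (@le_trans _ _ ((1 - v) ^+ x)%R).
    rewrite lerXn2r ?nnegrE ?lerD2l ?lerN2//.
      by rewrite (le_trans s0)// lerD2l lerN2.
    by rewrite (le_trans s0)// lerD2l lerN2.
  apply: le_trans (bernoulli_upper_sq x (_ : 0 <= v <= 1)%R) _.
    by rewrite v0 (le_trans vt).
  have : (x%:R ^+ 2 * v ^+ 2 <= x%:R ^+ 2 * t ^+ 2)%R.
    by rewrite ler_wpM2l ?exprn_ge0// lerXn2r ?nnegrE// ltW.
  by rewrite /B /v; lra.
have gu0 : (0 <= 1 - c * t + cst * t ^+ 2)%R.
  by rewrite addr_ge0 ?subr_ge0// mulr_ge0// exprn_ge0// ltW.
have H1 := le_trans (ler_wpM2r u0 gu) (ler_wpM2l gu0 uB).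
have /andP[pp pp1] := p_exp_range x.
have H2 := ler_wpM2r pp eu.
have t2 : (0 <= t ^+ 2)%R by rewrite exprn_ge0// ltW.
have H3 : (cst * t ^+ 2 * p ^+ x <= cst * t ^+ 2)%R.
  by rewrite ler_piMr// mulr_ge0.
have H4 := ler_wpM2r (ltW t_0) Dt.
have H5 : (cst * B * t ^+ 4 <= cst * B * t ^+ 2)%R.
  rewrite ler_wpM2l ?mulr_ge0// (_ : 4 = 2 + 2)%N// exprD ler_piMr//.
  by rewrite exprn_ile1// ltW.
have H6 : (0 <= (c * B + x%:R * cst) * t ^+ 3)%R.
  by rewrite mulr_ge0 ?exprn_ge0 ?(ltW t_0)// addr_ge0 ?mulr_ge0.
by move: H4; rewrite /D; lra.
Qed.

(** The slope at [t = tau / x0] is bounded by [t^-1] and at least [x0 / 2] at [x0].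
    Its drift is bounded below uniformly in [t]: the critical branching costs at most
    [(1 - f t) ^ x - (1 - t) ^ x <= 2 * b * t], by [one_success_prob_le1]. *)
Lemma pgf_not_positive y (q : R) : (0 <= c)%R -> (0 < c)%R \/ (0 <= q)%R ->
  (forall t, (0 < t <= t0)%R -> (e t <= - (q * t) + cst * t ^+ 2)%R) ->
  \sum_(n <oo) survival P S y n y = +oo.
Proof.
move=> c0 cq heq.
have [N HN] : exists N, forall x, (N <= x)%N -> (0 <= c + q * p ^+ x)%R.
  have [q0|q0] := leP 0%R q.
    exists 0%N => x _; rewrite addr_ge0// mulr_ge0//.
    by case/andP: (p_exp_range x).
  have {}c0 : (0 < c)%R by case: cq => //; rewrite leNgt q0.
  have p1 : (0 <= p < 1)%R by case/andP: p01 => /ltW -> ->.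
  have [N HN] := geometric_domination (- q / c) p1.
  exists N => x /HN; rewrite expr1n mulrAC ler_pdivrMr// mul1r.
  by lra.
have [|tau /andP[tau0 taut0] /= /and3P[btau gamtau _]] :=
  @small_enough _ t0 [:: (b, 2^-1); (gam, b / 2)]%R t00.
  by rewrite /= (ltW b0) gam0 divr_gt0//= invr_gt0 ltr0n.
apply: (@null_criterion _ _ _ _ _ mS irr y (maxn N y.+1) (2 * cst + 2 * b)%R).
- by rewrite addr_ge0// mulr_ge0// ltW.
- exact: leq_maxr.
- move=> x Nx; apply: le_trans (Ex_id_lower x c0 heq).
  by rewrite lee_fin -addrA lerDl HN// (leq_trans _ Nx)// leq_maxl.
move=> x0 x00; pose t := (tau / x0%:R)%R.
have x0R : (0 < x0%:R :> R)%R by rewrite ltr0n.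
have t_0 : (0 < t)%R by rewrite divr_gt0.
have ttau : (t <= tau)%R.
  by rewrite ler_pdivrMr// ler_peMr ?(ltW tau0)// ler1n.
have x0t : (x0%:R * t = tau)%R by rewrite mulrC divfK// gt_eqF.
clearbody t.
have tr : (0 < t <= t0)%R by rewrite t_0 (le_trans ttau).
have t1 : (t <= 1)%R by apply: le_trans (ltW t0_lt1); case/andP: tr.
have bt : (b * t <= 2^-1)%R by apply: le_trans btau; rewrite ler_wpM2l// ltW.
have gamt : (gam * t <= b / 2)%R by apply: le_trans gamtau; rewrite ler_wpM2l.
exists (slope t); split.
- by move=> z; exact: slope_range.
- have tau1 : (tau <= 1)%R by apply: le_trans taut0 (ltW t0_lt1).
  rewrite /slope ler_pdivlMr//.
  have := bernoulli_upper x0 (_ : 0 <= t <= 1)%R.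
  rewrite (ltW t_0) t1 => /(_ isT).
  have : (0 <= tau * (1 - tau))%R by rewrite mulr_ge0 ?(ltW tau0)// subr_ge0.
  have : (0 <= x0%:R * t ^+ 2)%R by rewrite mulr_ge0// exprn_ge0// ltW.
  by rewrite -x0t; lra.
- exists (t^-1)%R => z; rewrite /slope ler_piMl ?invr_ge0 ?(ltW t_0)//.
  by rewrite gerBl; case/andP: (onem_exp_range z tr).
move=> x; rewrite Ex_slope// -EFinD lee_fin /slope -lerBlDl -mulrBl ler_pdivrMr//.
have /andP[_ fu] := f_half tr gamt; have /andP[fl _] := hf tr.
have ft : (f t <= t)%R.
  by apply: le_trans fu _; rewrite gerBl mulr_ge0 ?exprn_ge0 ?divr_ge0 ?(ltW b0) ?(ltW t_0).
have f2 : (t / 2 <= f t)%R.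
  have : (0 <= t * (2^-1 - b * t))%R by rewrite mulr_ge0 ?(ltW t_0)// subr_ge0.
  by lra.
have f0 : (0 <= f t)%R by apply: le_trans f2; rewrite divr_ge0// ltW.
have /andP[s0 _] := onem_range tr.
have sf : (0 <= 1 - t <= 1 - f t)%R by rewrite s0 lerD2l lerN2.
have f1 : (1 - f t <= 1)%R by rewrite gerBl.
have H1 := exp_diff_le x sf f1.
have f01 : (0 <= f t <= 1)%R by rewrite f0 (le_trans ft).
have H2 := one_success_prob_le1 x f01.
pose m := (x%:R * (1 - f t) ^+ x.-1)%R.
have m0 : (0 <= m)%R by rewrite mulr_ge0// exprn_ge0// subr_ge0; case/andP: f01.
have mt : (m * t <= 2)%R.
  have := ler_wpM2l m0 f2; move: H2; rewrite /m; lra.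
have H3 : (t - f t <= b * t ^+ 2)%R by lra.
have H4 := ler_wpM2r m0 H3.
have bt0 : (0 <= b * t)%R by rewrite mulr_ge0 ?(ltW b0) ?(ltW t_0).
have H5 := ler_wpM2l bt0 mt.
have /andP[_ gu] := hg tr; have /andP[_ eu] := he tr.
have /andP[pp pp1] := p_exp_range x.
have cstt0 : (0 <= cst * t)%R by rewrite mulr_ge0// ltW.
have H6 := le_trans (ler_wpM2r pp eu) (ler_wpM2l cstt0 pp1).
have u0 : (0 <= (1 - f t) ^+ x)%R by rewrite exprn_ge0// (le_trans s0); case/andP: sf.
have u1 : ((1 - f t) ^+ x <= 1)%R by rewrite exprn_ile1// (le_trans s0); case/andP: sf.
have g1 : (g t <= 1 + cst * t)%R.
  have G1 : (0 <= cst * t * (1 - t))%R by rewrite mulr_ge0// subr_ge0.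
  have G2 : (0 <= c * t)%R by rewrite mulr_ge0// ltW.
  by lra.
have H7 := ler_wpM2r u0 g1.
have H8 := ler_wpM2l cstt0 u1.
rewrite -/m in H1; clearbody m.
by lra.
Qed.
End generating_function_criteria.

(** * Conditioning on independent discrete variables *)

Section binding.
Context {d : measure_display} {Omega : measurableType d} {R : realType}.
Context {P : probability Omega R}.
Context {T : eqType} (U : T -> {RV P >-> nat}) (U_indep : mutually_independent U).
Implicit Types (F : set T) (s : seq T) (B : T -> set nat) (V : Omega -> \bar R).

Lemma measurable_RV (Z : {RV P >-> nat}) : measurable_fun setT (Z : Omega -> nat).
Proof. exact: measurable_funP. Qed.

Definition cylinder s B : set Omega := \bigcap_(i in [set` s]) (U i @^-1` B i).

Lemma measurable_cylinder s B : measurable (cylinder s B).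
Proof.
elim: s => [|i s IH].
  by rewrite (_ : cylinder [::] B = setT)//; apply/seteqP; split.
have -> : cylinder (i :: s) B = U i @^-1` B i `&` cylinder s B.
  apply/seteqP; split=> [w Hw|w [iw sw] j /=].
    split; first by apply: Hw; rewrite /= mem_head.
    by move=> j js; apply: Hw; rewrite /= inE js orbT.
  by rewrite inE => /predU1P[->|/sw].
by apply: measurableI => //; apply: measurable_level; exact: measurable_RV.
Qed.

(** [V] has conditional expectation [c] given any finite number of variables
    whose indices lie outside [F]; testing on cylinders is all the chain needs. *)
Definition free_expectation F V (c : \bar R) : Prop :=
  [/\ measurable_fun setT V, forall w, 0 <= V w, 0 <= c &
      forall s B, uniq s -> (forall i, i \in s -> ~ F i) ->
        \int[P]_(w in cylinder s B) V w = P (cylinder s B) * c].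

Lemma free_expectationW F F' V c : F `<=` F' ->
  free_expectation F V c -> free_expectation F' V c.
Proof.
move=> FF' [mV V0 c0 Vc]; split=> // s B us sF; apply: Vc => // i si Fi.
exact: sF si (FF' _ Fi).
Qed.

Lemma free_expectation_cst F c : 0 <= c -> free_expectation F (fun=> c) c.
Proof.
move=> c0; split=> // s B _ _; rewrite integral_cst 1?muleC//.
exact: measurable_cylinder.
Qed.

Lemma free_expectation_eq F V V' c c' : V =1 V' -> c = c' ->
  free_expectation F V c -> free_expectation F V' c'.
Proof. by move=> /funext -> ->. Qed.

Lemma integral_free F V c : free_expectation F V c -> \int[P]_w V w = c.
Proof.
move=> [_ _ _ /(_ [::] (fun=> setT) isT)].
rewrite (_ : cylinder [::] _ = setT); last by apply/seteqP; split.
by rewrite probability_setT mul1e; apply.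
Qed.

(** Conditioning on one further independent variable: the level sets of [U i] refine
    the cylinder by one coordinate.  This has the shape of a monadic bind, so that
    a random recursion is evaluated by following its definition. *)
Lemma free_expectation_bind F F' i (V : nat -> Omega -> \bar R)
    (c : nat -> \bar R) : F i -> (forall j, F' j -> F j /\ j <> i) ->
  (forall v, free_expectation F' (V v) (c v)) ->
  free_expectation F (fun w => V (U i w) w) (Ex P (U i) c).
Proof.
move=> Fi FF' HV.
have c0 v : 0 <= c v by case: (HV v).
have mU := measurable_RV (U i).
have mV : measurable_fun setT (fun w => V (U i w) w).
  move=> _ A mA; rewrite setTI.
  have -> : (fun w => V (U i w) w) @^-1` A =
            \bigcup_v ((U i @^-1` [set v]) `&` (V v @^-1` A)).
    apply/seteqP; split=> [w Aw|w [v _ [/= Uv Av]]]; first by exists (U i w).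
    by rewrite /preimage /= Uv.
  apply: bigcup_measurable => v _; apply: measurableI; first exact: measurable_level.
  by rewrite -[_ @^-1` _]setTI; case: (HV v) => mVv _ _ _; exact: mVv.
split=> //; first by move=> w; case: (HV (U i w)).
  exact: Ex_ge0.
move=> s B us sF.
have is_ : i \notin s by apply/negP => /sF; exact.
rewrite (integral_levels P mU (measurable_cylinder _ _) mV); last first.
  by move=> w; case: (HV (U i w)).
have Pfin : P (cylinder s B) \is a fin_num.
  by apply: fin_num_measure; exact: measurable_cylinder.
rewrite (Ex_series P mU)// -(fineK Pfin) -nneseriesZl; last first.
  by move=> v _; apply: mule_ge0.
apply: eq_eseriesr => v _; rewrite fineK//.
pose B' j := if j == i then [set v] else B j.
have cylE : cylinder s B `&` U i @^-1` [set v] = cylinder (i :: s) B'.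
  apply/seteqP; split=> [w [sw iw] j /= | w Hw].
    rewrite inE => /predU1P[->|js]; first by rewrite /B' /preimage /= eqxx.
    rewrite /B' /preimage /=; case: eqP => [ji|_]; last exact: sw.
    by move: is_; rewrite -ji js.
  split=> [j /= js|]; last first.
    by have := Hw i; rewrite /= mem_head /B' /preimage /= eqxx; exact.
  have := Hw j; rewrite /= inE js orbT /B' /preimage /= => /(_ isT).
  by case: eqP => [ji|//]; move: is_; rewrite -ji js.
have usi : uniq (i :: s) by rewrite /= is_.
have sF' j : j \in i :: s -> ~ F' j.
  rewrite inE => /predU1P[->|js] /FF' [Fj ji]; first exact: ji.
  exact: sF js Fj.
rewrite (eq_integral (V v)); last by move=> w; rewrite inE => -[_ /= ->].
rewrite cylE; case: (HV v) => _ _ _ ->//.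
rewrite muleA; congr (_ * _).
rewrite /cylinder (U_indep B' usi) big_cons (U_indep B us) muleC; congr (_ * _).
  rewrite big_seq [RHS]big_seq; apply: eq_bigr => j js.
  by rewrite /B'; case: eqP => [ji|//]; move: is_; rewrite -ji js.
by rewrite /B' eqxx.
Qed.

End binding.

(** * Generating functions and moments *)

Lemma first_order_mul {R : realFieldType} (x y a a' C C' t : R) :
  (0 <= t <= 1)%R -> (`|x - (1 + a * t)| <= C * t ^+ 2)%R ->
  (`|y - (1 + a' * t)| <= C' * t ^+ 2)%R ->
  (`|x * y - (1 + (a + a') * t)| <=
     (`|a * a'| + C * (1 + `|a'|) + C' * (1 + `|a|) + C * C') * t ^+ 2)%R.
Proof.
move=> /andP[t0 t1]; set xi := (x - _)%R; set eta := (y - _)%R => Hx Hy.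
have -> : (x * y - (1 + (a + a') * t) =
   a * a' * t ^+ 2 + xi * (1 + a' * t) + eta * (1 + a * t) + xi * eta)%R.
  by rewrite /xi /eta; ring.
have t2 : (0 <= t ^+ 2)%R by rewrite exprn_ge0.
have one_a (r : R) : (`|1 + r * t| <= 1 + `|r|)%R.
  apply: le_trans (ler_normD _ _) _; rewrite normr1 lerD2l normrM (ger0_norm t0).
  by rewrite ler_piMr.
have T1 : (`|a * a' * t ^+ 2| <= `|a * a'| * t ^+ 2)%R by rewrite normrM (ger0_norm t2).
have T2 : (`|xi * (1 + a' * t)| <= C * t ^+ 2 * (1 + `|a'|))%R by rewrite normrM ler_pM.
have T3 : (`|eta * (1 + a * t)| <= C' * t ^+ 2 * (1 + `|a|))%R by rewrite normrM ler_pM.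
have T4 : (`|xi * eta| <= C * C' * t ^+ 2)%R.
  have Ct0 : (0 <= C * t ^+ 2)%R by apply: le_trans Hx.
  have C't0 : (0 <= C' * t ^+ 2)%R by apply: le_trans Hy.
  rewrite normrM; apply: le_trans (ler_pM _ _ Hx Hy) _ => //.
  rewrite (_ : C * t ^+ 2 * (C' * t ^+ 2) = (C * t ^+ 2 * C') * t ^+ 2)%R; last by ring.
  rewrite (_ : C * C' * t ^+ 2 = C * t ^+ 2 * C')%R; last by ring.
  rewrite ler_piMr ?exprn_ile1//.
  have [->|tn0] := eqVneq t 0%R; first by rewrite expr0n /= mulr0 mul0r.
  have t2' : (0 < t ^+ 2)%R by rewrite exprn_gt0// lt_neqAle eq_sym tn0.
  rewrite mulr_ge0//; move: C't0; by rewrite pmulr_lge0.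
apply: le_trans (ler_normD _ _) _; apply: le_trans (lerD (ler_normD _ _) T4) _.
apply: le_trans (lerD (lerD (ler_normD _ _) T3) (lexx _)) _.
apply: le_trans (lerD (lerD (lerD T1 T2) (lexx _)) (lexx _)) _.
by lra.
Qed.

(** The factor by which geometric emigration enters the one-step transform equals
    [1 + rho * f + rho * f ^ 2 / (1 - f - p)]. *)
Lemma emigration_first_order {R : realFieldType} (p b f t : R) : (0 < p < 1)%R -> (0 <= f <= t)%R ->
  (t <= (1 - p) / 2)%R -> (0 <= b)%R -> (t - b * t ^+ 2 <= f)%R ->
  (`|(1 - f) * (1 - p) / (1 - f - p) - (1 + p / (1 - p) * t)| <=
   (p / (1 - p) * b + 2 * p / (1 - p) ^+ 2) * t ^+ 2)%R.
Proof.
move=> /andP[p0 p1] /andP[f0 ft] tp b0 fl.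
have q0 : (0 < 1 - p)%R by rewrite subr_gt0.
have d0 : ((1 - p) / 2 <= 1 - f - p)%R by lra.
have d0' : (0 < 1 - f - p)%R by apply: lt_le_trans d0; rewrite divr_gt0.
have rho0 : (0 <= p / (1 - p))%R by rewrite divr_ge0 ?ltW.
have -> : ((1 - f) * (1 - p) / (1 - f - p) =
           1 + p / (1 - p) * f + p / (1 - p) * (f ^+ 2 / (1 - f - p)))%R.
  by field; rewrite !gt_eqF.
have H1 := ler_wpM2l rho0 fl; have H2 := ler_wpM2l rho0 ft.
have H3 : (0 <= f ^+ 2 / (1 - f - p))%R by rewrite divr_ge0 ?sqr_ge0 ?ltW.
have H4 : (f ^+ 2 / (1 - f - p) <= 2 / (1 - p) * t ^+ 2)%R.
  rewrite ler_pdivrMr//.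
  have f2 : (f ^+ 2 <= t ^+ 2)%R by rewrite lerXn2r ?nnegrE// (le_trans f0).
  apply: (le_trans f2).
  have t2 : (0 <= 2 / (1 - p) * t ^+ 2)%R by rewrite mulr_ge0 ?sqr_ge0 ?divr_ge0 ?ltW.
  apply: le_trans (ler_wpM2l t2 d0).
  by rewrite le_eqVlt; apply/orP; left; apply/eqP; field; rewrite gt_eqF.
have H5 := ler_wpM2l rho0 H4; have H6 := mulr_ge0 rho0 H3.
have H7 : (p / (1 - p) * (2 / (1 - p) * t ^+ 2) = 2 * p / (1 - p) ^+ 2 * t ^+ 2)%R.
  by field; rewrite gt_eqF.
have H8 := mulr_ge0 (mulr_ge0 rho0 b0) (sqr_ge0 t).
have H9 : (0 <= 2 * p / (1 - p) ^+ 2 * t ^+ 2)%R.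
  by rewrite mulr_ge0 ?sqr_ge0// divr_ge0 ?sqr_ge0// mulr_ge0// ltW.
by rewrite ler_norml; apply/andP; split; lra.
Qed.

(** [h], [k] and [i] stand for the factors due to [J], to the emigration and to [I],
    and [q] for [iota p].  The constant [cst] is chosen before [t], as it must serve
    along a whole sequence of iterates. *)
Lemma coefficients_first_order {R : realFieldType} (nu rho mu Ch Ck Ci : R) :
  (0 <= Ch)%R -> (0 <= Ck)%R -> (0 <= Ci)%R ->
  exists2 cst : R, (0 <= cst)%R & forall t h k i q : R,
    (0 <= t <= 1)%R -> (0 <= q <= 1)%R ->
    (`|h - (1 + - nu * t)| <= Ch * t ^+ 2)%R ->
    (`|k - (1 + rho * t)| <= Ck * t ^+ 2)%R ->
    (`|i - (1 + - mu * t)| <= Ci * t ^+ 2)%R ->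
    let c := (mu + nu - rho)%R in
    [/\ (1 - c * t - cst * t ^+ 2 <= h * k * i <= 1 - c * t + cst * t ^+ 2)%R,
        (- (cst * t) <= (1 - h * k) * q <= cst * t)%R &
        ((1 - h * k) * q <= - (q * (rho - nu) * t) + cst * t ^+ 2)%R].
Proof.
move=> Ch0 Ck0 Ci0.
have abs1 (r : R) : (0 <= 1 + `|r|)%R by rewrite addr_ge0.
have [Cal CalE] : exists Cal, Cal =
  (`|(- nu) * rho| + Ch * (1 + `|rho|) + Ck * (1 + `|- nu|) + Ch * Ck)%R by eexists.
have Cal0 : (0 <= Cal)%R.
  by rewrite CalE; apply: addr_ge0; [apply: addr_ge0; [apply: addr_ge0|]|];
    [exact: normr_ge0|exact: mulr_ge0..].
have [Cg CgE] : exists Cg, Cg = (`|(- nu + rho) * - mu| + Cal * (1 + `|- mu|)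
  + Ci * (1 + `|- nu + rho|) + Cal * Ci)%R by eexists.
have Cg0 : (0 <= Cg)%R.
  by rewrite CgE; apply: addr_ge0; [apply: addr_ge0; [apply: addr_ge0|]|];
    [exact: normr_ge0|exact: mulr_ge0..].
exists (`|rho - nu| + Cal + Cg)%R; first by rewrite !addr_ge0.
move=> t h k i q /[dup] t01 /andP[t0 t1] /andP[q0 q1] Hh Hk Hi.
have Hal := first_order_mul t01 Hh Hk; rewrite -CalE in Hal.
have Hg := first_order_mul t01 Hal Hi; rewrite -CgE in Hg.
move: (h * k)%R Hal Hg => al Hal Hg {h k CalE CgE Hh Hk Hi abs1 Ch0 Ck0 Ci0}.
have t2 : (0 <= t ^+ 2)%R by rewrite sqr_ge0.
have abs0 : (0 <= `|rho - nu| * t ^+ 2)%R by rewrite mulr_ge0.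
have Cal2 : (0 <= Cal * t ^+ 2)%R by rewrite mulr_ge0.
have Cg2 : (0 <= Cg * t ^+ 2)%R by rewrite mulr_ge0.
have Cg1 : (0 <= Cg * t)%R by rewrite mulr_ge0.
have Cal1 : (Cal * t ^+ 2 <= Cal * t)%R by rewrite ler_wpM2l// expr2 ler_piMl.
split.
- by move: Hg; rewrite ler_norml => /andP[Hg1 Hg2]; apply/andP; split; lra.
- rewrite -ler_norml normrM (ger0_norm q0).
  apply: (@le_trans _ _ `|1 - al|%R); first by rewrite ler_piMr.
  have -> : (1 - al = - (al - (1 + (- nu + rho) * t)) - (rho - nu) * t)%R by ring.
  apply: le_trans (ler_normB _ _) _; rewrite normrN normrM (ger0_norm t0).
  by lra.
- move: Hal; rewrite ler_norml => /andP[Hal1 _].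
  have H1 : (1 - al <= - ((rho - nu) * t) + Cal * t ^+ 2)%R by lra.
  have H2 := ler_wpM2r q0 H1.
  have H3 : (Cal * t ^+ 2 * q <= Cal * t ^+ 2)%R by rewrite ler_piMr.
  by lra.
Qed.

Section generating_functions.
Context {d : measure_display} {Omega : measurableType d} {R : realType}.
Variable P : probability Omega R.
Implicit Types (Z : {RV P >-> nat}) (s t : R).

Definition pgf Z s : R := fine (Ex P Z (fun z => (s ^+ z)%:E)).

Definition moment Z (k : nat) : R := fine (Ex P Z (fun z => (z%:R ^+ k)%:E)).

Lemma pgfE Z s : (0 <= s <= 1)%R -> Ex P Z (fun z => (s ^+ z)%:E) = (pgf Z s)%:E.
Proof.
move=> /andP[s0 s1]; rewrite fineK// ge0_fin_numE; last first.
  by apply: Ex_ge0 => z; rewrite lee_fin exprn_ge0.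
apply: (@le_lt_trans _ _ 1); last exact: ltry.
rewrite -[leRHS](Ex_cst P Z); apply: Ex_le; first exact: measurable_RV.
  by move=> z; rewrite lee_fin exprn_ge0.
by move=> z; rewrite lee_fin exprn_ile1.
Qed.

Lemma pgf_range Z s : (0 <= s <= 1)%R -> (0 <= pgf Z s <= 1)%R.
Proof.
move=> s01; have /andP[s0 s1] := s01; rewrite -!lee_fin -pgfE//; apply/andP; split.
  by apply: Ex_ge0 => z; rewrite lee_fin exprn_ge0.
rewrite -[leRHS](Ex_cst P Z); apply: Ex_le; first exact: measurable_RV.
  by move=> z; rewrite lee_fin exprn_ge0.
by move=> z; rewrite lee_fin exprn_ile1.
Qed.

Lemma moment_ge0 Z k : (0 <= moment Z k)%R.
Proof.
by rewrite fine_ge0//; apply: Ex_ge0 => z; rewrite lee_fin exprn_ge0.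
Qed.

Lemma momentE Z k m : finite_moment P m Z -> (0 < k <= m)%N ->
  Ex P Z (fun z => (z%:R ^+ k)%:E) = (moment Z k)%:E.
Proof.
move=> Hm /andP[k0 km]; rewrite fineK// ge0_fin_numE; last first.
  by apply: Ex_ge0 => z; rewrite lee_fin exprn_ge0.
apply: le_lt_trans Hm; rewrite unlock.
apply: (@Ex_le _ _ _ P Z _ _ (fun z => (z%:R ^+ m)%:E)); first exact: measurable_RV.
  by move=> z; rewrite lee_fin exprn_ge0.
move=> z; rewrite lee_fin; case: z => [|z]; last by rewrite ler_weXn2l// ler1n.
by rewrite !expr0n; case: (k) k0 => // k' _; rewrite /= ler0n.
Qed.

Lemma meanE Z m : finite_moment P m Z -> (0 < m)%N -> mean P Z = moment Z 1.
Proof. by move=> Hm m0; rewrite /mean unlock. Qed.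

(** A pointwise inequality between [(1 - t) ^ z] and a polynomial in [z] integrates
    to an inequality between generating function and moments, once the negative
    terms have been moved to the other side. *)
Lemma pgf_lower Z t : finite_moment P 1 Z -> (0 <= t <= 1)%R ->
  (1 - moment Z 1 * t <= pgf Z (1 - t))%R.
Proof.
move=> Z1 t01; have /andP[t0 t1] := t01.
have s01 : (0 <= 1 - t <= 1)%R by rewrite subr_ge0 t1 gerBl.
rewrite lerBlDr -lee_fin EFinD mulrC EFinM -(momentE Z1)// -pgfE//.
have mZ := measurable_RV Z.
rewrite -ExZ ?lee_fin//.
rewrite -ExD//; last 2 first.
- by move=> z; rewrite lee_fin exprn_ge0// subr_ge0.
- by move=> z; rewrite -EFinM lee_fin mulr_ge0.
rewrite -[leLHS](Ex_cst P Z); apply: Ex_le => // z.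
rewrite -EFinM -EFinD lee_fin; have := bernoulli_lower z t01.
by rewrite expr1; lra.
Qed.

Lemma finite_moment_le Z k m : finite_moment P m Z -> (0 < k <= m)%N ->
  finite_moment P k Z.
Proof.
by move=> Hm km; rewrite /finite_moment unlock; have := momentE Hm km; rewrite /Ex => ->; rewrite ltry.
Qed.

Lemma pgf_upper Z t : finite_moment P 2 Z -> (0 <= t <= 1)%R ->
  (pgf Z (1 - t) <= 1 - moment Z 1 * t + moment Z 2 * t ^+ 2)%R.
Proof.
move=> Z2 t01; have /andP[t0 t1] := t01.
have s01 : (0 <= 1 - t <= 1)%R by rewrite subr_ge0 t1 gerBl.
have t2 : (0 <= t ^+ 2)%R by rewrite exprn_ge0.
suff : (pgf Z (1 - t) + t * moment Z 1 <= 1 + t ^+ 2 * moment Z 2)%R by lra.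
have mZ := measurable_RV Z.
have ES : Ex P Z (fun z => ((1 - t) ^+ z)%:E + t%:E * (z%:R ^+ 1)%:E) =
    (pgf Z (1 - t) + t * moment Z 1)%R%:E.
  rewrite ExD//; last 2 first.
  - by move=> z; rewrite lee_fin exprn_ge0// subr_ge0.
  - by move=> z; rewrite -EFinM lee_fin mulr_ge0.
  by rewrite ExZ ?lee_fin// (momentE Z2)// pgfE// EFinD EFinM.
have EQ : Ex P Z (fun z => 1 + (t ^+ 2)%:E * (z%:R ^+ 2)%:E) =
    (1 + t ^+ 2 * moment Z 2)%R%:E.
  rewrite ExD//; last by move=> z; rewrite -EFinM lee_fin mulr_ge0// exprn_ge0.
  rewrite ExZ ?lee_fin//.
  by rewrite Ex_cst (momentE Z2)// EFinD EFinM.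
rewrite -lee_fin -ES -EQ; apply: Ex_le => // z.
  by rewrite -EFinM -EFinD lee_fin addr_ge0 ?mulr_ge0// exprn_ge0// subr_ge0.
rewrite -!EFinM -!EFinD lee_fin; have := bernoulli_upper_sq z t01.
by rewrite expr1; lra.
Qed.

(** The inner error [b * t ^ 2] comes from evaluating at a point [f] known to first
    order only. *)
Lemma pgf_first_order Z f t b : finite_moment P 2 Z -> (0 <= f <= t)%R ->
  (t <= 1)%R -> (t - b * t ^+ 2 <= f)%R -> (0 <= b)%R ->
  (`|pgf Z (1 - f) - (1 + - moment Z 1 * t)| <=
     (moment Z 1 * b + moment Z 2) * t ^+ 2)%R.
Proof.
move=> Z2 /andP[f0 ft] t1 fl b0.
have f01 : (0 <= f <= 1)%R by rewrite f0 (le_trans ft).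
have Z1 := finite_moment_le Z2 (isT : (0 < 1 <= 2)%N).
have Hl := pgf_lower Z1 f01; have Hu := pgf_upper Z2 f01.
have m1 := moment_ge0 Z 1; have m2 := moment_ge0 Z 2.
have H1 := ler_wpM2l m1 fl; have H2 := ler_wpM2l m1 ft.
have f2 : (f ^+ 2 <= t ^+ 2)%R by rewrite lerXn2r ?nnegrE// (le_trans f0).
have H3 := ler_wpM2l m2 f2.
have H4 := mulr_ge0 (addr_ge0 (mulr_ge0 m1 b0) m2) (sqr_ge0 t).
by rewrite ler_norml; apply/andP; split; lra.
Qed.

(** Writing [f t] for the middle term, this is [f t = t - b * t ^ 2 + O(t ^ 3)]: the
    third moment is what controls the remainder. *)
Lemma pgf_critical Z t : finite_moment P 3 Z -> moment Z 1 = 1%R ->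
  (0 <= t <= 1)%R ->
  (t - (moment Z 2 - 1) / 2 * t ^+ 2 <= 1 - pgf Z (1 - t) <=
   t - (moment Z 2 - 1) / 2 * t ^+ 2 + moment Z 3 * t ^+ 3)%R.
Proof.
move=> Z3 Z1 t01; have /andP[t0 t1] := t01.
have s01 : (0 <= 1 - t <= 1)%R by rewrite subr_ge0 t1 gerBl.
have t2 : (0 <= t ^+ 2 / 2)%R by rewrite divr_ge0// exprn_ge0.
have t3 : (0 <= t ^+ 3)%R by rewrite exprn_ge0.
have tt : (0 <= t + t ^+ 2 / 2)%R by rewrite addr_ge0.
have mZ := measurable_RV Z.
have ES : Ex P Z (fun z => ((1 - t) ^+ z)%:E + (t + t ^+ 2 / 2)%:E * (z%:R ^+ 1)%:E) =
    (pgf Z (1 - t) + (t + t ^+ 2 / 2) * moment Z 1)%R%:E.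
  rewrite ExD//; last 2 first.
  - by move=> z; rewrite lee_fin exprn_ge0// subr_ge0.
  - by move=> z; rewrite -EFinM lee_fin mulr_ge0.
  by rewrite ExZ ?lee_fin// (momentE Z3)// pgfE// EFinD EFinM.
have EQ : Ex P Z (fun z => 1 + (t ^+ 2 / 2)%:E * (z%:R ^+ 2)%:E) =
    (1 + t ^+ 2 / 2 * moment Z 2)%R%:E.
  rewrite ExD//; last by move=> z; rewrite -EFinM lee_fin mulr_ge0// exprn_ge0.
  rewrite ExZ ?lee_fin//.
  by rewrite Ex_cst (momentE Z3)// EFinD EFinM.
have EC : Ex P Z (fun z => (t ^+ 3)%:E * (z%:R ^+ 3)%:E) = (t ^+ 3 * moment Z 3)%R%:E.
  rewrite ExZ ?lee_fin//.
  by rewrite (momentE Z3)// EFinM.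
have S0 z : 0 <= ((1 - t) ^+ z)%:E + (t + t ^+ 2 / 2)%:E * (z%:R ^+ 1)%:E.
  by rewrite -EFinM -EFinD lee_fin addr_ge0 ?mulr_ge0// exprn_ge0// subr_ge0.
have Q0 z : 0 <= 1 + (t ^+ 2 / 2)%:E * (z%:R ^+ 2)%:E.
  by rewrite -EFinM -EFinD lee_fin addr_ge0 ?mulr_ge0// exprn_ge0.
have H1 : (pgf Z (1 - t) + (t + t ^+ 2 / 2) * moment Z 1 <=
           1 + t ^+ 2 / 2 * moment Z 2)%R.
  rewrite -lee_fin -ES -EQ; apply: Ex_le => // z.
  rewrite -!EFinM -!EFinD lee_fin; have := bernoulli_upper z t01.
  by rewrite expr1; lra.
have H2 : (1 + t ^+ 2 / 2 * moment Z 2 <=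
           pgf Z (1 - t) + (t + t ^+ 2 / 2) * moment Z 1 + t ^+ 3 * moment Z 3)%R.
  have C0 z : 0 <= (t ^+ 3)%:E * (z%:R ^+ 3)%:E by rewrite -EFinM lee_fin mulr_ge0// exprn_ge0.
  rewrite -lee_fin -EQ EFinD -ES -EC -ExD//; apply: Ex_le => // z.
  rewrite -!EFinM -!EFinD lee_fin; have := bernoulli_lower3 z t01.
  by rewrite expr1; lra.
by move: H1 H2; rewrite Z1; lra.
Qed.

Lemma moment_fin_mean Z : finite_moment P 2 Z -> 'E_P[real_of Z] = (moment Z 1)%:E.
Proof.
move=> Z2; rewrite unlock -(momentE Z2)//.
Qed.

Lemma variance_moment Z : finite_moment P 2 Z -> 'E_P[real_of Z] = 1 ->
  'V_P[real_of Z] = (moment Z 2 - 1)%R%:E.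
Proof.
move=> Z2 Z1; have mZ := measurable_RV Z.
rewrite /variance unlock Z1 /= unlock.
have -> : \int[P]_w (((real_of Z \- cst 1) * (real_of Z \- cst 1))%R w)%:E =
   Ex P Z (fun z => ((z%:R - 1) ^+ 2)%:E) by [].
have m1 : Ex P Z (fun z => (z%:R ^+ 1)%:E) = 1.
  by rewrite -Z1 unlock.
have sq0 z : 0 <= ((z%:R - 1 : R) ^+ 2)%:E by rewrite lee_fin sqr_ge0.
have : Ex P Z (fun z => ((z%:R - 1) ^+ 2)%:E + 2%:E * (z%:R ^+ 1)%:E) =
       Ex P Z (fun z => (z%:R ^+ 2)%:E + 1).
  congr Ex; apply/funext => z; rewrite -EFinM -!EFinD; congr EFin; ring.
rewrite !ExD//.
rewrite ExZ ?lee_fin// m1 Ex_cst mule1 (momentE Z2)// -EFinD => H.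
apply/eqP; rewrite (_ : (moment Z 2 - 1)%R%:E = (moment Z 2 + 1)%R%:E - 2%:E).
  by rewrite eq_sym sube_eq ?fin_num_adde_defl//; apply/eqP.
by rewrite -EFinB; congr EFin; ring.
Qed.

Lemma geometric_tail Z (p : R) N : (0 < p < 1)%R -> geometric_law P p Z ->
  \sum_(N <= k <oo) P (Z @^-1` [set k]) = (p ^+ N)%:E.
Proof.
move=> /andP[p0 p1] HZ.
have : Ex P Z (fun=> 1) = 1 by rewrite Ex_cst.
rewrite (Ex_series P (measurable_RV Z))//.
rewrite (eq_eseriesr (f := fun k => P (Z @^-1` [set k]) * 1)
  (g := fun k => P (Z @^-1` [set k]))); last first.
  by move=> k _; exact: mule1.
rewrite (@nneseries_split _ _ 0%N N)//.
rewrite add0n (eq_big_nat _ _ (F2 := fun k => ((1 - p) * p ^+ k)%R%:E)); last first.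
  by move=> k _; exact: HZ.
rewrite big_mkord sumEFin -mulr_sumr.
have -> : ((1 - p) * \sum_(i < N) p ^+ i = 1 - p ^+ N)%R.
  by rewrite -opprB mulNr -subrX1 opprB.
set Q := (\sum_(N <= k <oo) _) => H.
have : Q = 1 - (1 - p ^+ N)%R%:E by apply/esym/eqP; rewrite sube_eq ?fin_num_adde_defl// addeC; apply/eqP.
by move=> ->; rewrite -EFinB subKr.
Qed.

(** The partial sums are explicit, which bounds the mean; then the lack of memory
    gives [m = p * (m + 1)]. *)
Lemma geometric_mean Z (p : R) : (0 < p < 1)%R -> geometric_law P p Z ->
  mean P Z = (p / (1 - p))%R.
Proof.
move=> /[dup] p01 /andP[p0 p1] HZ; rewrite /mean unlock.
have mZ := measurable_RV Z.
have p1' : (0 < 1 - p)%R by rewrite subr_gt0.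
have -> : \int[P]_w (real_of Z w)%:E = Ex P Z (fun z => (z%:R)%:E) by [].
set m := Ex _ _ _.
have mE : m = \sum_(k <oo) ((1 - p) * p ^+ k * k%:R)%R%:E.
  rewrite /m Ex_series//; apply: eq_eseriesr => k _; rewrite EFinM; congr (_ * _).
  exact: HZ.
have term0 k : (0 <= (1 - p) * p ^+ k * k%:R :> R)%R.
  by rewrite !mulr_ge0 ?exprn_ge0 ?(ltW p1') ?(ltW p0).
have m_le : m <= (p / (1 - p))%R%:E.
  rewrite mE; apply: lime_le; first by apply: is_cvg_nneseries => k _ _; rewrite lee_fin.
  apply: nearW => N; rewrite big_mkord sumEFin lee_fin.
  suff : (\sum_(i < N) (1 - p) * p ^+ i * i%:R + p ^+ N * (N%:R + p / (1 - p)) =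
          p / (1 - p))%R.
    move=> <-; rewrite lerDl mulr_ge0 ?exprn_ge0 ?(ltW p0)// addr_ge0//.
    by rewrite divr_ge0 ?(ltW p0) ?(ltW p1').
  elim: N => [|N IH]; first by rewrite big_ord0 expr0 mul1r !add0r.
  rewrite -[RHS]IH big_ord_recr /= exprS -natr1; field.
  by rewrite gt_eqF.
have mfin : m \is a fin_num.
  rewrite ge0_fin_numE; last by apply: Ex_ge0 => z; rewrite lee_fin.
  by apply: le_lt_trans m_le _; exact: ltry.
have : m = p%:E * (m + 1).
  rewrite {1}mE nneseries_recl//; last by move=> k _; rewrite lee_fin.
  rewrite mulr0 add0e -(@nneseries_addn _ (fun k => ((1 - p) * p ^+ k * k%:R)%R%:E) 1%N); last first.
    by move=> i; rewrite lee_fin.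
  rewrite (_ : m + 1 = Ex P Z (fun z => (z%:R)%:E + 1)); last by rewrite ExD// Ex_cst.
  rewrite Ex_series//; last by move=> z; rewrite -EFinD lee_fin addr_ge0.
  rewrite -nneseriesZl; last by move=> i _; rewrite mule_ge0// -EFinD lee_fin addr_ge0.
  apply: eq_eseriesr => k _.
  rewrite (HZ k : P (Z @^-1` [set k]) = _) -EFinD -!EFinM; congr EFin.
  by rewrite addn1 exprS -natr1; ring.
move: mfin; clear m_le mE; clearbody m; case: m => //= r _ H.
have {}H : (r = p * (r + 1))%R by apply: EFin_inj; rewrite EFinM EFinD.
have Hp : (r * (1 - p) = p)%R by lra.
by rewrite -[X in (X / _)%R]Hp mulfK ?gt_eqF.
Qed.
End generating_functions.

(** * The branching process as a chain *)

Section branching_chain.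
Context {d : measure_display} {Omega : measurableType d} {R : realType}.
Context {P : probability Omega R}.
Variables (I J K X : {RV P >-> nat}).
Variables (I_ J_ K_ : nat -> {RV P >-> nat}) (X_ : nat -> nat -> {RV P >-> nat}).
Hypothesis I_copy : forall n, same_law (I_ n) I.
Hypothesis J_copy : forall n, same_law (J_ n) J.
Hypothesis K_copy : forall n, same_law (K_ n) K.
Hypothesis X_copy : forall m n, (1 <= m)%N -> same_law (X_ m n) X.
Hypothesis indep : mutually_independent (innovations I_ J_ K_ X_).

Lemma Ex_same_law (U V : {RV P >-> nat}) (h : nat -> \bar R) : same_law U V ->
  (forall v, 0 <= h v) -> Ex P U h = Ex P V h.
Proof.
move=> UV h0; rewrite !Ex_series//; try exact: measurable_RV.
by apply: eq_eseriesr => v _; congr (_ * _); exact: UV.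
Qed.

Definition one_step n x w : nat :=
  let N := (x + I_ n w)%N in
  if (K_ n w < N)%N then (J_ n w + \sum_(1 <= m < (N - K_ n w).+1) X_ m n w)%N
  else 0%N.

(** [after_sum l c j] is the mean of [c (j + X_1 + ... + X_l)] and [after_step c x]
    the mean of [c] after one step from [x], as iterated integrals over the given laws:
    in this form they visibly do not depend on time. *)
Fixpoint after_sum l (c : nat -> \bar R) (j : nat) : \bar R :=
  if l is l'.+1 then Ex P X (fun u => after_sum l' c (j + u)%N) else c j.

Definition after_step (c : nat -> \bar R) (x : nat) : \bar R :=
  Ex P I (fun i => Ex P K (fun k =>
    if (k < x + i)%N then Ex P J (after_sum (x + i - k) c) else c 0%N)).

Lemma after_sum_ge0 l c : (forall z, 0 <= c z) -> forall j, 0 <= after_sum l c j.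
Proof. by move=> c0; elim: l => //= l IH j; apply: Ex_ge0. Qed.

Definition index_time (i : (nat + nat) + (nat + nat * nat)) : nat :=
  match i with
  | inl (inl n) => n | inl (inr n) => n | inr (inl n) => n | inr (inr (_, n)) => n
  end.

Definition from_time n : set ((nat + nat) + (nat + nat * nat)) :=
  [set i | (n <= index_time i)%N].

Local Notation free_expect := (free_expectation (innovations I_ J_ K_ X_)).

Definition with_summands n l : set ((nat + nat) + (nat + nat * nat)) :=
  [set i | from_time n.+1 i \/ exists2 m, (m < l)%N & i = inr (inr (m, n))].

Lemma free_sum n (G : nat -> Omega -> \bar R) (c : nat -> \bar R) l j :
  (forall z, free_expect (from_time n.+1) (G z) (c z)) ->
  free_expect (with_summands n l)
    (fun w => G (j + \sum_(1 <= m < l.+1) X_ m n w)%N w) (after_sum l c j).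
Proof.
move=> HG; have c0 z : 0 <= c z by case: (HG z).
elim: l j => [|l IH] j.
  apply: free_expectationW (free_expectation_eq _ _ (HG j)) => //; first by move=> i; left.
  by move=> w; rewrite big_geq// addn0.
pose i : (nat + nat) + (nat + nat * nat) := inr (inr (l, n)).
have Fi : with_summands n l.+1 i by right; exists l.
have FF' i' : with_summands n l i' -> with_summands n l.+1 i' /\ i' <> i.
  move=> [Hi'|[m ml ->]]; split.
  - by left.
  - by move=> i'i; move: Hi'; rewrite i'i /from_time /= ltnn.
  - by right; exists m => //; exact: ltnW.
  - by move=> [] ml'; move: ml; rewrite ml' ltnn.
have := free_expectation_bind indep Fi FF' (fun u => IH (j + u)%N).
apply: free_expectation_eq => [w|].
  by rewrite [in RHS]big_nat_recr//= addnAC addnA.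
apply: Ex_same_law; first exact: X_copy.
by move=> u; exact: after_sum_ge0.
Qed.

(** One step from time [n] consumes the innovations of time [n] only; whatever
    depends on later ones alone is averaged as by an independent copy. *)
Lemma free_step n (G : nat -> Omega -> \bar R) (c : nat -> \bar R) x :
  (forall z, free_expect (from_time n.+1) (G z) (c z)) ->
  free_expect (from_time n) (fun w => G (one_step n x w) w) (after_step c x).
Proof.
move=> HG; have c0 z : 0 <= c z by case: (HG z).
pose F3 := [set i | from_time n.+1 i \/ exists m, i = inr (inr (m, n))].
pose F2 := [set i | F3 i \/ i = inl (inr n)].
pose F1 := [set i | F2 i \/ i = inr (inl n)].
have notF3 i : F3 i -> [/\ i <> inl (inr n), i <> inr (inl n) & i <> inl (inl n)].
  by move=> [Hi|[m ->]]; split=> // iE; move: Hi; rewrite iE /from_time /= ltnn.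
have H3 i k j : (k < x + i)%N -> free_expect F3
    (fun w => G (j + \sum_(1 <= m < (x + i - k).+1) X_ m n w)%N w)
    (after_sum (x + i - k) c j).
  move=> _; apply: free_expectationW (free_sum _ _ HG) => i' [|[m _ ->]].
    by left.
  by right; exists m.
have H2 i k : (k < x + i)%N -> free_expect F2
    (fun w => G (J_ n w + \sum_(1 <= m < (x + i - k).+1) X_ m n w)%N w)
    (Ex P J (after_sum (x + i - k) c)).
  move=> ki.
  have F2J : F2 (inl (inr n)) by right.
  have F32 j : F3 j -> F2 j /\ j <> inl (inr n).
    by move=> /[dup] Fj /notF3 [? _ _]; split=> //; left.
  apply: (free_expectation_eq _ _
    (free_expectation_bind indep F2J F32 (fun j => H3 i k j ki))).
    by move=> w.
  by apply: Ex_same_law; [exact: J_copy|exact: after_sum_ge0].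
pose cK i k := if (k < x + i)%N then Ex P J (after_sum (x + i - k) c) else c 0%N.
have cK0 i k : 0 <= cK i k.
  by rewrite /cK; case: ifP => // _; apply: Ex_ge0; exact: after_sum_ge0.
have H1 i : free_expect F1 (fun w => G (if (K_ n w < x + i)%N then
      (J_ n w + \sum_(1 <= m < (x + i - K_ n w).+1) X_ m n w)%N else 0%N) w)
    (Ex P K (cK i)).
  have F1K : F1 (inr (inl n)) by right.
  have F21 j : F2 j -> F1 j /\ j <> inr (inl n).
    move=> /[dup] Fj [/notF3 [_ ? _]|->]; split=> //; first by left.
    by left; right.
  have HK k : free_expect F2 (fun w => G (if (k < x + i)%N then
      (J_ n w + \sum_(1 <= m < (x + i - k).+1) X_ m n w)%N else 0%N) w) (cK i k).
    rewrite /cK; case: ifP => ki; first exact: H2.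
    by apply: free_expectationW (HG 0%N) => j Fj; left; left.
  apply: (free_expectation_eq _ _ (free_expectation_bind indep F1K F21 HK)).
    by move=> w.
  by apply: Ex_same_law; [exact: K_copy|].
have F0I : from_time n (inl (inl n)) by rewrite /from_time /=.
have F10 j : F1 j -> from_time n j /\ j <> inl (inl n).
  move=> [[/[dup] Fj /notF3 [_ _ ?]|->]|->]; split=> //; rewrite /from_time //=.
  by case: Fj => [/ltnW //|[m ->]] /=.
apply: (free_expectation_eq _ _ (free_expectation_bind indep F0I F10 H1)).
  by move=> w.
rewrite /after_step -/cK; apply: Ex_same_law; first exact: I_copy.
by move=> i; exact: Ex_ge0.
Qed.

Lemma measurable_one_step n x : measurable_fun setT (one_step n x).
Proof.
apply: measurable_of_levels => v.
have := @free_step n (fun z _ => if z == v then 1 else 0)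
  (fun z => if z == v then 1 else 0) x.
case=> [z|mG _ _ _]; first by apply: free_expectation_cst; case: ifP.
have -> : one_step n x @^-1` [set v] =
    (fun w => if one_step n x w == v then 1 else 0 : \bar R) @^-1` [set 1].
  apply/seteqP; split=> w /=; rewrite /preimage /=; first by move=> ->; rewrite eqxx.
  by case: eqP => // _ /eqP; rewrite eq_sym onee_eq0.
by rewrite -[_ @^-1` _]setTI; apply: mG.
Qed.

Lemma after_stepE c x : (forall z, 0 <= c z) ->
  after_step c x = Ex P (one_step 0 x) c.
Proof.
move=> c0; rewrite -(integral_free (@free_step 0%N (fun z _ => c z) c x _))//.
by move=> z; exact: free_expectation_cst.
Qed.

(** Unlike [branching] this recursion peels off the first step, which is what
    [free_step] composes with. *)
Fixpoint chain_from m x n w : nat :=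
  if n is n'.+1 then chain_from m.+1 (one_step m x w) n' w else x.

Lemma chain_from_rcons m x n w :
  chain_from m x n.+1 w = one_step (m + n) (chain_from m x n w) w.
Proof.
elim: n m x => [|n IH] m x; first by rewrite /= addn0.
have := IH m.+1 (one_step m x w); rewrite addSnnS; exact.
Qed.

Lemma branchingE y n w : branching I_ J_ K_ X_ y n w = chain_from 0 y n w.
Proof. by elim: n => // n IH; rewrite chain_from_rcons /= IH add0n. Qed.

(** The Markov property, in the only form needed: paths constrained to [D] are
    averaged by the iterates of the killed operator. *)
Lemma free_chain (D : pred nat) (h : nat -> \bar R) m x n : (forall z, 0 <= h z) ->
  free_expect (from_time m)
    (fun w => if all (fun k => D (chain_from m x k w)) (iota 1 n)
              then h (chain_from m x n w) else 0)
    (iter n (killed P (one_step 0) D) h x).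
Proof.
move=> h0; elim: n m x => [|n IH] m x; first by rewrite /=; exact: free_expectation_cst.
have HG z : free_expect (from_time m.+1)
    (fun w => if D z then (if all (fun k => D (chain_from m.+1 z k w)) (iota 1 n)
              then h (chain_from m.+1 z n w) else 0) else 0)
    (keep D (iter n (killed P (one_step 0) D) h) z).
  rewrite /keep; case: ifP => _; first exact: IH.
  exact: free_expectation_cst.
have := free_step x HG.
apply: free_expectation_eq => [w|]; last first.
  rewrite /= /killed after_stepE//; apply: keep_ge0; apply: iter_ge0 => //.
rewrite [iota 1 n.+1]/= [all _ (_ :: _)]/= (iotaDl 1 1 n) all_map.
by case: (D _).
Qed.

Lemma integral_chain (D : pred nat) (h : nat -> \bar R) x n : (forall z, 0 <= h z) ->
  \int[P]_w (if all (fun k => D (branching I_ J_ K_ X_ x k w)) (iota 1 n)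
             then h (branching I_ J_ K_ X_ x n w) else 0) =
  iter n (killed P (one_step 0) D) h x.
Proof.
move=> h0; rewrite -(integral_free (free_chain D 0 x n h0)).
apply: eq_integral => w _; rewrite branchingE.
by congr (if _ then _ else _); apply: eq_all => k; rewrite branchingE.
Qed.

Definition avoids y n : set Omega :=
  [set w | all (fun k => branching I_ J_ K_ X_ y k w != y) (iota 1 n)].

Lemma measurable_branching y n : measurable_fun setT (branching I_ J_ K_ X_ y n).
Proof.
apply: measurable_of_levels => v.
have := @free_chain predT (keep (pred1 v) (fun=> 1)) 0 y n.
case=> [|mG _ _ _]; first exact: keep_ge0.
have -> : branching I_ J_ K_ X_ y n @^-1` [set v] =
    (fun w => if all (fun=> true) (iota 1 n)
      then keep (pred1 v) (fun=> 1) (chain_from 0 y n w) else 0 : \bar R) @^-1` [set 1].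
  apply/seteqP; split=> w; rewrite /preimage /= all_predT /keep /= -branchingE.
    by move=> ->; rewrite eqxx.
  by case: eqP => // _ /eqP; rewrite eq_sym onee_eq0.
by rewrite -[_ @^-1` _]setTI; apply: mG.
Qed.

Lemma branching_transition y n v :
  P [set w | branching I_ J_ K_ X_ y n w = v] =
  iter n (killed P (one_step 0) predT) (keep (pred1 v) (fun=> 1)) y.
Proof.
rewrite -integral_chain; last exact: keep_ge0.
rewrite -[LHS](@Ex_indic _ _ _ P _ (measurable_branching y n) [set v]).
apply: eq_integral => w _; rewrite all_predT /keep /= indicE.
by case: eqP => [->|ne]; [rewrite mem_set|rewrite memNset].
Qed.

Lemma measurable_avoids y n : measurable (avoids y n).
Proof.
rewrite /avoids; elim: (iota 1 n) => [|k s IH].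
  by rewrite (_ : [set w | _] = setT)//; apply/seteqP; split.
have -> : [set w | all (fun k => branching I_ J_ K_ X_ y k w != y) (k :: s)] =
    (branching I_ J_ K_ X_ y k @^-1` [set z | z != y]) `&`
    [set w | all (fun k => branching I_ J_ K_ X_ y k w != y) s].
  by apply/seteqP; split=> w /=; [move=> /andP[? ?]; split|move=> [? ?]; apply/andP].
by apply: measurableI => //; apply: measurable_level; exact: measurable_branching.
Qed.

Lemma prob_avoids y n : P (avoids y n) = survival P (one_step 0) y n y.
Proof.
rewrite /survival -integral_chain//.
transitivity (\int[P]_w (\1_(avoids y n) w : R)%:E).
  by rewrite integral_indic ?setIT//; exact: measurable_avoids.
apply: eq_integral => w _; rewrite indicE /avoids.
by case: ifP => Hw; [rewrite mem_set|rewrite memNset//= Hw].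
Qed.
Local Notation Y := (branching I_ J_ K_ X_).

Lemma avoidsP y n w :
  reflect (forall k, (0 < k <= n)%N -> Y y k w <> y) (w \in avoids y n).
Proof.
apply: (iffP idP); rewrite inE /avoids /=.
  move=> /allP H k kn; apply/eqP; apply: H.
  by rewrite mem_iota add1n ltnS.
by move=> H; apply/allP => k; rewrite mem_iota add1n ltnS => /H /eqP.
Qed.

(** The layer-cake formula, valid also when [y] is never met again. *)
Lemma return_time_series y w :
  return_time Y y w = \sum_(n <oo) (\1_(avoids y n) w : R)%:E.
Proof.
pose hit n := (0 < n)%N && (Y y n w == y).
have [Hex|Hno] := pselect (exists n, hit n).
  have [t /andP[t_0 /eqP Yt] tmin] := ex_minnP Hex.
  have av n : (w \in avoids y n) = (n < t)%N.
    apply/avoidsP/idP => [H|nt k /andP[k0 kn] Yk].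
      by rewrite ltnNge; apply/negP => tn; apply: (H t) => //; rewrite t_0.
    have := tmin k; rewrite /hit k0 Yk eqxx => /(_ isT) tk.
    by have := leq_ltn_trans kn nt; rewrite ltnNge tk.
  rewrite (@nneseries_split _ _ 0%N t); last by move=> k _; rewrite lee_fin.
  rewrite add0n [X in _ + X]eseries0 ?adde0; last first.
    by move=> i ti _; rewrite indicE av ltnNge ti.
  rewrite (eq_big_nat _ _ (F2 := fun=> 1)); last first.
    by move=> i /andP[_ it]; rewrite indicE av it.
  rewrite big_mkord sumEFin sumr_const card_ord.
  apply/eqP; rewrite eq_le; apply/andP; split.
    by apply: ereal_inf_lbound; exists t.
  apply: le_ereal_inf_tmp => _ [n [n0 Yn] <-].
  by rewrite lee_fin ler_nat; apply: tmin; rewrite /hit n0 Yn eqxx.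
have av n : w \in avoids y n.
  apply/avoidsP => k /andP[k0 _] Yk; apply: Hno; exists k.
  by rewrite /hit k0 Yk eqxx.
rewrite /return_time (_ : [set n | _] = set0); last first.
  apply/seteqP; split=> // n [n0 Yn]; apply: Hno; exists n.
  by rewrite /hit n0 Yn eqxx.
rewrite image_set0 ereal_inf0; apply/esym/eqyP => A A0.
have [N HN] : exists N : nat, (A <= N%:R)%R.
  by exists (Num.truncn A).+1; apply: ltW; exact: truncnS_gt.
apply: le_trans (nneseries_lim_ge N _); last by move=> i _ _; rewrite lee_fin.
rewrite (eq_big_nat _ _ (F2 := fun=> 1)); last by move=> i _; rewrite indicE av.
by rewrite big_mkord sumEFin sumr_const card_ord lee_fin.
Qed.

Lemma mean_return_timeE y :
  mean_return_time P Y y = \sum_(n <oo) survival P (one_step 0) y n y.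
Proof.
rewrite /mean_return_time (eq_integral (fun w => \sum_(n <oo) (\1_(avoids y n) w : R)%:E)).
  rewrite integral_nneseries//; last first.
    by move=> n; apply/measurable_EFinP; apply: measurable_indic; exact: measurable_avoids.
  apply: eq_eseriesr => n _; rewrite integral_indic//; last exact: measurable_avoids.
  by rewrite setIT; exact: prob_avoids.
by move=> w _; exact: return_time_series.
Qed.

Lemma return_probabilityE y :
  return_probability P Y y = 1 - P (\bigcap_n avoids y n).
Proof.
have mcap : measurable (\bigcap_n avoids y n).
  by apply: bigcapT_measurable => n; exact: measurable_avoids.
rewrite -probability_setC//; congr (P _).
apply/seteqP; split=> w /=.
  move=> lt H; move: lt; rewrite /return_time (_ : [set n | _] = set0).
    by rewrite image_set0 ereal_inf0 ltxx.
  apply/seteqP; split=> // n [n0 Yn].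
  have : w \in avoids y n by rewrite inE; exact: H.
  by move=> /avoidsP /(_ n); rewrite n0 leqnn => /(_ isT).
move=> H; rewrite ltey; apply/eqP => E; apply: H => n _.
suff : w \in avoids y n by rewrite inE.
apply/avoidsP => k /andP[k0 _] Yk.
have : (return_time Y y w : \bar R) <= k%:R%:E by apply: ereal_inf_lbound; exists k.
by rewrite E leye_eq.
Qed.

Lemma cvg_survival y : survival P (one_step 0) y n y @[n --> \oo] -->
  P (\bigcap_n avoids y n).
Proof.
have -> : (fun n => survival P (one_step 0) y n y) = P \o avoids y.
  by apply/funext => n; rewrite /= prob_avoids.
apply: nonincreasing_cvg_mu.
- by rewrite (le_lt_trans (probability_le1 _ _)) ?ltry//; exact: measurable_avoids.
- by move=> n; exact: measurable_avoids.
- by apply: bigcapT_measurable => n; exact: measurable_avoids.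
- move=> m n mn; apply/subsetPset => w wn.
  have /avoidsP H : w \in avoids y n by rewrite inE.
  suff : w \in avoids y m by rewrite inE.
  by apply/avoidsP => k /andP[k0 km]; apply: H; rewrite k0 (leq_trans km).
Qed.

Lemma return_probability_lt1 y (eps : R) : (0 < eps)%R ->
  (forall n, eps%:E <= survival P (one_step 0) y n y) ->
  return_probability P Y y < 1.
Proof.
move=> eps0 H; rewrite return_probabilityE.
have : eps%:E <= P (\bigcap_n avoids y n).
  rewrite -(cvg_lim _ (@cvg_survival y))//; apply: lime_ge.
    by apply/cvg_ex; eexists; exact: cvg_survival.
  exact: nearW.
have mcap : measurable (\bigcap_n avoids y n).
  by apply: bigcapT_measurable => n; exact: measurable_avoids.
have Pfin : P (\bigcap_n avoids y n) \is a fin_num by exact: fin_num_measure.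
by rewrite -(fineK Pfin) -EFinB !lee_fin lte_fin; lra.
Qed.

Lemma return_probability_eq1 y :
  (forall eps : R, (0 < eps)%R ->
     exists n, survival P (one_step 0) y n y <= eps%:E) ->
  return_probability P Y y = 1.
Proof.
move=> H; rewrite return_probabilityE.
suff -> : P (\bigcap_n avoids y n) = 0 by rewrite sube0.
apply/eqP; rewrite eq_le measure_ge0 andbT; apply/lee_addgt0Pr => eps eps0.
have [n Hn] := H _ eps0; rewrite add0e; apply: le_trans Hn.
rewrite -prob_avoids; apply: le_measure; rewrite ?inE.
- by apply: bigcapT_measurable => k; exact: measurable_avoids.
- exact: measurable_avoids.
- by move=> w; apply.
Qed.
Lemma after_sum_exp l s j : (0 <= s <= 1)%R ->
  after_sum l (fun z => (s ^+ z)%:E) j = (s ^+ j * pgf X s ^+ l)%R%:E.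
Proof.
move=> s01; have /andP[s0 _] := s01; have /andP[f0 _] := pgf_range X s01.
elim: l j => [|l IH] j; first by rewrite /= mulr1.
rewrite /= (_ : (fun u => _) = (fun u => (s ^+ j * pgf X s ^+ l)%:E * (s ^+ u)%:E)).
  rewrite ExZ; last 3 first.
  - exact: measurable_RV.
  - by rewrite lee_fin mulr_ge0// exprn_ge0.
  - by move=> u; rewrite lee_fin exprn_ge0.
  by rewrite pgfE// -EFinM exprSr mulrA.
by apply/funext => u; rewrite IH -EFinM exprD; congr EFin; ring.
Qed.

Lemma geometric_convolution (a b : R) N :
  ((a - b) * \sum_(k < N) b ^+ k * a ^+ (N - k) = a * (a ^+ N - b ^+ N))%R.
Proof.
elim: N => [|N IH]; first by rewrite big_ord0 mulr0 !expr0 subrr mulr0.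
rewrite big_ord_recr /= subSnn expr1.
rewrite (eq_bigr (fun k : 'I_N => a * (b ^+ k * a ^+ (N - k)))%R); last first.
  by move=> k _; rewrite subSn ?(ltnW (ltn_ord k))// exprS; ring.
rewrite -mulr_sumr mulrDr mulrCA IH !exprS; ring.
Qed.

Section geometric_emigration.
Variable p : R.
Hypothesis (p01 : (0 < p < 1)%R) (K_geo : geometric_law P p K).

Lemma Ex_emigration (h a : R) N : (0 <= h)%R -> (0 <= a)%R -> (p < a)%R ->
  Ex P K (fun k => if (k < N)%N then (h * a ^+ (N - k))%R%:E else 1) =
  (h * a * (1 - p) / (a - p) * a ^+ N +
   (1 - h * a * (1 - p) / (a - p)) * p ^+ N)%R%:E.
Proof.
move=> h0 a0 pa; have mK := measurable_RV K.
rewrite (Ex_series P mK); last first.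
  by move=> k; case: ifP => _ //; rewrite lee_fin mulr_ge0// exprn_ge0.
rewrite (@nneseries_split _ _ 0%N N); last first.
  move=> k _; apply: mule_ge0 => //; case: ifP => _ //.
  by rewrite lee_fin mulr_ge0// exprn_ge0.
rewrite add0n.
rewrite (eq_big_nat _ _ (F2 := fun k => (h * (1 - p) * (p ^+ k * a ^+ (N - k)))%R%:E)); last first.
  move=> k /andP[_ kN]; rewrite kN (K_geo k : P (K @^-1` [set k]) = _) -EFinM.
  by congr EFin; ring.
rewrite (_ : \sum_(N <= k <oo) _ = \sum_(N <= k <oo) P (K @^-1` [set k])); last first.
  rewrite -[LHS](@nneseries_addn _ (fun k => P (K @^-1` [set k]) *
    (if (k < N)%N then (h * a ^+ (N - k))%R%:E else 1)) N); last first.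
    move=> k; apply: mule_ge0 => //; case: ifP => _ //.
    by rewrite lee_fin mulr_ge0// exprn_ge0.
  rewrite -[RHS](@nneseries_addn _ (fun k => P (K @^-1` [set k])) N)//.
  by apply: eq_eseriesr => k _; rewrite ltnNge leq_addl /= mule1.
rewrite (geometric_tail N p01 K_geo) big_mkord sumEFin -mulr_sumr -EFinD.
congr EFin.
have ap : (a - p != 0)%R by rewrite gt_eqF// subr_gt0.
have -> : (\sum_(i < N) p ^+ i * a ^+ (N - i) = a * (a ^+ N - p ^+ N) / (a - p))%R.
  by rewrite -geometric_convolution mulrC mulKf.
by field.
Qed.

(** The sum over [K] is geometric, and the two ends of that geometric sum are the two
    terms; the one in [p ^ x] also collects the event that emigration empties the
    population. *)
Lemma Ex_one_step_exp s x (al := (pgf J s * pgf X s * (1 - p) / (pgf X s - p))%R) :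
  (0 <= s <= 1)%R -> (p < pgf X s)%R ->
  Ex P (one_step 0 x) (fun z => (s ^+ z)%:E) =
  (al * pgf I (pgf X s) * pgf X s ^+ x + (1 - al) * pgf I p * p ^+ x)%R%:E.
Proof.
move=> s01; set a := pgf X s; set h := pgf J s => pa.
have /andP[s0 _] := s01; have /andP[a0 a1] := pgf_range X s01.
have /andP[h0 h1] := pgf_range J s01.
have /andP[p0 p1] := p01.
have pr : (0 <= p <= 1)%R by rewrite !ltW.
have ar : (0 <= a <= 1)%R by rewrite a0.
have sz0 z : 0 <= (s ^+ z)%:E by rewrite lee_fin exprn_ge0.
have EJ l : Ex P J (after_sum l (fun z => (s ^+ z)%:E)) = (h * a ^+ l)%R%:E.
  rewrite (_ : after_sum _ _ = (fun j => (a ^+ l)%:E * (s ^+ j)%:E)).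
    rewrite ExZ; [|exact: measurable_RV|by rewrite lee_fin exprn_ge0|exact: sz0].
    by rewrite pgfE// -EFinM mulrC.
  by apply/funext => j; rewrite after_sum_exp// EFinM muleC.
have EK i : Ex P K (fun k => if (k < x + i)%N
      then Ex P J (after_sum (x + i - k) (fun z => (s ^+ z)%:E))
      else (s ^+ 0%N)%:E) = (al * a ^+ (x + i) + (1 - al) * p ^+ (x + i))%R%:E.
  rewrite -(Ex_emigration _ h0 a0 pa); congr Ex; apply/funext => k.
  by rewrite EJ expr0.
rewrite -after_stepE// /after_step.
pose F i := (al * a ^+ (x + i) + (1 - al) * p ^+ (x + i))%R.
have -> : (fun i => Ex P K (fun k => if (k < x + i)%N
      then Ex P J (after_sum (x + i - k) (fun z => (s ^+ z)%:E))
      else (s ^+ 0%N)%:E)) = EFin \o F by apply/funext => i; rewrite EK.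
have F0 i : 0 <= (F i)%:E.
  rewrite -EK; apply: Ex_ge0 => k; case: ifP => // _.
  by apply: Ex_ge0; exact: after_sum_ge0.
have al0 : (0 <= al)%R.
  by rewrite /al divr_ge0 ?mulr_ge0// subr_ge0 ltW.
have mI := measurable_RV I.
have pz0 z : 0 <= (p ^+ z)%:E by rewrite lee_fin exprn_ge0// ltW.
have az0 z : 0 <= (a ^+ z)%:E by rewrite lee_fin exprn_ge0.
have px0 : (0 <= p ^+ x)%R by rewrite exprn_ge0// ltW.
have ax0 : (0 <= a ^+ x)%R by rewrite exprn_ge0.
(* [1 - al] may be negative: the term in [al * p ^ i] is moved to the other side. *)
have : Ex P I (fun i => (EFin \o F) i + (al * p ^+ x)%R%:E * (p ^+ i)%:E) =
       Ex P I (fun i => (al * a ^+ x)%R%:E * (a ^+ i)%:E + (p ^+ x)%:E * (p ^+ i)%:E).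
  congr Ex; apply/funext => i; rewrite /= /F -!EFinM -!EFinD; congr EFin.
  by rewrite !exprD; ring.
have apx0 : 0 <= (al * p ^+ x)%R%:E by rewrite lee_fin mulr_ge0.
have aax0 : 0 <= (al * a ^+ x)%R%:E by rewrite lee_fin mulr_ge0.
have ppx0 : 0 <= (p ^+ x)%:E by rewrite lee_fin.
rewrite (ExD P mI F0); last by move=> i; apply: mule_ge0.
rewrite ExD//; [|by move=> i; apply: mule_ge0..].
rewrite !ExZ// !pgfE// => H.
have Ffin : Ex P I (EFin \o F) \is a fin_num.
  rewrite ge0_fin_numE; last by apply: Ex_ge0.
  have le : Ex P I (EFin \o F) <= (al * a ^+ x * pgf I a + p ^+ x * pgf I p)%R%:E.
    rewrite EFinD !EFinM -H leeDl// mule_ge0// lee_fin.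
    by case/andP: (pgf_range I pr).
  by apply: le_lt_trans le _; exact: ltry.
move: H; rewrite -(fineK Ffin) -!EFinM -!EFinD => H.
have {}H := EFin_inj H.
by congr EFin; lra.
Qed.

End geometric_emigration.
(** First-order behaviour at 1 of the coefficients of the one-step transform:
    [c] is the asymptotic drift and [b] half the offspring variance. *)
Lemma one_step_expansion (p : R) (f g e : R -> R)
    (mu := moment I 1) (nu := moment J 1) (rho := (p / (1 - p))%R)
    (b := ((moment X 2 - 1) / 2)%R) (c := (mu + nu - rho)%R) :
  (0 < p < 1)%R -> geometric_law P p K -> (0 < b)%R ->
  finite_moment P 2 I -> finite_moment P 2 J -> finite_moment P 3 X ->
  moment X 1 = 1%R ->
  (forall t, f t = 1 - pgf X (1 - t))%R ->
  (forall t, g t = pgf J (1 - t) * ((1 - f t) * (1 - p) / (1 - f t - p))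
                   * pgf I (1 - f t))%R ->
  (forall t, e t = (1 - pgf J (1 - t) * ((1 - f t) * (1 - p) / (1 - f t - p)))
                   * pgf I p)%R ->
  exists cst t0 : R, [/\ (0 <= cst)%R, (0 < t0)%R, (p + t0 < 1)%R &
    forall t, (0 < t <= t0)%R ->
    [/\ (t - b * t ^+ 2 <= f t <= t - b * t ^+ 2 + moment X 3 * t ^+ 3)%R,
        (1 - c * t - cst * t ^+ 2 <= g t <= 1 - c * t + cst * t ^+ 2)%R,
        (- (cst * t) <= e t <= cst * t)%R,
        (e t <= - (pgf I p * (rho - nu) * t) + cst * t ^+ 2)%R &
        forall x, Ex P (one_step 0 x) (fun z => ((1 - t) ^+ z)%:E) =
                  (g t * (1 - f t) ^+ x + e t * p ^+ x)%R%:E]].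
Proof.
move=> p01 K_geo b0 I2 J2 X3 X1 fE gE eE.
have /andP[p0 p1] := p01; have q0 : (0 < 1 - p)%R by rewrite subr_gt0.
have pr : (0 <= p <= 1)%R by rewrite !ltW.
have I1 := finite_moment_le I2 (isT : (0 < 1 <= 2)%N).
have J1 := finite_moment_le J2 (isT : (0 < 1 <= 2)%N).
have mu0 : (0 <= mu)%R := moment_ge0 I 1.
have gam0 := moment_ge0 X 3.
have tq : (0 < (1 - p) / 2)%R by rewrite divr_gt0.
have [|t0 /andP[t00 t0q] /= /andP[gamt0 _]] :=
  @small_enough _ ((1 - p) / 2)%R [:: (moment X 3, b)]%R tq.
  by rewrite /= gam0 b0.
have rho0 : (0 <= rho)%R by rewrite divr_ge0 ?ltW.
have J20 := moment_ge0 J 2; have I20 := moment_ge0 I 2.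
have Ck0 : (0 <= rho * b + 2 * p / (1 - p) ^+ 2)%R.
  apply: addr_ge0; first by apply: mulr_ge0 => //; exact: ltW.
  by apply: divr_ge0; [apply: mulr_ge0 => //; exact: ltW|exact: sqr_ge0].
have Cj0 : (0 <= nu * 0 + moment J 2)%R by rewrite mulr0 add0r.
have Ci0 : (0 <= mu * b + moment I 2)%R.
  by apply: addr_ge0 => //; apply: mulr_ge0 => //; exact: ltW.
have [cst cst0 Hcst] := coefficients_first_order nu rho mu Cj0 Ck0 Ci0.
exists cst, t0; split=> //.
  have H : ((1 - p) / 2 < 1 - p)%R by rewrite ltr_pdivrMr// ltr_pMr// ltr1n.
  by rewrite addrC -ltrBrDr; exact: le_lt_trans t0q H.
move=> t /andP[t_0 tt0].
have tq2 : (t <= (1 - p) / 2)%R by apply: le_trans t0q.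
have t1 : (t <= 1)%R.
  apply: le_trans tq2 _; rewrite ler_pdivrMr// mul1r.
  by rewrite (@le_trans _ _ 1%R)// ?ler1n// gerBl ltW.
have t01 : (0 <= t <= 1)%R by rewrite ltW.
have s01 : (0 <= 1 - t <= 1)%R by rewrite subr_ge0 t1 gerBl ltW.
have /andP[a0 a1] := pgf_range X s01.
have Hf : (t - b * t ^+ 2 <= f t <= t - b * t ^+ 2 + moment X 3 * t ^+ 3)%R.
  by rewrite fE; exact: pgf_critical.
have /andP[fl fu] := Hf.
have f0 : (0 <= f t)%R by rewrite fE subr_ge0.
have t2 : (0 <= t ^+ 2)%R by rewrite sqr_ge0.
have ft : (f t <= t)%R.
  apply: (le_trans fu).
  have gamt : (moment X 3 * t <= b)%R by apply: le_trans gamt0; rewrite ler_wpM2l.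
  have H : (0 <= t ^+ 2 * (b - moment X 3 * t))%R by rewrite mulr_ge0// subr_ge0.
  by rewrite -subr_ge0; apply: le_trans H _; rewrite le_eqVlt; apply/orP; left; apply/eqP; ring.
have f01 : (0 <= f t <= 1)%R by rewrite f0 (le_trans ft).
have Hh : (`|pgf J (1 - t) - (1 + - nu * t)| <= (nu * 0 + moment J 2) * t ^+ 2)%R.
  apply: pgf_first_order => //; first by rewrite lexx (ltW t_0).
  by rewrite mul0r subr0.
have Hk : (`|(1 - f t) * (1 - p) / (1 - f t - p) - (1 + rho * t)| <=
           (rho * b + 2 * p / (1 - p) ^+ 2) * t ^+ 2)%R.
  by apply: emigration_first_order => //; [rewrite f0|exact: ltW].
have Hi : (`|pgf I (1 - f t) - (1 + - mu * t)| <= (mu * b + moment I 2) * t ^+ 2)%R.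
  by apply: pgf_first_order => //; [rewrite f0|exact: ltW].
have [Hg He Heq] := Hcst _ _ _ _ _ t01 (pgf_range I pr) Hh Hk Hi.
split=> //; [by rewrite gE|by rewrite eE|by rewrite eE|].
move=> x.
have pa : (p < pgf X (1 - t))%R.
  rewrite -ltrN2 -(ltrD2l 1) -fE; apply: le_lt_trans (le_trans ft tq2) _.
  by rewrite ltr_pdivrMr// ltr_pMr// ltr1n.
rewrite (Ex_one_step_exp p01 K_geo x s01 pa); congr EFin.
have -> : pgf X (1 - t) = (1 - f t)%R by rewrite fE subKr.
by rewrite gE eE; congr (_ * _ * _ + (1 - _) * _ * _)%R; rewrite !mulrA.
Qed.

Hypothesis hirr : irreducible_chain P (branching I_ J_ K_ X_).

Lemma branching_irreducible x y : exists n,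
  0 < iter n (killed P (one_step 0) predT) (keep (pred1 y) (fun=> 1)) x.
Proof. by have [n Hn] := hirr x y; exists n; rewrite -branching_transition. Qed.
End branching_chain.

Theorem theorem3p1 (d : measure_display) (Omega : measurableType d)
    (R : realType) (P : probability Omega R)
    (I J K X : {RV P >-> nat})
    (I_ J_ K_ : nat -> {RV P >-> nat}) (X_ : nat -> nat -> {RV P >-> nat})
    (p : R) (hp : (0 < p < 1)%R)
    (hJ : P [set w | (0 < J w)%N] = 1)
    (hK : geometric_law P p K)
    (hvar : 0 < 'V_P[real_of X])
    (I_copy : forall n, same_law (I_ n) I)
    (J_copy : forall n, same_law (J_ n) J)
    (K_copy : forall n, same_law (K_ n) K)
    (X_copy : forall m n, (1 <= m)%N -> same_law (X_ m n) X)
    (indep : mutually_independent (innovations I_ J_ K_ X_))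
    (hI : P [set w | I w = 0%N] < 1)
    (hirr : irreducible_chain P (branching I_ J_ K_ X_))
    (hA : assumptionA P I J X) :
  [/\ (1 < theta P I J K X)%R ->
        transient_chain P (branching I_ J_ K_ X_),
      (0 < theta P I J K X <= 1)%R ->
        null_recurrent_chain P (branching I_ J_ K_ X_),
      theta P I J K X = 0%R -> assumptionB P I J X ->
        null_recurrent_chain P (branching I_ J_ K_ X_)
    & (theta P I J K X < 0)%R ->
        positive_recurrent_chain P (branching I_ J_ K_ X_)].
Proof.
have [J2 I2 EX X3] := hA.
have X2 : finite_moment P 2 X := finite_moment_le X3 (isT : (0 < 2 <= 3)%N).
have X1 : moment X 1 = 1%R.
  by have := moment_fin_mean X2; rewrite EX => -[].
have VX := variance_moment X2 EX.
pose b := ((moment X 2 - 1) / 2)%R.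
have b0 : (0 < b)%R by move: hvar; rewrite VX lte_fin => ?; rewrite divr_gt0.
pose c := (moment I 1 + moment J 1 - p / (1 - p))%R.
have thetaE : theta P I J K X = (c / b)%R.
  rewrite /theta VX (meanE I2)// (meanE J2)// (geometric_mean hp hK) -/c /b /=.
  by rewrite invf_div [RHS]mulrC.
pose f t := (1 - pgf X (1 - t))%R.
pose k t := (pgf J (1 - t) * ((1 - f t) * (1 - p) / (1 - f t - p)))%R.
pose g t := (k t * pgf I (1 - f t))%R.
pose e t := ((1 - k t) * pgf I p)%R.
have [cst [t0 [cst0 t00 t0p Hexp]]] := one_step_expansion I_copy J_copy K_copy X_copy
  indep hp hK b0 I2 J2 X3 X1 (fun t => erefl (f t)) (fun t => erefl (g t))
  (fun t => erefl (e t)).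
have hf t : (0 < t <= t0)%R -> _ := fun tr => let: And5 H _ _ _ _ := Hexp t tr in H.
have hg t : (0 < t <= t0)%R -> _ := fun tr => let: And5 _ H _ _ _ := Hexp t tr in H.
have he t : (0 < t <= t0)%R -> _ := fun tr => let: And5 _ _ H _ _ := Hexp t tr in H.
have heq t : (0 < t <= t0)%R -> _ := fun tr => let: And5 _ _ _ H _ := Hexp t tr in H.
have hT t x : (0 < t <= t0)%R -> _ := fun tr => let: And5 _ _ _ _ H := Hexp t tr in H x.
pose S := one_step I_ J_ K_ X_ 0.
have mS x : measurable_fun setT (S x).
  exact: (measurable_one_step I_copy J_copy K_copy X_copy indep).
have irr := branching_irreducible I_copy J_copy K_copy X_copy indep hirr.
have gam0 := moment_ge0 X 3.
have recurrent : (c <= b)%R -> forall y, return_probability P (branching I_ J_ K_ X_) y = 1.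
  move=> cb y; apply: (return_probability_eq1 I_copy J_copy K_copy X_copy indep).
  move=> eps eps0.
  exact: (pgf_recurrent mS irr hp b0 gam0 cst0 t00 t0p hf hg he hT cb).
have null : (0 <= c)%R -> (c <= b)%R -> null_recurrent_chain P (branching I_ J_ K_ X_).
  move=> c0 cb y; split; first exact: recurrent.
  rewrite (mean_return_timeE I_copy J_copy K_copy X_copy indep).
  apply: (pgf_not_positive mS irr hp b0 gam0 cst0 t00 t0p hf hg he hT _ c0 _ heq).
  have [cpos|cle] := ltP 0%R c; [by left|right].
  have /andP[p0 p1] := hp.
  have pr : (0 <= p <= 1)%R by rewrite !ltW.
  have /andP[i0 _] := pgf_range I pr.
  rewrite mulr_ge0//; have mu0 := moment_ge0 I 1.
  by move: cle; rewrite /c; clear - mu0; lra.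
split.
- rewrite thetaE ltr_pdivlMr// mul1r => bc y.
  have [eps eps0 H] := pgf_transient mS irr hp b0 gam0 cst0 t00 t0p hf hg he hT y bc.
  exact: (return_probability_lt1 I_copy J_copy K_copy X_copy indep eps0 H).
- rewrite thetaE ltr_pdivlMr// mul0r ler_pdivrMr// mul1r => /andP[c0 cb].
  by apply: null => //; exact: ltW.
- rewrite thetaE => /eqP; rewrite mulf_eq0 invr_eq0 (gt_eqF b0) orbF => /eqP c0 _.
  by apply: null; rewrite c0// ltW.
- rewrite thetaE ltr_pdivrMr// mul0r => c0 y.
  split; first by apply: recurrent; exact: le_trans (ltW c0) (ltW b0).
  rewrite (mean_return_timeE I_copy J_copy K_copy X_copy indep).
  have [M HM] := pgf_positive_recurrent mS irr hp b0 gam0 cst0 t00 t0p hf hg he hT y c0.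
  apply: (@le_lt_trans _ _ M%:E); last exact: ltry.
  apply: lime_le; first by apply: is_cvg_nneseries => n _ _; exact: survival_ge0.
  exact: nearW.
Qed.
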